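(* Let $(M,I_{|D|})$ be a manifold endowed with an elliptic divisor, and let $Y\subset D(k)$ be an irreducible component. Assume that we are given a holomorphic ideal $I_Y$ for $Y$ adapted to $I_{|D|}$, and let $p:\tilde M\to M$ be the blow-up of $I_Y$ in $M$. Then there exists an elliptic divisor $I_{|\tilde D|}$ on $\tilde M$ such that the blow-down map $p$ induces a fibre-wise isomorphism $$p_*:(\mathcal{A}_{|\tilde D|})_x\overset{\simeq}{\longrightarrow}(\mathcal{A}_{|D|})_{p(x)}\qquad\text{for all }x\in\tilde M .$$
   Context: **Elliptic divisors.** An elliptic divisor on $M^n$ is an ideal (sheaf) $I_{|D|}\subset C^\infty(M;\mathbb{R})$ such that around each point $q\in M$ there are coordinates $x_1,\dots,x_n$ centred at $q$ and an integer $k\ge0$ with $I_{|D|}=\langle r_1^2\cdots r_k^2\rangle$, $r_i^2=x_{2i-1}^2+x_{2i}^2$. The number $k$ is the multiplicity of $q$; $D$ is the vanishing locus; $D(k)$ is the set of points of multiplicity at least $k$. $D(k)$ is the image of an immersed submanifold $N\to M$ (with transverse self-intersections), and the images of the connected components of $N$ are the irreducible components of $D(k)$. The elliptic tangent bundle $\mathcal{A}_{|D|}\to M$ is the Lie algebroid whose sections are the vector fields preserving $I_{|D|}$; locally it is spanned by $r_i\partial_{r_i}=x_{2i-1}\partial_{x_{2i-1}}+x_{2i}\partial_{x_{2i}}$, $\partial_{\theta_i}=x_{2i-1}\partial_{x_{2i}}-x_{2i}\partial_{x_{2i-1}}$ ($i\le k$) and $\partial_{x_{2k+1}},\dots,\partial_{x_n}$.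 That $p$ induces $p_*$ means that $dp$ lifts to a Lie algebroid morphism $\mathcal{A}_{|\tilde D|}\to\mathcal{A}_{|D|}$ covering $p$. **Holomorphic ideals.** Let $Y\subset M^n$ be a closed embedded submanifold of codimension $2l$. A holomorphic ideal for $Y$ is a sheaf of ideals $I_Y\subset C^\infty(M;\mathbb{C})$ with $I_Y|_{M\setminus Y}=C^\infty(M;\mathbb{C})|_{M\setminus Y}$ and such that every $y\in Y$ has a neighbourhood $U$ with coordinates $(z_1,\dots,z_l,x_{2l+1},\dots,x_n):U\to\mathbb{C}^l\times\mathbb{R}^{n-2l}$ with $Y\cap U=\{z_1=\dots=z_l=0\}$ and $I_Y|_U=\langle z_1,\dots,z_l\rangle$. It is adapted to $I_{|D|}$ if around each point of $Y$ there are coordinates $(z_1,\dots,z_{k'},x_{2k'+1},\dots,x_n)$ on a neighbourhood $U$, $k'\ge l$, in which $Y\cap U=\{z_1=\dots=z_l=0\}$, $I_Y|_U=\langle z_1,\dots,z_l\rangle$ and $I_{|D|}|_U=\langle|z_1|^2\cdots|z_{k'}|^2\rangle$. (In particular, existence of a holomorphic ideal presupposes that $Y$ is closed and embedded.) **Blow-up.** A complex divisor is a locally principal ideal of $C^\infty(\cdot;\mathbb{C})$ locally generated by functions with nowhere dense zero set. The blow-up of $I_Y$ in $M$ is the manifold $\tilde M$ with map $p:\tilde M\to M$ (existing and unique up to isomorphism) such that $p^*I_Y$ is a divisor and every smooth $f:X\to M$ with $f^*I_Y$ a divisor factors uniquely through $p$. In local coordinates $(z_1,\dots,z_l,x_{2l+1},\dots,x_n):U\to\mathbb{C}^l\times\mathbb{R}^{n-2l}$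 with $Y\cap U=\{z_1=\dots=z_l=0\}$ and $I_Y|_U=\langle z_1,\dots,z_l\rangle$, it is the usual complex blow-up of $\{0\}$ in $\mathbb{C}^l$ times $\mathbb{R}^{n-2l}$. *)

(* Defs.v *)
From HB Require Import structures.
From mathcomp Require Import all_boot all_order all_algebra.
From mathcomp Require Import all_classical all_reals all_analysis.
From mathcomp Require Import complex.

Set Implicit Arguments.
Unset Strict Implicit.
Unset Printing Implicit Defensive.

Import Order.TTheory GRing.Theory Num.Theory numFieldNormedType.Exports.

Local Open Scope classical_set_scope.
Local Open Scope ring_scope.

(* Local data (functions, sections, vector fields) are represented by total
   functions of which only the germs matter: a predicate [P f x] on functions
   [f] and points [x] says that the germ of [f] at [x] has the property, and
   the sections over an open set [U] are the [f] with [P f x] for every [x] in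
   [U]. Every sheaf below is the sheaf of sections of such a predicate; the
   sheaf conditions are then automatic. *)

(** * Smooth manifolds *)

Fixpoint Ck (R : realType) (n k : nat) (f : 'rV[R]_n -> R) (u : 'rV[R]_n)
    : Prop :=
  match k with
  | 0 => \forall v \near u, {for v, continuous f}
  | k'.+1 => forall i : 'I_n,
      (\forall v \near u, derivable f v 'e_i) /\ Ck k' ('D_'e_i f) u
  end.

(* The neighbourhood is uniform in the order of differentiation. *)
Definition smooth_rV (R : realType) (n : nat) (f : 'rV[R]_n -> R)
    (u : 'rV[R]_n) : Prop :=
  \forall v \near u, forall k, Ck k f v.

(* [cmap] is only relevant on [cdom], and [cinv] on [cmap @` cdom]. *)
Record chart (R : realType) (n : nat) (T : topologicalType) := Chart {
  cdom : set T;
  cmap : T -> 'rV[R]_n;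
  cinv : 'rV[R]_n -> T
}.

Definition is_chart (R : realType) (n : nat) (T : topologicalType)
    (c : chart R n T) : Prop :=
  [/\ open (cdom c),
      open (cmap c @` cdom c),
      forall x, cdom c x -> cinv c (cmap c x) = x,
      forall x, cdom c x -> {for x, continuous (cmap c)} &
      forall x, cdom c x -> {for cmap c x, continuous (cinv c)}].

Definition smooth_transition (R : realType) (n : nat) (T : topologicalType)
    (c d : chart R n T) : Prop :=
  forall x, cdom c x -> cdom d x ->
  forall j, smooth_rV (fun u => cmap d (cinv c u) 0 j) (cmap c x).

Record manifold (R : realType) (n : nat) := Manifold {
  mcarrier :> topologicalType;
  atlas : set (chart R n mcarrier);
  manifold_hausdorff : hausdorff_space mcarrier;
  manifold_second_countable : @second_countable mcarrier;
  atlas_chart : forall c, atlas c -> is_chart c;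
  atlas_transition : forall c d, atlas c -> atlas d -> smooth_transition c d;
  atlas_cover : forall x : mcarrier, exists2 c, atlas c & cdom c x
}.

(* Members of the maximal atlas. *)
Definition coordinates (R : realType) (n : nat) (M : manifold R n)
    (c : chart R n M) : Prop :=
  is_chart c /\
  forall d, atlas d -> smooth_transition c d /\ smooth_transition d c.

Definition smooth (R : realType) (n : nat) (M : manifold R n) (f : M -> R)
    (x : M) : Prop :=
  forall c, atlas c -> cdom c x -> smooth_rV (f \o cinv c) (cmap c x).

Definition csmooth (R : realType) (n : nat) (M : manifold R n)
    (f : M -> R[i]) (x : M) : Prop :=
  smooth (fun y => complex.Re (f y)) x /\ smooth (fun y => complex.Im (f y)) x.

Definition smooth_map (R : realType) (m n : nat) (M : manifold R m)
    (N : manifold R n) (p : M -> N) : Prop :=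
  forall x, {for x, continuous p} /\
    forall c, atlas c -> cdom c (p x) ->
    forall j, smooth (fun y => cmap c (p y) 0 j) x.

(* Tangent vectors are derivations of the algebra of germs of smooth functions;
   the value on functions that are not smooth at [x] is irrelevant. *)
Definition tangent (R : realType) (n : nat) (M : manifold R n) (x : M)
    (v : (M -> R) -> R) : Prop :=
  [/\ forall f g, smooth f x -> (\forall y \near x, f y = g y) -> v f = v g,
      forall (a : R) f g, smooth f x -> smooth g x ->
        v (fun y => a * f y + g y) = a * v f + v g &
      forall f g, smooth f x -> smooth g x ->
        v (fun y => f y * g y) = v f * g x + f x * v g].

Definition immersion (R : realType) (m n : nat) (M : manifold R m)
    (N : manifold R n) (p : M -> N) : Prop :=
  smooth_map p /\
  forall x v, tangent x v ->
    (forall g, smooth g (p x) -> v (g \o p) = 0) ->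
    forall f, smooth f x -> v f = 0.

Definition vector_field (R : realType) (n : nat) (M : manifold R n)
    (X : M -> (M -> R) -> R) (x : M) : Prop :=
  \forall y \near x, tangent y (X y) /\
    forall f, smooth f y -> smooth (fun z => X z f) y.

(** * Sheaves of ideals *)

(* [I x f]: the germ of [f] at [x] lies in the stalk at [x] of the ideal. The
   coefficients are the germs satisfying [C] ([smooth] or [csmooth]). *)
Definition ideal_sheaf (T : topologicalType) (K : comNzRingType)
    (C : (T -> K) -> T -> Prop) (I : T -> set (T -> K)) : Prop :=
  forall x,
  [/\ forall f, I x f -> C f x /\ \forall y \near x, I y f,
      forall f g, I x f -> (\forall y \near x, f y = g y) -> I x g,
      I x (fun=> 0),
      forall f g, I x f -> I x g -> I x (fun y => f y + g y) &
      forall a f, C a x -> I x f -> I x (fun y => a y * f y)].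

(* I|_U = <g_0, ..., g_(m-1)>. *)
Definition generated (T : topologicalType) (K : comNzRingType)
    (C : (T -> K) -> T -> Prop) (U : set T) (m : nat) (g : 'I_m -> T -> K)
    (I : T -> set (T -> K)) : Prop :=
  forall x, U x -> forall f, I x f <->
    exists a : 'I_m -> T -> K, (forall i, C (a i) x) /\
      \forall y \near x, f y = \sum_i a i y * g i y.

(* The ideal p^*I generated by the f \o p for f in I; [C] refers to the
   source of p. *)
Definition pullback (S T : topologicalType) (K : comNzRingType)
    (C : (S -> K) -> S -> Prop) (p : S -> T) (I : T -> set (T -> K))
    : S -> set (S -> K) :=
  fun x f => exists (m : nat) (a : 'I_m -> S -> K) (g : 'I_m -> T -> K),
    (forall i, C (a i) x /\ I (p x) (g i)) /\
    \forall y \near x, f y = \sum_i a i y * g i (p y).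

Definition complex_divisor (R : realType) (n : nat) (M : manifold R n)
    (I : M -> set (M -> R[i])) : Prop :=
  ideal_sheaf (@csmooth R n M) I /\
  forall x, exists (U : set M) (g : M -> R[i]),
    [/\ open U, U x, forall y, U y -> csmooth g y,
        interior (closure (U `&` [set y | g y = 0])) = set0 &
        generated (@csmooth R n M) U (fun _ : 'I_1 => g) I].

(** * Elliptic divisors *)

(* The [j]-th coordinate, with numbering from 0; the default is never used,
   as the indices below satisfy [j < n]. *)
Definition coord (R : realType) (n : nat) (u : 'rV[R]_n) (j : nat) : R :=
  oapp (fun i : 'I_n => u 0 i) 0 (insub j).

Definition zcoord (R : realType) (n : nat) (u : 'rV[R]_n) (i : nat) : R[i] :=
  Complex (coord u i.*2) (coord u i.*2.+1).

(* r_i^2 = |z_i|^2 *)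
Definition rsq (R : realType) (n : nat) (u : 'rV[R]_n) (i : nat) : R :=
  coord u i.*2 ^+ 2 + coord u i.*2.+1 ^+ 2.

Definition elliptic_coordinates (R : realType) (n : nat) (M : manifold R n)
    (I : M -> set (M -> R)) (c : chart R n M) (k : nat) : Prop :=
  [/\ coordinates c, (k.*2 <= n)%N &
      generated (@smooth R n M) (cdom c)
        (fun (_ : 'I_1) y => \prod_(i < k) rsq (cmap c y) i) I].

Definition multiplicity (R : realType) (n : nat) (M : manifold R n)
    (I : M -> set (M -> R)) (q : M) (k : nat) : Prop :=
  exists c, [/\ cdom c q, cmap c q = 0 & elliptic_coordinates I c k].

Definition elliptic_divisor (R : realType) (n : nat) (M : manifold R n)
    (I : M -> set (M -> R)) : Prop :=
  ideal_sheaf (@smooth R n M) I /\ forall q, exists k, multiplicity I q k.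

Definition multiplicity_locus (R : realType) (n : nat) (M : manifold R n)
    (I : M -> set (M -> R)) (k : nat) : set M :=
  [set q | exists2 m, (k <= m)%N & multiplicity I q m].

(* iota presents D(k) as an immersed submanifold with transverse
   self-intersections: near each q, in coordinates with
   I = <r_0^2 ... r_(m-1)^2>, the preimage of the coordinate domain is the
   disjoint union of open sheets N_S, one for each k-element subset S of
   {0, ..., m-1}, and iota restricts to a homeomorphism from N_S onto
   {z_i = 0 for all i in S}. *)
Definition immersed_presentation (R : realType) (n : nat) (M : manifold R n)
    (I : M -> set (M -> R)) (k : nat) (N : manifold R (n - k.*2))
    (iota : N -> M) : Prop :=
  [/\ immersion iota,
      range iota = multiplicity_locus I k &
      forall q : M, exists (c : chart R n M) (m : nat) (sheet : N -> {set 'I_m}),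
        let slice (S : {set 'I_m}) : set M := [set y | cdom c y /\
              forall i, i \in S -> zcoord (cmap c y) i = 0] in
        let NS (S : {set 'I_m}) : set N := [set x | cdom c (iota x) /\ sheet x = S] in
        [/\ cdom c q,
            elliptic_coordinates I c m,
            forall x, cdom c (iota x) -> #|sheet x| = k,
            forall S : {set 'I_m}, open (NS S) &
            forall S : {set 'I_m}, #|S| = k ->
              [/\ {in NS S &, injective iota},
                  iota @` NS S = slice S &
                  forall x W, NS S x -> nbhs x W ->
                    \forall y \near iota x,
                      slice S y -> (iota @` (W `&` NS S)) y]]].

Definition irreducible_component (R : realType) (n : nat) (M : manifold R n)
    (I : M -> set (M -> R)) (k : nat) (Y : set M) : Prop :=
  exists (N : manifold R (n - k.*2)) (iota : N -> M),
    immersed_presentation I iota /\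
    exists x0 : N, Y = iota @` connected_component [set: N] x0.

(** * Holomorphic ideals and their blow-ups *)

(* On the domain of c, Y = {z_0 = ... = z_(l-1) = 0} and
   IY = <z_0, ..., z_(l-1)>. *)
Definition holomorphic_coordinates (R : realType) (n : nat)
    (M : manifold R n) (l : nat) (Y : set M) (IY : M -> set (M -> R[i]))
    (c : chart R n M) : Prop :=
  [/\ coordinates c, (l.*2 <= n)%N,
      forall x, cdom c x ->
        (Y x <-> forall i : 'I_l, zcoord (cmap c x) i = 0) &
      generated (@csmooth R n M) (cdom c)
        (fun (i : 'I_l) y => zcoord (cmap c y) i) IY].

(* The slice charts make the closed set Y an embedded submanifold of
   codimension 2l. *)
Definition holomorphic_ideal (R : realType) (n : nat) (M : manifold R n)
    (l : nat) (Y : set M) (IY : M -> set (M -> R[i])) : Prop :=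
  [/\ closed Y,
      ideal_sheaf (@csmooth R n M) IY,
      forall x, ~ Y x -> forall f, IY x f <-> csmooth f x &
      forall y, Y y -> exists2 c, cdom c y & holomorphic_coordinates l Y IY c].

Definition adapted (R : realType) (n : nat) (M : manifold R n) (l : nat)
    (Y : set M) (IY : M -> set (M -> R[i])) (I : M -> set (M -> R)) : Prop :=
  forall y, Y y -> exists (c : chart R n M) (k' : nat),
    [/\ cdom c y, (l <= k')%N, holomorphic_coordinates l Y IY c &
        elliptic_coordinates I c k'].

Definition blowup (R : realType) (n : nat) (M Mt : manifold R n)
    (IY : M -> set (M -> R[i])) (p : Mt -> M) : Prop :=
  [/\ smooth_map p,
      complex_divisor (pullback (@csmooth R n Mt) p IY) &
      forall (d : nat) (X : manifold R d) (f : X -> M), smooth_map f ->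
        complex_divisor (pullback (@csmooth R d X) f IY) ->
        exists! g : X -> Mt, smooth_map g /\ forall x, p (g x) = f x].

(** * Lie algebroids *)

(* A vector bundle, given by its fibres and its smooth sections
   ([section s x]: s is smooth near x); the local frames are equivalent to
   local trivializations. *)
Record vector_bundle (R : realType) (n : nat) (M : manifold R n) :=
  VectorBundle {
  fibre :> M -> lmodType R;
  rank : nat;
  section : (forall x, fibre x) -> M -> Prop;
  local_frame : forall x : M, exists e : 'I_rank -> forall y, fibre y,
    \forall y \near x,
      (forall v : fibre y, exists! a : 'I_rank -> R,
         v = \sum_i a i *: e i y) /\
      (forall s, section s y <->
         exists a : 'I_rank -> M -> R, (forall i, smooth (a i) y) /\
           \forall z \near y, s z = \sum_i a i z *: e i z)
}.

(* The bracket of sections is a total function, of which only the germs of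
   brackets of smooth sections matter. As each identity holds at every point
   near which the sections are smooth, it is an identity of germs. *)
Record lie_algebroid (R : realType) (n : nat) (M : manifold R n) :=
  LieAlgebroid {
  bundle :> vector_bundle M;
  anchor : forall x, bundle x -> (M -> R) -> R;
  bracket : (forall x, bundle x) -> (forall x, bundle x) ->
            forall x, bundle x;
  anchor_tangent : forall x (v : bundle x), tangent x (anchor v);
  anchor_linear : forall x (a : R) (v w : bundle x) f, smooth f x ->
    anchor (a *: v + w) f = a * anchor v f + anchor w f;
  anchor_smooth : forall s x, section s x ->
    vector_field (fun y => anchor (s y)) x;
  bracket_section : forall s t x, section s x -> section t x ->
    section (bracket s t) x;
  bracket_local : forall s s' t x, section s x -> section t x ->
    (\forall y \near x, s y = s' y) -> bracket s t x = bracket s' t x;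
  bracket_anti : forall s t x, section s x -> section t x ->
    bracket s t x = - bracket t s x;
  bracket_add : forall s s' t x, section s x -> section s' x -> section t x ->
    bracket (fun y => s y + s' y) t x = bracket s t x + bracket s' t x;
  bracket_jacobi : forall s t u x,
    section s x -> section t x -> section u x ->
    bracket s (bracket t u) x + bracket t (bracket u s) x
      + bracket u (bracket s t) x = 0;
  bracket_leibniz : forall (f : M -> R) s t x,
    smooth f x -> section s x -> section t x ->
    bracket s (fun y => f y *: t y) x
      = f x *: bracket s t x + anchor (s x) f *: t x;
  anchor_bracket : forall s t x f,
    section s x -> section t x -> smooth f x ->
    anchor (bracket s t x) f
      = anchor (s x) (fun y => anchor (t y) f)
        - anchor (t x) (fun y => anchor (s y) f)
}.

Definition preserves (R : realType) (n : nat) (M : manifold R n)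
    (I : M -> set (M -> R)) (X : M -> (M -> R) -> R) (x : M) : Prop :=
  \forall y \near x, forall f, I y f -> I y (fun z => X z f).

(* The anchor is an isomorphism from the sheaf of sections of A onto the sheaf
   of vector fields preserving I. *)
Definition elliptic_tangent_bundle (R : realType) (n : nat)
    (M : manifold R n) (I : M -> set (M -> R)) (A : lie_algebroid M) : Prop :=
  [/\ forall s x, section s x -> preserves I (fun y => anchor (s y : A y)) x,
      forall s x, section s x ->
        (\forall y \near x, forall f, smooth f y -> anchor (s y : A y) f = 0) ->
        \forall y \near x, s y = 0 &
      forall X x, vector_field X x -> preserves I X x ->
        exists2 s, section s x &
          \forall y \near x, forall f, smooth f y ->
            anchor (s y : A y) f = X y f].

(* Near x, Phi o s = sum_i a_i (t_i o p) as a section of p^*B. *)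
Definition decomposition (R : realType) (m n : nat) (M : manifold R m)
    (N : manifold R n) (A : vector_bundle M) (B : vector_bundle N)
    (p : M -> N) (Phi : forall x, A x -> B (p x)) (s : forall x, A x) (x : M)
    (r : nat) (a : 'I_r -> M -> R) (t : 'I_r -> forall y, B y) : Prop :=
  [/\ forall i, smooth (a i) x,
      forall i, section (t i) (p x) &
      \forall y \near x, Phi y (s y) = \sum_i a i y *: t i (p y)].

(* Lie algebroid morphisms covering p, in the sense of Higgins and
   Mackenzie. *)
Definition lie_algebroid_morphism (R : realType) (m n : nat)
    (M : manifold R m) (N : manifold R n) (A : lie_algebroid M)
    (B : lie_algebroid N) (p : M -> N) (Phi : forall x, A x -> B (p x))
    : Prop :=
  [/\ forall x (a : R) (v w : A x), Phi x (a *: v + w) = a *: Phi x v + Phi x w,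
      forall s x, section s x ->
        exists (r : nat) (a : 'I_r -> M -> R) (t : 'I_r -> forall y, B y),
          decomposition Phi s x a t,
      forall x (v : A x) g, smooth g (p x) ->
        anchor (Phi x v) g = anchor v (g \o p) &
      forall s s' x, section s x -> section s' x ->
      forall r (a : 'I_r -> M -> R) (t : 'I_r -> forall y, B y)
             r' (b : 'I_r' -> M -> R) (u : 'I_r' -> forall y, B y),
        decomposition Phi s x a t -> decomposition Phi s' x b u ->
        Phi x (bracket s s' x)
          = \sum_i \sum_j (a i x * b j x) *: bracket (t i) (u j) (p x)
            + \sum_j anchor (s x) (b j) *: u j (p x)
            - \sum_i anchor (s' x) (a i) *: t i (p x)].

(* Main.v *)
Require Import Defs.
From HB Require Import structures.
From mathcomp Require Import all_boot all_order all_algebra.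
From mathcomp Require Import all_classical all_reals all_analysis.
From mathcomp Require Import complex.
From mathcomp Require Import ring lra.

(* In adapted coordinates I_Y = <z_0, ..., z_(l-1)> and
   I_|D| = <|z_0|^2 ... |z_(k-1)|^2>. In the chart z_j = w_j, z_i = w_i w_j
   (i < l, i <> j) of the blow-up, p^*I_Y is generated by w_j and p^*I_|D| by
   |w_j|^(2(l-1)) |w_0|^2 ... |w_(k-1)|^2. Dropping the first factor, which does
   not depend on the chart up to units, gives I_|Dt|. The vector fields
   preserving I_|D| are the combinations of the complex fields z_i d/dz_i (i < k)
   and of the remaining coordinate fields. As z_i d/dz_i lifts to w_i d/dw_i for
   i <> j, and z_j d/dz_j to w_j d/dw_j - sum_(i < l, i <> j) w_i d/dw_i, lifting
   turns the local frame of A_|D| into a local frame of A_|Dt|. So p^*A_|D|, with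
   the lifted anchor and the bracket forced by the injectivity of the anchor on
   sections, is the elliptic tangent bundle of I_|Dt|, and p_* is the identity on
   fibres.

   The analytic input is a division theorem: if f |z_j|^2 = |z_i|^2 q with f, q
   smooth and i <> j, then |z_i|^2 divides f. It implies that a vector field X
   preserving I_|D| satisfies Re (conj(z_i) X z_i) = a |z_i|^2 with a smooth, and
   then X z_i = (a + ib) z_i. *)

Set Implicit Arguments.
Unset Strict Implicit.
Unset Printing Implicit Defensive.

Import Order.TTheory GRing.Theory Num.Theory numFieldNormedType.Exports.
Import Defs.

Local Open Scope classical_set_scope.
Local Open Scope ring_scope.

(** * Smooth functions on open subsets of R^n *)

(** [blowup] provides only a universal property, so charts on [Mt] have to be manufactured. A
    generator e of the pulled back ideal gives z_i = a_i e with some a_j nonzero at the given point;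
    the ratios a_i / a_j and the remaining coordinates form the candidate chart, and its inverse is
    the lift of the local model supplied by the universal property. The division theorem is not
    formal: smooth functions do not factor uniquely, and the two zero sets meet in codimension 4,
    across which the quotient and all its derivatives must be continued. The anchor of A_|D| is
    injective on sections but not on the fibres over D, and dp may degenerate on the exceptional
    locus. Hence the anchor at a point of [Mt] cannot be computed from a single vector: a whole
    local section is lifted, and the lift is unique because the complement of the exceptional locus
    is dense. *)

Lemma near_all (T : topologicalType) (J : finType) (P : J -> T -> Prop) (x : T) :
  (forall j, \forall y \near x, P j y) -> \forall y \near x, forall j, P j y.
Proof. by move=> xP; apply: filter_forall. Qed.

Lemma near_and (T : topologicalType) (P Q : T -> Prop) (x : T) :
  (\forall y \near x, P y) -> (\forall y \near x, Q y) ->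
  \forall y \near x, P y /\ Q y.
Proof. by move=> xP xQ; apply: filterI. Qed.

Lemma near_imp (T : topologicalType) (P Q : T -> Prop) (x : T) :
  (forall y, P y -> Q y) -> (\forall y \near x, P y) -> \forall y \near x, Q y.
Proof. by move=> PQ; apply: filterS. Qed.

Section Box.
Variables (R : realType) (n : nat).
Implicit Types (u v w : 'rV[R]_n) (A : set 'rV[R]_n).

(** Boxes rather than norm balls: they are stable under changing coordinates one at a time, which
    the axis-parallel arguments below exploit. *)
Definition box v (r : R) : set 'rV[R]_n :=
  [set w | forall i, `|w 0 i - v 0 i| < r].

Lemma nbhs_boxP v A :
  nbhs v A <-> exists2 r : R, 0 < r & forall w, box v r w -> A w.
Proof.
split=> [[P vP PA]|[r r0 rA]].
  have /choice[e eP] (i : 'I_n) : exists e : R, 0 < e /\ ball (v 0 i) e `<=` P 0 i.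
    by have /nbhs_ballP[e e0 eP] := vP 0 i; exists e.
  (* The initial value 1 keeps the radius defined and positive when there are no coordinates. *)
  exists (\big[Num.min/1]_i e i).
    by elim/big_ind: _ => // [x y x0 y0|i _]; [rewrite lt_min x0|have [] := eP i].
  move=> w vw; apply: PA => a i; rewrite ord1; have [_] := eP i; apply.
  rewrite /ball /= distrC; apply: lt_le_trans (vw i) _.
  by apply: bigmin_le_cond.
exists (fun _ i => ball (v 0 i) r) => [a i|w vw].
  by rewrite ord1; apply: nbhsx_ballx.
by apply: rA => i; rewrite distrC; apply: vw.
Qed.

Lemma open_box v r : open (box v r).
Proof.
rewrite openE => w vw; apply/nbhs_boxP.
exists (\big[Num.min/1]_i (r - `|w 0 i - v 0 i|)).
  elim/big_ind: _ => // [x y x0 y0|i _]; first by rewrite lt_min x0.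
  by rewrite subr_gt0; apply: vw.
move=> z wz i; have := wz i.
have -> : z 0 i - v 0 i = (z 0 i - w 0 i) + (w 0 i - v 0 i) by ring.
move=> zi; apply: le_lt_trans (ler_normD _ _) _; rewrite -ltrBrDr.
by apply: lt_le_trans zi _; apply: bigmin_le_cond.
Qed.

Lemma boxxx v r : 0 < r -> box v r v.
Proof. by move=> r0 i; rewrite subrr normr0. Qed.

Lemma box_nbhs v r w : box v r w -> nbhs w (box v r).
Proof. by move=> vw; apply: open_nbhs_nbhs; split=> //; exact: open_box. Qed.

Lemma nbhsx_box v r : 0 < r -> nbhs v (box v r).
Proof. by move=> r0; apply: box_nbhs; exact: boxxx. Qed.

Lemma row_continuous (T : topologicalType) (g : T -> 'rV[R]_n) (t : T) :
  (forall i, {for t, continuous (fun s => g s 0 i)}) -> {for t, continuous g}.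
Proof.
move=> ct A [P gP PA]; rewrite nbhs_simpl /=.
have : nbhs t [set s | forall i, P 0 i (g s 0 i)].
  apply: filter_forall => i; exact: (ct i _ (gP 0 i)).
by apply: filterS => s sP; apply: PA => a i; rewrite ord1.
Qed.

Lemma coord_cont v i : {for v, continuous (fun w : 'rV[R]_n => w 0 i)}.
Proof. exact: coord_continuous. Qed.

End Box.

Section Lines.
Variables (R : realType).

Lemma is_derive_cvgP (V : normedModType R) (f : V -> R) (x v : V) (d : R) :
  is_derive x v f d <->
  (fun h => h^-1 * (f (h *: v + x) - f x)) @ 0^' --> d.
Proof.
split=> [[dfx <-]|cf]; first exact: dfx.
by apply: DeriveDef; [apply/cvg_ex; exists d|apply/cvg_lim].
Qed.

Lemma is_derive_line (V : normedModType R) (f : V -> R) (v a : V) (s d : R) :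
  is_derive (v + s *: a) a f d <-> is_derive s 1 (fun t => f (v + t *: a)) d.
Proof.
rewrite !is_derive_cvgP.
suff -> : (fun h : R => h^-1 * (f (h *: a + (v + s *: a)) - f (v + s *: a))) =
  (fun h : R => h^-1 * (f (v + (h *: 1 + s) *: a) - f (v + s *: a))) by [].
by apply/funext => h; rewrite addrCA -scalerDl [h *: 1]mulr1.
Qed.

Lemma is_derive_continuous (f : R -> R) (t d : R) :
  is_derive t 1 f d -> {for t, continuous f}.
Proof. by move=> [df _]; apply/differentiable_continuous/derivable1_diffP. Qed.

(** Restriction to the segment reduces this to one variable. The derivative is required only in the
    interior, so that it may be unknown at an end point, as happens in [derive_ext]. *)
Lemma MVT_seg (V : normedModType R) (f : V -> R) (v w : V) (D : R -> R) :
  (forall t : R, 0 < t < 1 -> is_derive t 1 (fun s => f (v + s *: w)) (D t)) ->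
  (forall t : R, 0 <= t <= 1 -> {for v + t *: w, continuous f}) ->
  exists2 t : R, 0 < t < 1 & f (v + w) - f v = D t.
Proof.
move=> dD cf.
have dD' (t : R) : t \in `]0, 1[ -> is_derive t 1 (fun s => f (v + s *: w)) (D t).
  by rewrite in_itv /=; apply: dD.
have cf' : {within `[0, 1], continuous (fun s : R => f (v + s *: w))}.
  apply: continuous_in_subspaceT => t; rewrite inE /= in_itv /= => t01.
  apply: (@continuous_comp R V R (fun s : R => v + s *: w) f t); last exact: cf.
  by apply: cvgD; [exact: cvg_cst|apply: cvgZr_tmp; exact: cvg_id].
have [t t01 E] := MVT ltr01 dD' cf'.
by exists t => //; move: E; rewrite scale1r scale0r addr0 subr0 mulr1.
Qed.

Lemma is_derive_scale (V : normedModType R) (f : V -> R) (v a : V) (t s d : R) :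
  is_derive (v + (s * t) *: a) a f d ->
  is_derive s 1 (fun r => f (v + r *: (t *: a))) (t * d).
Proof.
move=> /is_derive_line df.
have dt : is_derive s 1 (fun r : R => r * t) t.
  have h : is_derive s 1 (@id R * cst t) (s *: 0 + t *: 1) by exact: is_deriveM.
  by apply: (is_derive_eq h); rewrite scaler0 add0r [LHS]mulr1.
rewrite mulrC.
have := @is_derive1_comp R (fun r => f (v + r *: a)) (fun r : R => r * t) s d t df dt.
by congr is_derive; apply/funext => r /=; rewrite scalerA.
Qed.

End Lines.

Lemma cont_distP (R : realType) (T : topologicalType) (f : T -> R) (x : T) :
  {for x, continuous f} <->
  forall e, 0 < e -> \forall y \near x, `|f x - f y| < e.
Proof. exact: cvgrPdist_lt. Qed.

(** * Chain rule for functions with continuous partial derivatives *)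

Section ChainRule.
Variables (R : realType) (m : nat).
Implicit Types (v w : 'rV[R]_m) (h : 'rV[R]_m -> R).

(** Axis-parallel walk from v to w in m steps: increments along it are controlled by partial
    derivatives alone. *)
Let hybrid v w (k : nat) : 'rV[R]_m := \row_j if (j < k)%N then w 0 j else v 0 j.

Let hybrid0 v w : hybrid v w 0 = v.
Proof. by apply/rowP => j; rewrite mxE ltn0. Qed.

Let hybridn v w : hybrid v w m = w.
Proof. by apply/rowP => j; rewrite mxE ltn_ord. Qed.

Let hybridS v w (j : 'I_m) :
  hybrid v w j.+1 = hybrid v w j + (w 0 j - v 0 j) *: 'e_j.
Proof.
apply/rowP => i; rewrite !mxE eqxx /= ltnS leq_eqVlt.
have [->|ij] := eqVneq i j; first by rewrite eqxx ltnn /= mulr1; ring.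
by rewrite -[_ == _ :> nat]/(i == j) (negPf ij) mulr0 addr0.
Qed.

Lemma box_hybrid v w r (j : 'I_m) t : 0 < r -> 0 <= t <= 1 ->
  box v r w -> box v r (hybrid v w j + t *: ((w 0 j - v 0 j) *: 'e_j)).
Proof.
move=> r0 /andP[t0 t1] vw i; rewrite !mxE eqxx /=.
have [->|ij] := eqVneq i j; last first.
  rewrite !mulr0 addr0; case: ifP => _; first exact: vw.
  by rewrite subrr normr0.
rewrite ltnn mulr1 [X in `|X|](_ : _ = t * (w 0 j - v 0 j)); last by ring.
rewrite normrM ger0_norm //.
by apply: le_lt_trans (vw j); rewrite ler_piMl.
Qed.

(* Caratheodory's form of differentiability, which makes the chain rule a limit
   of sums of products. *)
Lemma caratheodory h v :
  (forall i, \forall w \near v, derivable h w 'e_i) ->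
  (forall i, {for v, continuous ('D_'e_i h)}) ->
  (\forall w \near v, {for w, continuous h}) ->
  exists phi : 'I_m -> 'rV[R]_m -> R,
    (forall i, {for v, continuous (phi i)} /\ phi i v = 'D_'e_i h v) /\
    forall w, h w - h v = \sum_i phi i w * (w 0 i - v 0 i).
Proof.
move=> dh cdh ch.
(* Difference quotient along the i-th step of the walk; where that step is trivial, the partial
   derivative at v is the value that keeps it continuous at v. *)
pose phi i w := if w 0 i == v 0 i then 'D_'e_i h v else
  (h (hybrid v w i.+1) - h (hybrid v w i)) / (w 0 i - v 0 i).
exists phi; split=> [i|w]; last first.
  rewrite -[in LHS](hybridn v w) -[in X in _ - X](hybrid0 v w).
  rewrite -(@telescope_sumr _ 0 m (fun k => h (hybrid v w k))) // big_mkord.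
  apply: eq_bigr => i _; rewrite /phi; case: eqP => [wv|/eqP wv].
    by rewrite wv subrr mulr0 hybridS wv subrr scale0r addr0 subrr.
  by rewrite divfK // subr_eq0.
split; last by rewrite /phi eqxx.
apply/cont_distP => e e0.
have /nbhs_boxP[r1 r10 r1h] : \forall w \near v, (forall i, derivable h w 'e_i) /\
    {for w, continuous h} /\ forall i, `|'D_'e_i h v - 'D_'e_i h w| < e.
  apply: near_and; first exact: near_all.
  apply: near_and; first exact: ch.
  by apply: near_all => j; have /cont_distP := cdh j; apply.
apply: near_imp (nbhsx_box v r10) => w vw /=.
rewrite {1}/phi eqxx /phi; case: eqP => [_|/eqP wv]; first by rewrite subrr normr0.
set z := (w 0 i - v 0 i) *: 'e_i : 'rV[R]_m.
have H t : 0 <= t <= 1 -> box v r1 (hybrid v w i + t *: z).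
  by move=> t01; apply: box_hybrid.
(* By the mean value theorem the quotient is a partial derivative at a point of the same box, hence
   close to the one at v. *)
have [t /andP[t0 t1] E] : exists2 t : R, 0 < t < 1 &
    h (hybrid v w i + z) - h (hybrid v w i) =
    (w 0 i - v 0 i) * 'D_'e_i h (hybrid v w i + t *: z).
  apply: (@MVT_seg _ _ _ _ _
    (fun t => (w 0 i - v 0 i) * 'D_'e_i h (hybrid v w i + t *: z))) => t t01.
    apply: is_derive_scale; rewrite -scalerA; apply: derivableP.
    by case/andP: t01 => t0 t1; have [] := r1h _ (H t _); rewrite ?(ltW t0) ?ltW.
  by have [_ []] := r1h _ (H t t01).
rewrite hybridS E mulrAC divff ?subr_eq0 // mul1r.
have t01 : 0 <= t <= 1 by rewrite !ltW.
by have [_ [_ ]] := r1h _ (H t t01); apply.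
Qed.

Lemma chain_path h (g : R -> 'rV[R]_m) (t : R) (c : 'I_m -> R) :
  (forall i, \forall w \near g t, derivable h w 'e_i) ->
  (forall i, {for g t, continuous ('D_'e_i h)}) ->
  (\forall w \near g t, {for w, continuous h}) ->
  (forall i, is_derive t 1 (fun s => g s 0 i) (c i)) ->
  is_derive t 1 (h \o g) (\sum_i 'D_'e_i h (g t) * c i).
Proof.
move=> dh cdh ch dg; have [phi [cphi phiE]] := caratheodory dh cdh ch.
have cg : {for t, continuous g}.
  by apply: row_continuous => i; apply: is_derive_continuous (dg i).
apply/is_derive_cvgP => /=.
have -> : (fun s => s^-1 * (h (g (s *: 1 + t)) - h (g t))) =
    (fun s => \sum_i phi i (g (s *: 1 + t)) *
       (s^-1 * (g (s *: 1 + t) 0 i - g t 0 i))).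
  by apply/funext => s; rewrite phiE mulr_sumr; apply: eq_bigr => i _; ring.
apply: cvg_big => [|i _]; first exact: add_continuous.
apply: cvgM; last exact/is_derive_cvgP.
have [ci <-] := cphi i.
have -> : (fun s : R => phi i (g (s *: 1 + t))) = (phi i \o g) \o shift t.
  by apply/funext => s /=; rewrite [s *: 1]mulr1.
by apply/(continuous_withinNshiftx (phi i \o g) t)/continuous_comp.
Qed.

End ChainRule.

(** * Smoothness on open sets and its stability properties *)

Section Cinf.
Variables (R : realType).

Definition Cinf (n : nat) (U : set 'rV[R]_n) (f : 'rV[R]_n -> R) : Prop :=
  forall v, U v -> forall k, Ck k f v.

Lemma near_near (T : topologicalType) (P : T -> Prop) (x : T) :
  (\forall y \near x, P y) -> \forall y \near x, \forall z \near y, P z.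
Proof. exact: nbhs_interior. Qed.

Lemma near_here (T : topologicalType) (P : T -> Prop) (x : T) :
  (\forall y \near x, P y) -> P x.
Proof. exact: nbhs_singleton. Qed.

Lemma cont_near (T U : topologicalType) (f g : T -> U) (x : T) :
  (\forall y \near x, f y = g y) -> {for x, continuous f} -> {for x, continuous g}.
Proof.
move=> fg cf; rewrite /prop_for /continuous_at -(near_here fg).
by apply: cvg_trans cf; apply: near_eq_cvg; apply: near_imp fg.
Qed.

Lemma Ck_near n k (f g : 'rV[R]_n -> R) v :
  (\forall w \near v, f w = g w) -> Ck k f v -> Ck k g v.
Proof.
elim: k f g v => [|k IH] f g v fg /= fC.
  have := near_and (near_near fg) fC; apply: near_imp => w [+ cf].
  by move=> /cont_near; apply.
move=> i; have [df Df] := fC i; split.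
  have := near_and (near_near fg) df; apply: near_imp => w [].
  exact: near_eq_derivable.
apply: IH Df; have := near_near fg; apply: near_imp => w.
exact: near_eq_derive.
Qed.

Section Basics.
Variables (n : nat) (U : set 'rV[R]_n).
Hypothesis oU : open U.
Implicit Types f g : 'rV[R]_n -> R.

Lemma near_open v : U v -> \forall w \near v, U w.
Proof. by move=> Uv; apply: open_nbhs_nbhs. Qed.

(** Coinduction principle: [Ck] unfolds one derivative at a time, so if a family of functions
    continuous on U contains, up to equality on U, the partial derivatives of its members, then all
    members are smooth, by induction on the order. *)
Lemma Cinf_coind (P : ('rV[R]_n -> R) -> Prop) :
  (forall g, P g -> (forall v, U v -> {for v, continuous g}) /\
     forall i, exists g', P g' /\ forall v, U v -> is_derive v 'e_i g (g' v)) ->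
  forall g, P g -> Cinf U g.
Proof.
move=> Pstep g Pg v Uv k; elim: k g Pg v Uv => [|k IH] g Pg v Uv /=.
  by have := near_open Uv; apply: near_imp => w; have [cg _] := Pstep g Pg; apply: cg.
move=> i; have [_ /(_ i)[g' [Pg' dg]]] := Pstep g Pg; split.
  by have := near_open Uv; apply: near_imp => w /dg[].
apply: Ck_near (IH _ Pg' v Uv); have := near_open Uv; apply: near_imp => w /dg.
by case.
Qed.

Lemma Cinf_cont f v : Cinf U f -> U v -> {for v, continuous f}.
Proof. by move=> fU Uv; have /near_here := fU v Uv 0. Qed.

Lemma Cinf_derivable f i v : Cinf U f -> U v -> derivable f v 'e_i.
Proof. by move=> fU Uv; have [/near_here] := fU v Uv 1 i. Qed.

Lemma Cinf_is_derive f i v : Cinf U f -> U v -> is_derive v 'e_i f ('D_'e_i f v).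
Proof. by move=> fU Uv; apply: derivableP; exact: Cinf_derivable. Qed.

Lemma Cinf_derive f i : Cinf U f -> Cinf U ('D_'e_i f).
Proof. by move=> fU v Uv k; have [] := fU v Uv k.+1 i. Qed.

Lemma Cinf_eq f g : (forall v, U v -> f v = g v) -> Cinf U f -> Cinf U g.
Proof.
move=> fg fU v Uv k; apply: Ck_near (fU v Uv k).
by apply: near_imp (near_open Uv) => w /fg.
Qed.

Lemma Cinf_chain m (W : set 'rV[R]_m) (h : 'rV[R]_m -> R)
    (g dg : 'I_m -> 'rV[R]_n -> R) i v :
  open W -> Cinf W h -> W (\row_j g j v) ->
  (forall j, is_derive v 'e_i (g j) (dg j v)) ->
  is_derive v 'e_i (fun w => h (\row_j g j w))
    (\sum_j 'D_'e_j h (\row_j g j v) * dg j v).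
Proof.
move=> oW hW Wv dgv; rewrite -[v in is_derive v](addr0 v) -(scale0r 'e_i).
apply/is_derive_line.
have E : \row_j g j (v + 0 *: 'e_i) = \row_j g j v by rewrite scale0r addr0.
have := @chain_path R m h (fun t => \row_j g j (v + t *: 'e_i)) 0 (fun j => dg j v).
rewrite E; apply.
- move=> j; apply: near_imp (open_nbhs_nbhs (conj oW Wv)) => w Ww.
  by have [/near_here] := hW w Ww 1 j.
- by move=> j; have [_ /near_here] := hW _ Wv 1 j.
- exact: (hW _ Wv 0).
- move=> j; have -> : (fun s : R => (\row_j0 g j0 (v + s *: 'e_i)) 0 j) =
      (fun s : R => g j (v + s *: 'e_i)) by apply/funext => s; rewrite mxE.
  by apply/(is_derive_line (g j) v 'e_i 0); rewrite scale0r addr0; exact: dgv.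
Qed.

(* The closure of the smooth functions under the operations below is stable
   under partial derivatives, whence all its members are smooth. *)
Inductive smooth_closure : ('rV[R]_n -> R) -> Prop :=
| sc_base f : Cinf U f -> smooth_closure f
| sc_cst c : smooth_closure (cst c)
| sc_add f g : smooth_closure f -> smooth_closure g ->
    smooth_closure (fun v => f v + g v)
| sc_mul f g : smooth_closure f -> smooth_closure g ->
    smooth_closure (fun v => f v * g v)
| sc_inv f : smooth_closure f -> (forall v, U v -> f v != 0) ->
    smooth_closure (fun v => (f v)^-1)
| sc_comp m (W : set 'rV[R]_m) h (g : 'I_m -> 'rV[R]_n -> R) :
    open W -> Cinf W h -> (forall j, smooth_closure (g j)) ->
    (forall v, U v -> W (\row_j g j v)) ->
    smooth_closure (fun v => h (\row_j g j v)).

Lemma sc_sum m (g : 'I_m -> 'rV[R]_n -> R) :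
  (forall j, smooth_closure (g j)) -> smooth_closure (fun v => \sum_j g j v).
Proof.
move=> gj; elim: m g gj => [|m IH] g gj.
  have -> : (fun v => \sum_j g j v) = cst 0 by apply/funext => v; rewrite big_ord0.
  exact: sc_cst.
have -> : (fun v => \sum_j g j v) =
    (fun v => g ord0 v + \sum_j g (lift ord0 j) v).
  by apply/funext => v; rewrite big_ord_recl.
by apply: sc_add => //; apply: IH.
Qed.

Lemma smooth_closure_Cinf f : smooth_closure f -> Cinf U f.
Proof.
apply: Cinf_coind f => f; elim=> {f}.
- move=> f fU; split=> [v Uv|i]; first exact: Cinf_cont Uv.
  exists ('D_'e_i f); split; first exact/sc_base/Cinf_derive.
  by move=> v Uv; exact: Cinf_is_derive.
- move=> c; split=> [v _|i]; first exact: cst_continuous.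
  by exists (cst 0); split; [exact: sc_cst|move=> v _; exact: is_derive_cst].
- move=> f g scf [cf df] scg [cg dg]; split=> [v Uv|i].
    by apply: continuousD; [exact: cf|exact: cg].
  have [f' [scf' ff']] := df i; have [g' [scg' gg']] := dg i.
  exists (fun v => f' v + g' v); split; first exact: sc_add.
  by move=> v Uv; apply: is_deriveD; [exact: ff'|exact: gg'].
- move=> f g scf [cf df] scg [cg dg]; split=> [v Uv|i].
    by apply: continuousM; [exact: cf|exact: cg].
  have [f' [scf' ff']] := df i; have [g' [scg' gg']] := dg i.
  exists (fun v => f v * g' v + g v * f' v); split.
    by apply: sc_add; apply: sc_mul.
  by move=> v Uv; apply: is_deriveM; [exact: ff'|exact: gg'].
- move=> f scf [cf df] f0; split=> [v Uv|i].
    by apply: continuousV; [exact: f0|exact: cf].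
  have [f' [scf' ff']] := df i.
  (* The derivative - f' / f^2 of 1 / f is spelled with the operations of the closure, so that it
     visibly belongs to it. *)
  exists (fun v => -1 * (((f v)^-1 * (f v)^-1) * f' v)); split.
    by apply: sc_mul; [exact: sc_cst|apply: sc_mul => //; apply: sc_mul; exact: sc_inv].
  move=> v Uv; have dfv := ff' v Uv.
  apply: DeriveDef; first by apply: derivableV; [exact: f0|case: dfv].
  rewrite deriveV; [|exact: f0|by case: dfv].
  rewrite derive_val -[_ *: _]/(_ * _) mulN1r mulNr; congr (- (_ * _)).
  by rewrite -[in RHS]invfM -expr2.
- move=> m W h g oW hW gsc IH gW; split=> [v Uv|i].
    apply: (@continuous_comp 'rV[R]_n 'rV[R]_m R (fun v => \row_j g j v) h v); last first.
      by have /near_here := hW _ (gW v Uv) 0.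
    {
      apply: row_continuous => j; have [cg _] := IH j.
      have -> : (fun s => (\row_j g j s) 0 j) = g j by apply/funext => s; rewrite mxE.
      exact: cg.
    }
  have /choice[g' g'P] (j : 'I_m) := (IH j).2 i.
  exists (fun v => \sum_j 'D_'e_j h (\row_j g j v) * g' j v); split.
    apply: sc_sum => j; apply: sc_mul; last by have [] := g'P j.
    apply: (@sc_comp m W ('D_'e_j h) g oW _ gsc gW) => w Ww k.
    by have [] := hW w Ww k.+1 j.
  move=> v Uv; apply: (Cinf_chain oW hW); first exact: gW.
  by move=> j; have [_] := g'P j; apply.
Qed.

Lemma Cinf_cst c : Cinf U (cst c).
Proof. exact/smooth_closure_Cinf/sc_cst. Qed.

Lemma CinfD f g : Cinf U f -> Cinf U g -> Cinf U (fun v => f v + g v).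
Proof. by move=> fU gU; apply/smooth_closure_Cinf/sc_add; exact: sc_base. Qed.

Lemma CinfM f g : Cinf U f -> Cinf U g -> Cinf U (fun v => f v * g v).
Proof. by move=> fU gU; apply/smooth_closure_Cinf/sc_mul; exact: sc_base. Qed.

Lemma CinfV f : Cinf U f -> (forall v, U v -> f v != 0) -> Cinf U (fun v => (f v)^-1).
Proof. by move=> fU f0; apply/smooth_closure_Cinf/sc_inv => //; exact: sc_base. Qed.

Lemma CinfN f : Cinf U f -> Cinf U (fun v => - f v).
Proof.
move=> fU; apply: (@Cinf_eq (fun v => -1 * f v)) => [v _|]; first by rewrite mulN1r.
by apply: CinfM => //; exact: Cinf_cst.
Qed.

Lemma CinfB f g : Cinf U f -> Cinf U g -> Cinf U (fun v => f v - g v).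
Proof. by move=> fU gU; apply: CinfD => //; exact: CinfN. Qed.

Lemma CinfX f k : Cinf U f -> Cinf U (fun v => f v ^+ k).
Proof.
move=> fU; elim: k => [|k IH]; first exact: Cinf_cst.
apply: (@Cinf_eq (fun v => f v * f v ^+ k)); last exact: CinfM.
by move=> v _; rewrite exprS.
Qed.

Lemma Cinf_comp m (W : set 'rV[R]_m) h (g : 'I_m -> 'rV[R]_n -> R) :
  open W -> Cinf W h -> (forall j, Cinf U (g j)) ->
  (forall v, U v -> W (\row_j g j v)) -> Cinf U (fun v => h (\row_j g j v)).
Proof.
move=> oW hW gU gW; apply: smooth_closure_Cinf; apply: (sc_comp oW hW) => // j.
exact: sc_base.
Qed.

End Basics.

Lemma is_derive_coord n (v : 'rV[R]_n) (i j : 'I_n) :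
  is_derive v 'e_i (fun w : 'rV[R]_n => w 0 j) ((j == i)%:R).
Proof.
apply/is_derive_cvgP; apply: cvg_near_cst.
have : \forall h \near (0 : R)^', h != 0 by exact: nbhs_dnbhs_neq.
apply: filterS => h h0 /=.
by rewrite !mxE eqxx /= addrK mulrA mulVf // mul1r.
Qed.

Lemma Cinf_coord n (U : set 'rV[R]_n) (j : 'I_n) : open U ->
  Cinf U (fun w : 'rV[R]_n => w 0 j).
Proof.
move=> oU; pose P (f : 'rV[R]_n -> R) :=
  f = (fun w : 'rV[R]_n => w 0 j) \/ exists c, f = cst c.
apply: (Cinf_coind oU (P := P)); last by left.
move=> g [->|[c ->]]; split=> [v _|i].
- exact: coord_cont.
- exists (cst ((j == i)%:R)); split; first by right; exists ((j == i)%:R).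
  by move=> v _; exact: is_derive_coord.
- exact: cst_continuous.
- exists (cst 0); split; first by right; exists 0.
  by move=> v _; exact: is_derive_cst.
Qed.

End Cinf.

Lemma near_openP (T : topologicalType) (P : T -> Prop) (x : T) :
  (\forall y \near x, P y) -> exists U, [/\ open U, U x & forall y, U y -> P y].
Proof.
move=> xP; have : nbhs x P by [].
by rewrite nbhsE => -[U [oU Ux] UP]; exists U.
Qed.

Section SmoothRV.
Variables (R : realType) (n : nat).
Implicit Types (f g : 'rV[R]_n -> R) (u v : 'rV[R]_n).

Lemma Cinf_sub (U U' : set 'rV[R]_n) f : U' `<=` U -> Cinf U f -> Cinf U' f.
Proof. by move=> U'U fU v /U'U; exact: fU. Qed.

Lemma smooth_rVP f u :
  smooth_rV f u <-> exists U, [/\ open U, U u & Cinf U f].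
Proof.
split=> [|[U [oU Uu fU]]]; last by apply: near_imp (near_open oU Uu) => v /fU.
by move=> /near_openP[U [oU Uu UP]]; exists U; split=> // v /UP.
Qed.

Lemma Cinf_smooth (U : set 'rV[R]_n) f v : open U -> Cinf U f -> U v -> smooth_rV f v.
Proof. by move=> oU fU Uv; apply/smooth_rVP; exists U. Qed.

Lemma smooth_Cinf (U : set 'rV[R]_n) f :
  (forall v, U v -> smooth_rV f v) -> Cinf U f.
Proof. by move=> fU v /fU /near_here. Qed.

Lemma smooth_near f u : smooth_rV f u -> \forall v \near u, smooth_rV f v.
Proof. exact: near_near. Qed.

Lemma smooth_congr f g u :
  (\forall v \near u, f v = g v) -> smooth_rV f u -> smooth_rV g u.
Proof.
move=> fg fu; have := near_and (near_near fg) fu.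
by apply: near_imp => v [fgv fv] k; apply: Ck_near (fv k).
Qed.

Lemma smooth_cont f u : smooth_rV f u -> {for u, continuous f}.
Proof. by case/smooth_rVP => U [oU Uu fU]; apply: Cinf_cont Uu. Qed.

Lemma smooth_is_derive f u i : smooth_rV f u -> is_derive u 'e_i f ('D_'e_i f u).
Proof. by case/smooth_rVP => U [oU Uu fU]; apply: Cinf_is_derive Uu. Qed.

Lemma smooth_derive f u i : smooth_rV f u -> smooth_rV ('D_'e_i f) u.
Proof.
case/smooth_rVP => U [oU Uu fU]; apply/smooth_rVP; exists U; split=> //.
exact: Cinf_derive.
Qed.

Lemma smooth_rV_cst c u : smooth_rV (cst c) u.
Proof. by apply/smooth_rVP; exists setT; split=> //; [exact: openT|exact: (Cinf_cst openT)]. Qed.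

Let smooth2 f g u : smooth_rV f u -> smooth_rV g u ->
  exists U, [/\ open U, U u, Cinf U f & Cinf U g].
Proof.
move=> /smooth_rVP[U [oU Uu fU]] /smooth_rVP[W [oW Wu gW]].
exists (U `&` W); split=> //; first exact: openI.
  by apply: Cinf_sub fU => v [].
by apply: Cinf_sub gW => v [].
Qed.

Lemma smooth_rVD f g u : smooth_rV f u -> smooth_rV g u ->
  smooth_rV (fun v => f v + g v) u.
Proof.
move=> fu gu; have [U [oU Uu fU gU]] := smooth2 fu gu.
by apply/smooth_rVP; exists U; split=> //; exact: CinfD.
Qed.

Lemma smooth_rVM f g u : smooth_rV f u -> smooth_rV g u ->
  smooth_rV (fun v => f v * g v) u.
Proof.
move=> fu gu; have [U [oU Uu fU gU]] := smooth2 fu gu.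
by apply/smooth_rVP; exists U; split=> //; exact: CinfM.
Qed.

Lemma smooth_rVN f u : smooth_rV f u -> smooth_rV (fun v => - f v) u.
Proof.
move=> /smooth_rVP[U [oU Uu fU]].
by apply/smooth_rVP; exists U; split=> //; exact: CinfN.
Qed.

Lemma smooth_rVB f g u : smooth_rV f u -> smooth_rV g u ->
  smooth_rV (fun v => f v - g v) u.
Proof. by move=> fu gu; apply: smooth_rVD => //; exact: smooth_rVN. Qed.

Lemma smooth_rVX f k u : smooth_rV f u -> smooth_rV (fun v => f v ^+ k) u.
Proof.
move=> /smooth_rVP[U [oU Uu fU]].
by apply/smooth_rVP; exists U; split=> //; exact: CinfX.
Qed.

Lemma smooth_rV_sum (J : finType) (P : pred J) (g : J -> 'rV[R]_n -> R) u :
  (forall j, P j -> smooth_rV (g j) u) -> smooth_rV (fun v => \sum_(j | P j) g j v) u.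
Proof.
move=> gu; have -> : (fun v => \sum_(j | P j) g j v) = \sum_(j | P j) g j.
  by apply/funext => v; rewrite fct_sumE.
elim/big_ind: _ => //; first exact: smooth_rV_cst.
by move=> f h; exact: smooth_rVD.
Qed.

Lemma smooth_rV_prod (J : finType) (P : pred J) (g : J -> 'rV[R]_n -> R) u :
  (forall j, P j -> smooth_rV (g j) u) -> smooth_rV (fun v => \prod_(j | P j) g j v) u.
Proof.
move=> gu; have -> : (fun v => \prod_(j | P j) g j v) = \prod_(j | P j) g j.
  by apply/funext => v; rewrite fct_prodE.
elim/big_ind: _ => //; first exact: smooth_rV_cst.
by move=> f h; exact: smooth_rVM.
Qed.

Lemma neq0_near (T : topologicalType) (f : T -> R) (x : T) :
  {for x, continuous f} -> f x != 0 -> \forall y \near x, f y != 0.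
Proof.
move=> cf f0; have /cont_distP /(_ `|f x|) := cf; rewrite normr_gt0 => /(_ f0).
by apply: near_imp => y; apply: contraTneq => ->; rewrite subr0 ltxx.
Qed.

Lemma smooth_rVV f u : smooth_rV f u -> f u != 0 -> smooth_rV (fun v => (f v)^-1) u.
Proof.
move=> fu f0.
have /near_openP[U [oU Uu UP]] :=
  near_and (smooth_near fu) (neq0_near (smooth_cont fu) f0).
apply/smooth_rVP; exists U; split=> //; apply: CinfV => // [|v /UP[]//].
by apply: smooth_Cinf => v /UP[].
Qed.

Lemma smooth_rV_coord j u : smooth_rV (fun v => v 0 j) u.
Proof.
by apply/smooth_rVP; exists setT; split=> //; [exact: openT|exact: (Cinf_coord _ openT)].
Qed.

Lemma smooth_coord k u : smooth_rV (fun v => coord v k) u.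
Proof.
rewrite /coord; case: insub => [i|] /=; first exact: smooth_rV_coord.
exact: smooth_rV_cst.
Qed.

Lemma smooth_rsq i u : smooth_rV (fun v => rsq v i) u.
Proof. by apply: smooth_rVD; apply: smooth_rVX; exact: smooth_coord. Qed.

End SmoothRV.

Section SmoothRVComp.
Variables (R : realType) (n : nat).
Implicit Types (f g : 'rV[R]_n -> R) (u v : 'rV[R]_n).

Lemma smooth_rV_comp m (h : 'rV[R]_m -> R) (g : 'I_m -> 'rV[R]_n -> R) u :
  (forall j, smooth_rV (g j) u) -> smooth_rV h (\row_j g j u) ->
  smooth_rV (fun v => h (\row_j g j v)) u.
Proof.
move=> gu /smooth_rVP[W [oW Wu hW]].
have cg : {for u, continuous (fun v => \row_j g j v)}.
  apply: row_continuous => j.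
  have -> : (fun s => (\row_j g j s) 0 j) = g j by apply/funext => s; rewrite mxE.
  exact: smooth_cont.
have : \forall v \near u, (forall j, smooth_rV (g j) v) /\ W (\row_j g j v).
  apply: near_and; first by apply: near_all => j; exact: smooth_near.
  exact: (cg _ (near_open oW Wu)).
move=> /near_openP[U [oU Uu UP]]; apply/smooth_rVP; exists U; split=> //.
apply: (Cinf_comp oU oW hW) => [j|v /UP[]//].
by apply: smooth_Cinf => v /UP[].
Qed.

Lemma smooth_compr m (h : 'rV[R]_m -> R) (g : 'rV[R]_n -> 'rV[R]_m) u :
  (forall j, smooth_rV (fun v => g v 0 j) u) -> smooth_rV h (g u) ->
  smooth_rV (fun v => h (g v)) u.
Proof.
move=> gu hu; have E v : \row_j g v 0 j = g v by apply/rowP => j; rewrite mxE.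
have := @smooth_rV_comp m h (fun j v => g v 0 j) u gu; rewrite E => /(_ hu).
by congr smooth_rV; apply/funext => v; rewrite E.
Qed.

Lemma derive_coord k (i : 'I_n) u : 'D_'e_i (fun v => coord v k) u = (k == i :> nat)%:R.
Proof.
rewrite /coord; case: insubP => [j _ jk|nk] /=.
  by have [_ ->] := is_derive_coord u i j; rewrite -jk.
have [_ ->] : is_derive u 'e_i (cst (0 : R)) 0 := is_derive_cst _ _ _.
by case: eqP => // ki; move: nk; rewrite ki ltn_ord.
Qed.

Lemma coordE u (i : 'I_n) : coord u i = u 0 i.
Proof. by rewrite /coord valK. Qed.

Lemma coord_ge u k : (n <= k)%N -> coord u k = 0.
Proof. by move=> nk; rewrite /coord insubF // ltnNge nk. Qed.

End SmoothRVComp.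

(** * Extension of smooth functions across small sets *)

Section Extension.
Variables (R : realType) (n : nat).
Implicit Types (f g : 'rV[R]_n -> R) (u v w : 'rV[R]_n).

Lemma cont_box g v e : {for v, continuous g} -> 0 < e ->
  exists2 r, 0 < r & forall w, box v r w -> `|g v - g w| < e.
Proof. by move=> /cont_distP cg e0; apply/nbhs_boxP; exact: cg. Qed.

Lemma open_sub_box (U : set 'rV[R]_n) v : open U -> U v ->
  exists2 r, 0 < r & box v r `<=` U.
Proof. by move=> oU Uv; have /nbhs_boxP[r r0 rU] := near_open oU Uv; exists r. Qed.

Lemma box_le v r r' : r <= r' -> box v r `<=` box v r'.
Proof. by move=> rr' w vw i; apply: lt_le_trans rr'; exact: vw. Qed.

Lemma box_add v w r r' : (forall i, `|w 0 i| <= r') -> r' < r -> box v r (v + w).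
Proof. by move=> wr rr i; rewrite mxE addrAC subrr add0r; apply: le_lt_trans rr. Qed.

Lemma norm_unit_le (i j : 'I_n) (t r : R) : `|t| <= r -> `|(t *: 'e_i : 'rV[R]_n) 0 j| <= r.
Proof.
move=> tr; rewrite !mxE eqxx /=; case: eqP => _; rewrite ?mulr1 // mulr0 normr0.
exact: le_trans tr.
Qed.

(* Shifting the increment by [d] moves it into [O]; the mean value inequality
   there survives the limit [d -> 0] by continuity. *)
Lemma derive_ext (U O : set 'rV[R]_n) g gi i : open U ->
  (forall v, U v -> {for v, continuous g}) ->
  (forall v, U v -> {for v, continuous gi}) ->
  (forall v, U v -> O v -> is_derive v 'e_i g (gi v)) ->
  (forall v, ~ O v -> forall e : R, 0 < e -> exists d : 'rV[R]_n,
     (forall j, `|d 0 j| < e) /\ forall s : R, s != 0 -> O (v + d + s *: 'e_i)) ->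
  forall v, U v -> is_derive v 'e_i g (gi v).
Proof.
move=> oU cg cgi dg thick v Uv.
have [/(dg _ Uv)//|nOv] := pselect (O v).
apply/is_derive_cvgP/cvgrPdist_le => e e0.
have [r1 r10 r1U] := open_sub_box oU Uv.
have [r2 r20 r2P] := cont_box (cgi v Uv) e0.
pose r := Num.min r1 r2; have r0 : 0 < r by rewrite lt_min r10.
have rU : box v r `<=` U by move=> w /(box_le _) wr; apply/r1U/wr; rewrite ge_min lexx.
have rP w : box v r w -> `|gi v - gi w| <= e.
  by move=> /(box_le _) wr; apply/ltW/r2P/wr; rewrite ge_min lexx orbT.
have : \forall h \near (0 : R)^', h != 0 /\ `|h| < r / 2.
  have h1 : \forall h \near (0 : R)^', h != 0 by exact: nbhs_dnbhs_neq.
  have h2 : \forall h \near (0 : R)^', `|h| < r / 2 by apply: dnbhs0_lt; rewrite divr_gt0.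
  by apply: filterS2 h1 h2 => h.
apply: filterS => h [h0 hr].
suff H : `|g (v + h *: 'e_i) - g v - h * gi v| <= e * `|h|.
  rewrite (addrC (h *: _)); apply: (le_trans _ (_ : `|h|^-1 * (e * `|h|) <= _)).
    rewrite -normfV -[X in X <= _]normrN opprB.
    have -> : h^-1 * (g (v + h *: 'e_i) - g v) - gi v =
      h^-1 * (g (v + h *: 'e_i) - g v - h * gi v) by field.
    by rewrite normrM ler_wpM2l.
  by rewrite mulrCA mulVf ?mulr1 ?normr_eq0.
apply/ler_addgt0Pr => eta eta0.
have eta20 : 0 < eta / 2 by rewrite divr_gt0.
have Uh : U (v + h *: 'e_i).
  apply: rU; apply: (@box_add _ _ _ (r / 2)) => [j|]; last by lra.
  exact/norm_unit_le/ltW.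
have [s1 s10 s1P] := cont_box (cg v Uv) eta20.
have [s2 s20 s2P] := cont_box (cg _ Uh) eta20.
have m0 : 0 < Num.min (r / 2) (Num.min s1 s2) by rewrite !lt_min s10 s20 divr_gt0.
have [d [dm dO]] := thick v nOv _ m0.
have dr j : `|d 0 j| < r / 2 by have := dm j; rewrite lt_min => /andP[].
have d1 : box v s1 (v + d).
  by move=> j; rewrite mxE addrAC subrr add0r; have := dm j; rewrite !lt_min => /and3P[].
have d2 : box (v + h *: 'e_i) s2 (v + d + h *: 'e_i).
  move=> j; rewrite addrAC mxE addrAC subrr add0r.
  by have := dm j; rewrite !lt_min => /and3P[].
have Ht t : 0 <= t <= 1 -> box v r (v + d + t *: (h *: 'e_i)).
  move=> /andP[t0 t1] j; rewrite -addrA mxE addrAC subrr add0r mxE.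
  apply: le_lt_trans (ler_normD _ _) _; rewrite [r]splitr ltr_leD //.
  rewrite scalerA; apply: norm_unit_le; rewrite normrM ger0_norm //.
  by apply: le_trans (ltW hr); rewrite ler_piMl.
(* Interior points of the shifted segment lie in [O], since there the parameter t h is nonzero; at t
   = 0 this may fail. *)
have [t t01 E] : exists2 t : R, 0 < t < 1 & g (v + d + h *: 'e_i) - g (v + d) =
    h * gi (v + d + t *: (h *: 'e_i)).
  apply: (@MVT_seg _ _ _ _ _ (fun t => h * gi (v + d + t *: (h *: 'e_i)))) => t.
    move=> /andP[t0 t1]; apply: is_derive_scale; rewrite -scalerA.
    apply: dg; first by apply/rU/Ht; rewrite !ltW.
    by rewrite scalerA; apply: dO; rewrite mulf_neq0 // gt_eqF.
  by move=> t01; apply/cg/rU/Ht.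
have b1 := s1P _ d1; have b2 := s2P _ d2.
have b3 : `|h * gi (v + d + t *: (h *: 'e_i)) - h * gi v| <= e * `|h|.
  rewrite -mulrBr normrM mulrC ler_wpM2r // distrC; apply/rP/Ht.
  by case/andP: t01 => *; rewrite !ltW.
have -> : g (v + h *: 'e_i) - g v - h * gi v =
  (h * gi (v + d + t *: (h *: 'e_i)) - h * gi v) +
  ((g (v + h *: 'e_i) - g (v + d + h *: 'e_i)) - (g v - g (v + d))).
  by rewrite -E; ring.
apply: le_trans (ler_normD _ _) _; apply: lerD => //.
apply: le_trans (ler_normB _ _) _; rewrite [eta]splitr; apply: lerD; exact: ltW.
Qed.

(** Coinduction when the derivatives are known only on [O]. The condition on d says that the
    complement of [O] is thin: after a small shift, a line in direction e_i meets it at most at its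
    base point, so [derive_ext] applies. *)
Lemma Cinf_ext (U O : set 'rV[R]_n) (P : ('rV[R]_n -> R) -> Prop) : open U ->
  (forall v i, ~ O v -> forall e : R, 0 < e -> exists d : 'rV[R]_n,
     (forall j, `|d 0 j| < e) /\ forall s : R, s != 0 -> O (v + d + s *: 'e_i)) ->
  (forall g, P g -> (forall v, U v -> {for v, continuous g}) /\
     forall i, exists g', P g' /\ forall v, U v -> O v -> is_derive v 'e_i g (g' v)) ->
  forall g, P g -> Cinf U g.
Proof.
move=> oU thick Pstep; apply: (Cinf_coind oU) => g Pg.
have [cg dg] := Pstep g Pg; split=> // i; have [g' [Pg' dg']] := dg i.
exists g'; split=> //; apply: (derive_ext oU cg _ dg') => [|v nOv].
  by have [] := Pstep g' Pg'.
exact: thick.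
Qed.

End Extension.

(** * Symmetry of mixed partial derivatives *)

Section Schwarz.
Variables (R : realType) (n : nat) (U : set 'rV[R]_n).
Hypothesis oU : open U.
Implicit Types (f g : 'rV[R]_n -> R) (u v w : 'rV[R]_n).

Lemma MVT_unit f v i (t : R) : Cinf U f ->
  (forall s, 0 <= s <= 1 -> U (v + s *: (t *: 'e_i))) ->
  exists2 s : R, 0 < s < 1 &
    f (v + t *: 'e_i) - f v = t * 'D_'e_i f (v + s *: (t *: 'e_i)).
Proof.
move=> fU vU; apply: (@MVT_seg _ _ _ _ _ (fun s => t * 'D_'e_i f (v + s *: (t *: 'e_i)))).
  move=> s /andP[s0 s1]; apply: is_derive_scale; rewrite -scalerA.
  by apply: Cinf_is_derive fU _; apply: vU; rewrite !ltW.
by move=> s s01; apply: Cinf_cont fU _; exact: vU.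
Qed.

(** Two mean value theorems: in direction e_i for the difference of f in direction e_j, then in
    direction e_j for its derivative. With steps r / 3 the four corners stay in the box of radius
    r. *)
Let second_difference f v i j r : Cinf U f -> 0 < r -> box v r `<=` U ->
  exists2 w, box v r w & f (v + (r / 3) *: 'e_i + (r / 3) *: 'e_j) -
    f (v + (r / 3) *: 'e_i) - (f (v + (r / 3) *: 'e_j) - f v) =
    (r / 3) * ((r / 3) * 'D_'e_j ('D_'e_i f) w).
Proof.
move=> fU r0 rU; set s := r / 3; have s0 : 0 < s by rewrite divr_gt0.
have sn t : 0 <= t <= 1 -> `|t * s| <= s.
  case/andP=> t0 t1; rewrite normrM (gtr0_norm s0) (ger0_norm t0).
  by apply: ler_piMl => //; exact: ltW.
have bx t t' : 0 <= t <= 1 -> 0 <= t' <= 1 ->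
    box v r (v + t *: (s *: 'e_i) + t' *: (s *: 'e_j)).
  move=> t01 t'01; rewrite -addrA; apply: (@box_add _ _ _ _ _ (s + s)) => [k|].
    rewrite mxE; apply: le_trans (ler_normD _ _) _.
    by rewrite !scalerA; apply: lerD; apply: norm_unit_le; exact: sn.
  by rewrite /s; lra.
have I01 : 0 <= (1 : R) <= 1 by rewrite ler01 lexx.
have O01 : 0 <= (0 : R) <= 1 by rewrite lexx ler01.
have [t t01 E] : exists2 t : R, 0 < t < 1 &
    f (v + s *: 'e_i + s *: 'e_j) - f (v + s *: 'e_i) - (f (v + s *: 'e_j) - f v) =
    s * ('D_'e_i f (v + t *: (s *: 'e_i) + s *: 'e_j) - 'D_'e_i f (v + t *: (s *: 'e_i))).
  apply: (@MVT_seg _ _ (fun w => f (w + s *: 'e_j) - f w) v _ (fun t =>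
    s * ('D_'e_i f (v + t *: (s *: 'e_i) + s *: 'e_j) -
         'D_'e_i f (v + t *: (s *: 'e_i))))) => t /andP[t0 t1].
    have t01 : 0 <= t <= 1 by rewrite !ltW.
    rewrite mulrBr; apply: is_deriveB.
      have -> : (fun r0 : R => f (v + r0 *: (s *: 'e_i) + s *: 'e_j)) =
        (fun r0 : R => f ((v + s *: 'e_j) + r0 *: (s *: 'e_i))).
        by apply/funext => ?; rewrite addrAC.
      apply: is_derive_scale; rewrite -scalerA addrAC.
      by apply: Cinf_is_derive fU _; apply: rU; rewrite -[s *: 'e_j]scale1r; exact: bx.
    apply: is_derive_scale; rewrite -scalerA.
    apply: Cinf_is_derive fU _; apply: rU.
    by have := bx t 0 t01 O01; rewrite scale0r addr0.
  have t01 : 0 <= t <= 1 by rewrite t0.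
  apply: continuousB.
    apply: (@continuous_comp _ _ _ (fun w => w + s *: 'e_j) f).
      by apply: continuousD; [exact: cvg_id|exact: cst_continuous].
    by apply: Cinf_cont fU _; apply: rU; rewrite -[s *: 'e_j]scale1r; exact: bx.
  by apply: Cinf_cont fU _; apply: rU; have := bx t 0 t01 O01; rewrite scale0r addr0.
have t01' : 0 <= t <= 1 by case/andP: t01 => *; rewrite !ltW.
have := @MVT_unit ('D_'e_i f) (v + t *: (s *: 'e_i)) j s (Cinf_derive i fU).
case=> [t' t'01|t' t'01 E']; first by apply/rU/bx.
exists (v + t *: (s *: 'e_i) + t' *: (s *: 'e_j)); last by rewrite E E'.
by apply: bx => //; case/andP: t'01 => *; rewrite !ltW.
Qed.

Lemma schwarz f v i j : Cinf U f -> U v ->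
  'D_'e_i ('D_'e_j f) v = 'D_'e_j ('D_'e_i f) v.
Proof.
move=> fU Uv; apply/eqP; rewrite -subr_eq0 -normr_le0; apply/ler_addgt0Pr => e e0.
rewrite add0r; have e20 : 0 < e / 2 by rewrite divr_gt0.
have [r1 r10 r1U] := open_sub_box oU Uv.
have [r2 r20 r2P] := cont_box (Cinf_cont (Cinf_derive i (Cinf_derive j fU)) Uv) e20.
have [r3 r30 r3P] := cont_box (Cinf_cont (Cinf_derive j (Cinf_derive i fU)) Uv) e20.
have [r [r0 rr1 rr2 rr3]] : exists r : R, [/\ 0 < r, r <= r1, r <= r2 & r <= r3].
  exists (Num.min r1 (Num.min r2 r3)).
  by rewrite !lt_min !ge_min r10 r20 r30 !lexx !orbT.
have rU : box v r `<=` U by move=> w /(box_le rr1)/r1U.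
have [w1 vw1 E1] := second_difference i j fU r0 rU.
have [w2 vw2 E2] := second_difference j i fU r0 rU.
(* The second difference is symmetric in i and j, so the two mixed derivatives agree at some points
   w1 and w2 near v; continuity then forces equality at v. *)
have E : 'D_'e_j ('D_'e_i f) w1 = 'D_'e_i ('D_'e_j f) w2.
  have s0 : r / 3 != 0 by rewrite gt_eqF // divr_gt0.
  apply: (mulfI s0); apply: (mulfI s0).
  have sub4 (x y z w : R) : x - y - (z - w) = x - z - (y - w) by ring.
  by apply: etrans (esym E1) (etrans _ E2); rewrite sub4 (addrAC v).
have close (A B C D : R) : C = D -> `|A - D| < e / 2 -> `|B - C| < e / 2 -> `|A - B| <= e.
  move=> -> AD BD; have -> : A - B = (A - D) - (B - D) by ring.
  by apply: le_trans (ler_normB _ _) _; rewrite [e]splitr; apply: lerD; exact: ltW.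
exact: close E (r2P _ (box_le rr2 vw2)) (r3P _ (box_le rr3 vw1)).
Qed.

End Schwarz.

(** * Hadamard's lemma *)

Section Quotient.
Variables (R : realType) (n : nat).

(** A derivative of f / rho^k is again a numerator over a power of rho; this is what makes the class
    of quotients in Hadamard's lemma stable. *)
Lemma is_derive_quotient (f rho : 'rV[R]_n -> R) (v a : 'rV[R]_n) (df drho : R) (k : nat) :
  rho v != 0 -> is_derive v a f df -> is_derive v a rho drho ->
  is_derive v a (fun w => f w / rho w ^+ k)
    ((rho v * df - k%:R * drho * f v) / rho v ^+ k.+1).
Proof.
move=> rv dfv drv.
have rk0 : (rho ^+ k) v != 0 by rewrite fctE expf_neq0.
have drk : is_derive v a (rho ^+ k) (k%:R * rho v ^+ k.-1 * drho).
  by have := is_deriveX k drv; move=> h; apply: (is_derive_eq h); rewrite -mulr_natl -[_ *: _]/(_ * _).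
have dq : is_derive v a (fun w => ((rho ^+ k) w)^-1)
    (- (rho v ^+ k) ^- 2 * (k%:R * rho v ^+ k.-1 * drho)).
  apply: DeriveDef; first by apply: derivableV => //; case: drk.
  have ddrk : derivable (rho ^+ k) v a by case: drk.
  by rewrite (deriveV rk0 ddrk) derive_val fctE.
have := is_deriveM dfv dq.
have -> : f * (fun w => ((rho ^+ k) w)^-1) = (fun w => f w / rho w ^+ k).
  by apply/funext => w; rewrite /GRing.mul /= fctE.
move=> h; apply: (is_derive_eq h); rewrite -![_ *: _]/(_ * _) fctE.
(* For k = 0 the truncated exponent k.-1 is harmless because it comes with the factor 0. *)
case: k {rk0 drk dq h} => [|k] /=; first by rewrite expr0 expr1; field.
rewrite [rho v ^+ k.+2]exprS !exprS.
by field; rewrite rv expf_neq0.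
Qed.

End Quotient.

Section Hadamard.
Variables (R : realType) (n : nat) (U : set 'rV[R]_n) (m : 'I_n) (c : R).
Hypothesis oU : open U.
Implicit Types (f g : 'rV[R]_n -> R) (u v w : 'rV[R]_n).

Let D (f : 'rV[R]_n -> R) : 'rV[R]_n -> R := 'D_'e_m f.

Lemma Cinf_iter f j : Cinf U f -> Cinf U (iter j D f).
Proof. by move=> fU; elim: j => //= j IH; exact: Cinf_derive. Qed.

Lemma derive_eq_on f g i v : U v -> (forall w, U w -> f w = g w) ->
  'D_'e_i f v = 'D_'e_i g v.
Proof.
by move=> Uv fg; apply: near_eq_derive; apply: near_imp (near_open oU Uv) => w /fg.
Qed.

Lemma iterD_swap f j i v : Cinf U f -> U v ->
  iter j D ('D_'e_i f) v = 'D_'e_i (iter j D f) v.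
Proof.
move=> fU; elim: j v => //= j IH v Uv.
apply: (etrans (derive_eq_on m Uv IH)); apply: (schwarz oU) => //.
exact: Cinf_iter.
Qed.

(** Lagrange remainder along a line when the lower derivatives vanish at the start: one use of the
    mean value theorem lowers the order, and the induction hypothesis treats [D f]. *)
Lemma taylor_zero f a w (t : R) : Cinf U f -> (forall j, (j < a)%N -> iter j D f w = 0) ->
  (forall s : R, 0 <= s <= 1 -> U (w + (s * t) *: 'e_m)) ->
  exists2 s : R, 0 <= s <= 1 &
    f (w + t *: 'e_m) = t ^+ a / a`!%:R * iter a D f (w + (s * t) *: 'e_m).
Proof.
elim: a f t => [|a IH] f t fU f0 wU.
  by exists 1; rewrite ?ler01 ?lexx // expr0 fact0 divr1 !mul1r.
pose F (s : R) := f (w + (s * t) *: 'e_m).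
have dF (s : R) : 0 <= s <= 1 -> is_derive s 1 F (t * D f (w + (s * t) *: 'e_m)).
  move=> s01; have -> : F = (fun s => f (w + s *: (t *: 'e_m))).
    by apply/funext => r; rewrite /F scalerA.
  by apply: is_derive_scale; apply: Cinf_is_derive fU _; exact: wU.
have dG (s : R) : is_derive s 1 (fun r : R => r ^+ a.+1) (a.+1%:R * s ^+ a).
  apply: DeriveDef; first exact: exprn_derivable.
  by rewrite exp_derive -![_ *: _]/(_ * _) mulr1.
(* The function F r - F 1 * r^(a+1) vanishes at 0 and at 1, so Rolle's theorem expresses F 1 through
   the derivative of F at an interior point. *)
have dpsi (s : R) : 0 <= s <= 1 -> is_derive s 1 (fun r => F r - F 1 * r ^+ a.+1)
    (t * D f (w + (s * t) *: 'e_m) - F 1 * (a.+1%:R * s ^+ a)).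
  move=> s01; have dFs := dF s s01; have h := is_deriveZ (F 1) (dG s).
  exact: is_deriveB dFs h.
have cpsi : {within `[0, 1], continuous (fun r : R => F r - F 1 * r ^+ a.+1)}.
  apply: continuous_in_subspaceT => s; rewrite inE /= in_itv /= => s01.
  exact: is_derive_continuous (dpsi s s01).
have dpsi' (s : R) : s \in `]0, 1[ -> is_derive s 1 (fun r => F r - F 1 * r ^+ a.+1)
    (t * D f (w + (s * t) *: 'e_m) - F 1 * (a.+1%:R * s ^+ a)).
  by rewrite in_itv /= => /andP[s0 s1]; apply: dpsi; rewrite !ltW.
have F0 : F 0 = 0 by rewrite /F mul0r scale0r addr0; exact: (f0 0%N).
have [s] := MVT ltr01 dpsi' cpsi.
rewrite in_itv /= => /andP[s0 s1].
rewrite F0 expr1n mulr1 subrr expr0n /= mulr0 !subr0 mulr1 => /esym/eqP.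
rewrite subr_eq0 => /eqP E.
have rs01 (r : R) : 0 <= r <= 1 -> 0 <= r * s <= 1.
  case/andP=> r0 r1; apply/andP; split; first by apply: mulr_ge0 => //; exact: ltW.
  by apply: mulr_ile1 => //; exact: ltW.
have [|j ja|r /andP[r0 r1]|r /andP[r0 r1] E'] := IH (D f) (s * t).
- exact: Cinf_derive.
- by rewrite -[LHS]/(iter j D (D f) w) -iterSr; apply: f0.
- by rewrite mulrA; apply: wU; apply: rs01; rewrite r0.
exists (r * s); first by apply: rs01; rewrite r0.
move: E; rewrite E' {1}/F mul1r -iterSr (mulrA r) => E.
have sa0 : s ^+ a != 0 by rewrite expf_neq0 // gt_eqF.
have fa0 : (a`!%:R : R) != 0 by rewrite pnatr_eq0 -lt0n fact_gt0.
have a10 : (a.+1%:R : R) != 0 by rewrite pnatr_eq0.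
have -> : f (w + t *: 'e_m) =
    (f (w + t *: 'e_m) * (a.+1%:R * s ^+ a)) / (a.+1%:R * s ^+ a).
  by rewrite mulfK // mulf_neq0.
rewrite -E factS natrM exprMn exprS -[D (iter a D f)]/(iter a.+1 D f).
move: (iter a.+1 D f _) => Z; field.
by rewrite sa0 fa0 ?natr1 ?nat1r a10.
Qed.

(** The quotient by (x_m - c)^a, completed on the hyperplane by the Taylor coefficient, its only
    possible continuous value. *)
Let quot f a v : R :=
  if v 0 m == c then iter a D f v / a`!%:R else f v / (v 0 m - c) ^+ a.

Let vanishes f a := forall j, (j < a)%N -> forall v, U v -> v 0 m = c -> iter j D f v = 0.

Let quot_cont f a v : Cinf U f -> vanishes f a -> U v -> {for v, continuous (quot f a)}.
Proof.
move=> fU f0 Uv; have [vc|vc] := eqVneq (v 0 m) c; last first.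
  apply: (@cont_near _ _ (fun w => f w / (w 0 m - c) ^+ a)).
    have : \forall w \near v, (w : 'rV[R]_n) 0 m - c != 0.
      apply: (@neq0_near _ _ (fun w : 'rV[R]_n => w 0 m - c)); last by rewrite subr_eq0.
      by apply: continuousB; [exact: coord_cont|exact: cst_continuous].
    by apply: near_imp => w; rewrite subr_eq0 /quot => /negPf ->.
  apply: continuousM; first exact: Cinf_cont fU Uv.
  apply: smooth_cont; apply: smooth_rVV; last by rewrite expf_neq0 // subr_eq0.
  apply: smooth_rVX; apply: smooth_rVB; first exact: smooth_rV_coord.
  exact: smooth_rV_cst.
apply/cont_distP => e e0; apply/nbhs_boxP.
have fa0 : (0 : R) < a`!%:R by rewrite ltr0n fact_gt0.
have e'0 : 0 < e * a`!%:R by rewrite mulr_gt0.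
have [r1 r10 r1P] := cont_box (Cinf_cont (Cinf_iter a fU) Uv) e'0.
have [r2 r20 r2U] := open_sub_box oU Uv.
have [r [r0 rr1 rr2]] : exists r : R, [/\ 0 < r, r <= r1 & r <= r2].
  by exists (Num.min r1 r2); rewrite lt_min !ge_min r10 r20 !lexx orbT.
exists r => // w vw.
(* It suffices that each nearby value is a Taylor coefficient at a point of the same box: off the
   hyperplane this is the Lagrange remainder, starting from the projection [w0] of w to the
   hyperplane. *)
suff [z vz ->] : exists2 z, box v r z & quot f a w = iter a D f z / a`!%:R.
  rewrite /quot vc eqxx -mulrBl normrM normfV (gtr0_norm fa0) ltr_pdivrMr //.
  exact/r1P/(box_le rr1).
have [wc|wc] := eqVneq (w 0 m) c; first by exists w => //; rewrite /quot wc eqxx.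
pose w0 := w + (c - w 0 m) *: 'e_m.
have Ew : w = w0 + (w 0 m - c) *: 'e_m.
  by rewrite /w0 -addrA -scalerDl -opprB addNr scale0r addr0.
have bw0 (s : R) : 0 <= s <= 1 -> box v r (w0 + (s * (w 0 m - c)) *: 'e_m).
  move=> /andP[s0 s1] i; rewrite /w0 !mxE eqxx /=.
  have [->|im] := eqVneq i m; last by rewrite !mulr0 !addr0; exact: vw.
  rewrite !mulr1 vc [X in `|X|](_ : _ = s * (w 0 m - c)); last by ring.
  rewrite normrM ger0_norm //; apply: le_lt_trans (_ : `|w 0 m - v 0 m| < r); last exact: vw.
  by rewrite vc ler_piMl.
have [||s s01|s s01 E] := @taylor_zero f a w0 (w 0 m - c).
- exact: fU.
- move=> j ja; apply: f0 => //; last by rewrite /w0 !mxE !eqxx /=; ring.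
  by apply/r2U/(box_le rr2); have := bw0 0; rewrite mul0r scale0r addr0; apply; rewrite lexx ler01.
- exact/r2U/(box_le rr2)/bw0.
exists (w0 + (s * (w 0 m - c)) *: 'e_m); first exact: bw0.
have t0 : (w 0 m - c) ^+ a != 0 by rewrite expf_neq0 // subr_eq0.
rewrite /quot (negPf wc) {1}Ew E; move: (iter a D f _) => Z; move: t0 fa0.
by move: (_ ^+ a) (a`!%:R) => t' q t0 /gt_eqF/negbT q0; field; rewrite t0 q0.
Qed.

(** This is the numerator of the x_m-derivative of f / (x_m - c)^a. Its j-th derivative is (x_m - c)
    D^(j+1) f + (j - a) D^j f: on the hyperplane the first term vanishes, and the second does so for
    j < a because of f and for j = a because of its factor. *)
Let quot_vanish f a : Cinf U f -> vanishes f a ->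
  vanishes (fun v => (v 0 m - c) * D f v - a%:R * f v) a.+1.
Proof.
move=> fU f0.
have cD : Cinf U (D f) by exact: Cinf_derive.
have cx : Cinf U (fun v : 'rV[R]_n => v 0 m - c).
  by apply: CinfB => //; [exact: Cinf_coord|exact: Cinf_cst].
have E j v : U v -> iter j D (fun v => (v 0 m - c) * D f v - a%:R * f v) v =
    (v 0 m - c) * iter j.+1 D f v + (j%:R - a%:R) * iter j D f v.
  elim: j v => [|j IH] v Uv; first by rewrite /= sub0r mulNr.
  apply: (etrans (derive_eq_on m Uv IH)).
  have d1 := Cinf_is_derive m (Cinf_iter j.+1 fU) Uv.
  have d2 := Cinf_is_derive m (Cinf_iter j fU) Uv.
  have dx : is_derive v 'e_m (fun v : 'rV[R]_n => v 0 m - c) 1.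
    have := is_deriveB (is_derive_coord v m m) (is_derive_cst c v 'e_m).
    by move=> h; apply: (is_derive_eq h); rewrite eqxx subr0.
  have := is_deriveD (is_deriveM dx d1) (is_deriveZ (j%:R - a%:R) d2).
  case=> _ E; apply: (etrans E); rewrite -![_ *: _]/(_ * _).
  rewrite -[iter j.+2 D f v]/('D_'e_m (iter j.+1 D f) v).
  rewrite -['D_'e_m (iter j D f) v]/(iter j.+1 D f v) -natr1.
  by move: ('D_'e_m _ v) (iter j.+1 D f v) => A B; ring.
move=> j; rewrite ltnS leq_eqVlt => ja v Uv vc; rewrite E // vc subrr mul0r add0r.
case/orP: ja => [/eqP ->|ja]; first by rewrite subrr mul0r.
by rewrite f0 // mulr0.
Qed.

(** In direction e_m the exponent rises by one. In the other directions only the numerator is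
    differentiated; it still vanishes to order a because mixed derivatives commute and the direction
    is tangent to the hyperplane. *)
Let quot_derive f a i : Cinf U f -> vanishes f a -> exists g b, [/\ Cinf U g,
  vanishes g b & forall v, U v -> v 0 m != c -> is_derive v 'e_i (quot f a) (quot g b v)].
Proof.
move=> fU f0.
have Q v : U v -> v 0 m != c -> is_derive v 'e_i (quot f a)
   (((v 0 m - c) * 'D_'e_i f v - a%:R * (m == i)%:R * f v) / (v 0 m - c) ^+ a.+1).
  move=> Uv vc.
  have dx : is_derive v 'e_i (fun v : 'rV[R]_n => v 0 m - c) (m == i)%:R.
    have := is_deriveB (is_derive_coord v i m) (is_derive_cst c v 'e_i).
    by move=> h; apply: (is_derive_eq h); rewrite subr0.
  have := @is_derive_quotient R n f _ v 'e_i _ _ a _ (Cinf_is_derive i fU Uv) dx.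
  rewrite subr_eq0 => /(_ vc); apply: near_eq_is_derive.
  have : \forall w \near v, (w : 'rV[R]_n) 0 m - c != 0.
    apply: (@neq0_near _ _ (fun w : 'rV[R]_n => w 0 m - c)); last by rewrite subr_eq0.
    by apply: continuousB; [exact: coord_cont|exact: cst_continuous].
  by apply: near_imp => w; rewrite subr_eq0 /quot => /negPf ->.
have [mi|mi] := eqVneq m i.
  subst i.
  exists (fun v => (v 0 m - c) * D f v - a%:R * f v), a.+1; split.
  - apply: CinfB => //; apply: CinfM => //; [|exact: Cinf_derive|exact: Cinf_cst].
    by apply: CinfB => //; [exact: Cinf_coord|exact: Cinf_cst].
  - exact: quot_vanish.
  - move=> v Uv vc; rewrite {2}/quot (negPf vc).
    by apply: (is_derive_eq (Q v Uv vc)); rewrite eqxx mulr1.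
exists ('D_'e_i f), a; split; first exact: Cinf_derive.
- move=> j ja v Uv vc; rewrite iterD_swap //.
  have /is_derive_line : is_derive (v + 0 *: 'e_i) 'e_i (iter j D f)
      ('D_'e_i (iter j D f) v).
    by rewrite scale0r addr0; apply: Cinf_is_derive Uv; exact: Cinf_iter.
  have cv : {for (0 : R), continuous (fun t : R => v + t *: 'e_i)}.
    by apply: cvgD; [exact: cvg_cst|apply: cvgZr_tmp; exact: cvg_id].
  have Z : \forall t \near (0 : R), iter j D f (v + t *: 'e_i) = cst 0 t.
    have : \forall t \near (0 : R), U (v + t *: 'e_i).
      by apply: cv; rewrite scale0r addr0; exact: near_open.
    by apply: near_imp => t Ut; apply: f0 => //; rewrite !mxE (negPf mi) andbF mulr0 addr0.
  by move=> /(near_eq_is_derive Z)[_ <-]; rewrite derive_cst.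
- move=> v Uv vc; rewrite {2}/quot (negPf vc).
  apply: (is_derive_eq (Q v Uv vc)); rewrite (negPf mi) mulr0 mul0r subr0 exprS.
  by rewrite -mulf_div divff ?mul1r // subr_eq0.
Qed.

(** The completed quotients are continuous and, off the hyperplane, stable under partial
    derivatives, so [Cinf_ext] makes all of them smooth; the claim is the case a = 1. *)
Lemma hadamard_Cinf f : Cinf U f -> (forall v, U v -> v 0 m = c -> f v = 0) ->
  exists2 g, Cinf U g & forall v, U v -> f v = (v 0 m - c) * g v.
Proof.
move=> fU f0; exists (quot f 1); last first.
  move=> v Uv; rewrite /quot; case: eqP => [vc|/eqP vc].
    by rewrite f0 // vc subrr mul0r.
  by rewrite expr1 mulrC divfK // subr_eq0.
pose P g := exists f a, [/\ Cinf U f, vanishes f a & g = quot f a].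
apply: (@Cinf_ext R n U [set v | v 0 m != c] P oU).
- move=> v i /= /negP; rewrite negbK => /eqP vc e e0.
  (* Lines in direction e_m leave the hyperplane at once and need no shift; lines parallel to the
     hyperplane are moved off it along e_m. *)
  have [->|mi] := eqVneq i m.
    exists 0; split=> [j|s s0]; first by rewrite mxE normr0.
    by rewrite addr0 !mxE !eqxx /= mulr1 vc -subr_eq0 addrAC subrr add0r.
  exists ((e / 2) *: 'e_m); split=> [j|s s0].
    apply: le_lt_trans (norm_unit_le _ _ (lexx _)) _.
    by rewrite gtr0_norm ?divr_gt0 //; lra.
  have im : (m == i) = false by rewrite eq_sym (negPf mi).
  rewrite !mxE !eqxx /= im mulr1 mulr0 addr0 vc.
  by rewrite -subr_eq0 addrAC subrr add0r gt_eqF // divr_gt0.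
- move=> _ [f' [a [f'U f'0 ->]]]; split=> [v|i]; first exact: quot_cont.
  have [g [b [gU g0 dg]]] := quot_derive i f'U f'0.
  by exists (quot g b); split; [exists g, b|exact: dg].
- exists f, 1%N; split=> // j; rewrite ltnS leqn0 => /eqP -> /=; exact: f0.
Qed.

End Hadamard.

Lemma hadamard (R : realType) (n : nat) (f : 'rV[R]_n -> R) (u : 'rV[R]_n)
    (m : 'I_n) (c : R) :
  smooth_rV f u -> (\forall v \near u, (v : 'rV[R]_n) 0 m = c -> f v = 0) ->
  exists2 g, smooth_rV g u &
    \forall v \near u, f v = ((v : 'rV[R]_n) 0 m - c) * g v.
Proof.
move=> fu f0; have /near_openP[U [oU Uu UP]] := near_and (smooth_near fu) f0.
have fU : Cinf U f by apply: smooth_Cinf => v /UP[].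
have [|g gU fg] := @hadamard_Cinf R n U m c oU f fU; first by move=> v /UP[].
exists g; first exact: Cinf_smooth gU Uu.
by apply: near_imp (near_open oU Uu) => v /fg.
Qed.

(** * Division by |z_i|^2 *)

Lemma near_true (T : topologicalType) (P : T -> Prop) (x : T) :
  (forall y, P y) -> \forall y \near x, P y.
Proof. exact: nearW. Qed.

Section Vanishing.
Variables (R : realType) (n : nat) (a b : 'I_n).
Hypothesis ab : a != b.
Implicit Types (f g h : 'rV[R]_n -> R) (u v w : 'rV[R]_n).

Definition rho (a b : 'I_n) (v : 'rV[R]_n) : R := v 0 a ^+ 2 + v 0 b ^+ 2.

Lemma rho_eq0 (i j : 'I_n) v : (rho i j v == 0) = (v 0 i == 0) && (v 0 j == 0).
Proof. by rewrite paddr_eq0 ?sqr_ge0 // !sqrf_eq0. Qed.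

Lemma smooth_rho (i j : 'I_n) v : smooth_rV (rho i j) v.
Proof. by apply: smooth_rVD; apply: smooth_rVX; exact: smooth_rV_coord. Qed.

(* [f] vanishes to order [k] at [v] in the directions [a] and [b]. *)
Fixpoint vanish (k : nat) f v : Prop :=
  if k is k'.+1 then
    [/\ f v = 0, vanish k' ('D_'e_a f) v & vanish k' ('D_'e_b f) v]
  else True.

Lemma vanish_congr k f g v : (\forall w \near v, f w = g w) -> vanish k f v -> vanish k g v.
Proof.
elim: k f g => //= k IH f g fg [f0 fa fb].
have E i : \forall w \near v, 'D_'e_i f w = 'D_'e_i g w.
  by have := near_near fg; apply: near_imp => w; exact: near_eq_derive.
by split; [rewrite -(near_here fg)|exact: IH fa|exact: IH fb].
Qed.

Lemma vanishD k f g v : smooth_rV f v -> smooth_rV g v ->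
  vanish k f v -> vanish k g v -> vanish k (fun w => f w + g w) v.
Proof.
elim: k f g => //= k IH f g sf sg [f0 fa fb] [g0 ga gb].
have E i : \forall w \near v, 'D_'e_i f w + 'D_'e_i g w = 'D_'e_i (fun w => f w + g w) w.
  have := near_and (smooth_near sf) (smooth_near sg); apply: near_imp => w [sfw sgw].
  by have [_ <-] := is_deriveD (smooth_is_derive i sfw) (smooth_is_derive i sgw).
split; first by rewrite f0 g0 addr0.
- by apply: vanish_congr (E a) _; apply: IH => //; exact: smooth_derive.
- by apply: vanish_congr (E b) _; apply: IH => //; exact: smooth_derive.
Qed.

Lemma vanishZ k c f v : smooth_rV f v -> vanish k f v -> vanish k (fun w => c * f w) v.
Proof.
elim: k f => //= k IH f sf [f0 fa fb].
have E i : \forall w \near v, c * 'D_'e_i f w = 'D_'e_i (fun w => c * f w) w.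
  have := smooth_near sf; apply: near_imp => w sfw.
  by have [_ Ec] := is_deriveZ c (smooth_is_derive i sfw); exact: esym Ec.
split; first by rewrite f0 mulr0.
- by apply: vanish_congr (E a) _; apply: IH => //; exact: smooth_derive.
- by apply: vanish_congr (E b) _; apply: IH => //; exact: smooth_derive.
Qed.

(** By the product rule a partial derivative of x_j h is a multiple of h plus x_j times a derivative
    of h; the induction hypothesis raises the order of the latter. *)
Lemma vanish_coord k j h v : smooth_rV h v -> v 0 j = 0 ->
  vanish k h v -> vanish k.+1 (fun w => w 0 j * h w) v.
Proof.
move=> + vj; elim: k h => [|k IH] h sh hk; first by split=> //; rewrite vj mul0r.
have E i : \forall w \near v, (j == i)%:R * h w + w 0 j * 'D_'e_i h w =
    'D_'e_i (fun w => w 0 j * h w) w.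
  have := smooth_near sh; apply: near_imp => w shw.
  have [_ ] := is_deriveM (is_derive_coord w i j) (smooth_is_derive i shw).
  rewrite -![_ *: _]/(_ * _) => E; apply: etrans (esym E).
  by rewrite [RHS]addrC mulrC.
have sd i : smooth_rV ('D_'e_i h) v by exact: smooth_derive.
have sx : smooth_rV (fun w => w 0 j) v by exact: smooth_rV_coord.
split; first by rewrite vj mul0r.
- apply: vanish_congr (E a) _; apply: vanishD.
  + by apply: smooth_rVM => //; exact: smooth_rV_cst.
  + exact: smooth_rVM.
  + exact: vanishZ.
  + by apply: IH => //; case: hk.
- apply: vanish_congr (E b) _; apply: vanishD.
  + by apply: smooth_rVM => //; exact: smooth_rV_cst.
  + exact: smooth_rVM.
  + exact: vanishZ.
  + by apply: IH => //; case: hk.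
Qed.

Lemma vanish_rho k h v : smooth_rV h v -> rho a b v = 0 ->
  vanish k h v -> vanish k.+2 (fun w => rho a b w * h w) v.
Proof.
move=> sh /eqP; rewrite rho_eq0 => /andP[/eqP va /eqP vb] hk.
have sx j : smooth_rV (fun w => w 0 j) v by exact: smooth_rV_coord.
apply: (@vanish_congr _ (fun w => w 0 a * (w 0 a * h w) + w 0 b * (w 0 b * h w))).
  by apply: near_true => w; rewrite /rho; ring.
by apply: vanishD; do ?[apply: vanish_coord|apply: smooth_rVM] => //.
Qed.

Lemma vanish_rhoX k h v : smooth_rV h v -> rho a b v = 0 ->
  vanish (k + k) (fun w => rho a b w ^+ k * h w) v.
Proof.
move=> sh v0; elim: k => [//|k IH]; rewrite addSn addnS.
apply: (@vanish_congr _ (fun w => rho a b w * (rho a b w ^+ k * h w))).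
  by apply: near_true => w; rewrite exprS mulrA.
by apply: vanish_rho => //; apply: smooth_rVM => //; apply: smooth_rVX; exact: smooth_rho.
Qed.

Variable (U : set 'rV[R]_n).
Hypothesis oU : open U.

Lemma cont_eq0 f v : {for v, continuous f} ->
  (forall e : R, 0 < e -> exists2 w, box v e w & f w = 0) -> f v = 0.
Proof.
move=> cf f0; apply/eqP; rewrite -normr_le0; apply/ler_addgt0Pr => e e0.
have [r r0 rP] := cont_box cf e0; have [w vw fw] := f0 _ r0.
by rewrite add0r; have := rP w vw; rewrite fw subr0 => /ltW.
Qed.

(** All derivatives involved are continuous. This carries vanishing from the points where a quotient
    is known to be smooth to their limits. *)
Lemma vanish_closed k f v : Cinf U f -> U v ->
  (forall e : R, 0 < e -> exists2 w, box v e w & vanish k f w) -> vanish k f v.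
Proof.
elim: k f => //= k IH f fU Uv fk; split.
- apply: cont_eq0; first exact: Cinf_cont Uv.
  by move=> e /fk[w vw []]; exists w.
- by apply: IH => //; [exact: Cinf_derive|move=> e /fk[w vw []]; exists w].
- by apply: IH => //; [exact: Cinf_derive|move=> e /fk[w vw []]; exists w].
Qed.

(** Taylor estimate transverse to the subspace x_a = x_b = 0, by induction on k: one mean value step
    along e_a and one along e_b lead from the projection of v to v, and each increment gains a
    factor max(|x_a|, |x_b|). *)
Lemma vanish_bound k f s : Cinf U f -> U s -> rho a b s = 0 ->
  (forall v, U v -> rho a b v = 0 -> vanish k f v) ->
  exists K r : R, [/\ 0 <= K, 0 < r & forall v, box s r v ->
    `|f v| <= K * Num.max `|v 0 a| `|v 0 b| ^+ k].
Proof.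
move=> + Us /eqP; rewrite rho_eq0 => + /andP[/eqP sa /eqP sb].
elim: k f => [|k IH] f fU fk.
  have [r r0 rP] := cont_box (Cinf_cont fU Us) ltr01.
  exists (`|f s| + 1), r; split=> [||v /rP sv]; rewrite ?addr_ge0 // expr0 mulr1.
  have -> : f v = f s - (f s - f v) by ring.
  by apply: le_trans (ler_normB _ _) _; rewrite lerD2l ltW.
have [Ka [ra [Ka0 ra0 raP]]] : exists K r : R, [/\ 0 <= K, 0 < r & forall v, box s r v ->
    `|'D_'e_a f v| <= K * Num.max `|v 0 a| `|v 0 b| ^+ k].
  by apply: IH; [exact: Cinf_derive|move=> v Uv v0; have [] := fk v Uv v0].
have [Kb [rb [Kb0 rb0 rbP]]] : exists K r : R, [/\ 0 <= K, 0 < r & forall v, box s r v ->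
    `|'D_'e_b f v| <= K * Num.max `|v 0 a| `|v 0 b| ^+ k].
  by apply: IH; [exact: Cinf_derive|move=> v Uv v0; have [] := fk v Uv v0].
have [r1 r10 r1U] := open_sub_box oU Us.
have [r [r0 rra rrb rr1]] : exists r : R, [/\ 0 < r, r <= ra, r <= rb & r <= r1].
  exists (Num.min ra (Num.min rb r1)).
  by rewrite !lt_min !ge_min ra0 rb0 r10 !lexx !orbT.
exists (Ka + Kb), r; split=> [||v sv]; rewrite ?addr_ge0 //.
have rU : box s r `<=` U by move=> w /(box_le rr1)/r1U.
pose x := v 0 a; pose y := v 0 b; pose M := Num.max `|x| `|y|.
have M0 : 0 <= M by rewrite le_max normr_ge0.
have xM : `|x| <= M by rewrite le_max lexx.
have yM : `|y| <= M by rewrite le_max lexx orbT.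
have ba : (b == a) = false by rewrite eq_sym (negPf ab).
(* Corners of the path: [v0] lies on the subspace, where f vanishes, and [v1] has the a-coordinate
   of v. The path stays in the box because its centre s lies on the subspace. *)
pose v0 := v - x *: 'e_a - y *: 'e_b; pose v1 := v0 + x *: 'e_a.
have pt (t t' : R) : 0 <= t <= 1 -> 0 <= t' <= 1 ->
    let z := v0 + t *: (x *: 'e_a) + t' *: (y *: 'e_b) in
    [/\ box s r z, z 0 a = t * x & z 0 b = t' * y].
  move=> /andP[t0 t1] /andP[t'0 t'1] /=.
  have za : (v0 + t *: (x *: 'e_a) + t' *: (y *: 'e_b)) 0 a = t * x.
    by rewrite /v0 !mxE !eqxx /= (negPf ab) /= -/x; ring.
  have zb : (v0 + t *: (x *: 'e_a) + t' *: (y *: 'e_b)) 0 b = t' * y.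
    by rewrite /v0 !mxE !eqxx /= ba /= -/y; ring.
  split=> // i; have [->|ia] := eqVneq i a.
    rewrite za sa subr0 normrM ger0_norm //; apply: le_lt_trans (_ : `|x| < r).
      by rewrite ler_piMl.
    by have := sv a; rewrite sa subr0.
  have [->|ib] := eqVneq i b.
    rewrite zb sb subr0 normrM ger0_norm //; apply: le_lt_trans (_ : `|y| < r).
      by rewrite ler_piMl.
    by have := sv b; rewrite sb subr0.
  by rewrite /v0 !mxE eqxx /= (negPf ia) (negPf ib) !mulr0 !subr0 !addr0; exact: sv.
have I00 : 0 <= (0 : R) <= 1 by rewrite lexx ler01.
have I11 : 0 <= (1 : R) <= 1 by rewrite lexx ler01.
have f00 : f v0 = 0.
  have [b0 a0' b0'] := pt 0 0 I00 I00; move: b0 a0' b0'.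
  rewrite !scale0r !addr0 !mul0r => b0 a0' b0'.
  by have [] := fk v0 (rU _ b0) _; rewrite // /rho a0' b0' expr0n addr0.
have mul_le t z : 0 <= t <= 1 -> `|z| <= M -> `|t * z| <= M :> R.
  move=> /andP[t0 t1] zM; rewrite normrM ger0_norm //; apply: le_trans zM.
  by rewrite ler_piMl.
have step (K c D : R) : 0 <= K -> `|c| <= M -> `|D| <= K * M ^+ k ->
    `|c * D| <= K * M ^+ k.+1.
  by move=> K0 cM DK; rewrite normrM exprS mulrCA; apply: ler_pM.
have [t t01 Ea] : exists2 t : R, 0 < t < 1 &
    f v1 - f v0 = x * 'D_'e_a f (v0 + t *: (x *: 'e_a)).
  apply: (@MVT_unit R n U f v0 a x) => // t t01.
  by apply: rU; have [] := pt t 0 t01 I00; rewrite scale0r addr0.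
have [t' t'01 Eb] : exists2 t' : R, 0 < t' < 1 &
    f (v1 + y *: 'e_b) - f v1 = y * 'D_'e_b f (v1 + t' *: (y *: 'e_b)).
  apply: (@MVT_unit R n U f v1 b y) => // t' t'01.
  by apply: rU; have [] := pt 1 t' I11 t'01; rewrite scale1r.
have vE : v1 + y *: 'e_b = v by rewrite /v1 /v0 addrAC !subrK.
have lt01 (t0 : R) : 0 < t0 < 1 -> 0 <= t0 <= 1 by case/andP=> *; rewrite !ltW.
have -> : f v = (f (v1 + y *: 'e_b) - f v1) + (f v1 - f v0) by rewrite vE f00; ring.
have monoK (K N : R) : 0 <= K -> 0 <= N -> N <= M -> K * N ^+ k <= K * M ^+ k.
  by move=> K0 N0 NM; apply: ler_wpM2l => //; apply: lerXn2r.
have Ha : `|f v1 - f v0| <= Ka * M ^+ k.+1.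
  rewrite Ea; apply: step => //; have [bz za zb] := pt t 0 (lt01 _ t01) I00.
  move: bz za zb; rewrite scale0r addr0 => bz za zb.
  apply: (le_trans (raP _ (box_le rra bz))); apply: monoK; first by [].
    by rewrite le_max normr_ge0.
  by rewrite ge_max za zb !mul_le // lt01.
have Hb : `|f (v1 + y *: 'e_b) - f v1| <= Kb * M ^+ k.+1.
  rewrite Eb; apply: step => //; have [bz za zb] := pt 1 t' I11 (lt01 _ t'01).
  move: bz za zb; rewrite scale1r => bz za zb.
  apply: (le_trans (rbP _ (box_le rrb bz))); apply: monoK; first by [].
    by rewrite le_max normr_ge0.
  by rewrite ge_max za zb !mul_le // lt01.
by apply: (le_trans (ler_normD _ _)); rewrite mulrDl addrC; apply: lerD.
Qed.

End Vanishing.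

(** * Functions presented as quotients in two ways *)

Section DivisionClass.
Variables (R : realType) (n : nat) (U : set 'rV[R]_n).
Hypothesis oU : open U.
Implicit Types (f g h C : 'rV[R]_n -> R) (u v w : 'rV[R]_n).

Definition bad_set (a1 b1 a2 b2 : 'I_n) (v : 'rV[R]_n) : Prop :=
  rho a1 b1 v = 0 /\ rho a2 b2 v = 0.

(* The quotients [f / rho_1 = q / rho_2] of [rho_division] lie in this class, and it
   is stable under partial derivatives. A member is bounded near [bad_set]: off
   [bad_set], [f] vanishes to order [2k] on [rho_1 = 0], hence everywhere on it,
   the codimension of [bad_set] being 4. So members extend continuously, with all
   their derivatives. *)
Definition divisible_class (a1 b1 a2 b2 : 'I_n) C : Prop :=
  exists k l f q, [/\ Cinf U f, Cinf U q &
    forall v, U v -> ~ bad_set a1 b1 a2 b2 v ->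
      rho a1 b1 v ^+ k * C v = f v /\ rho a2 b2 v ^+ l * C v = q v].

Lemma bad_setC a1 b1 a2 b2 v : bad_set a1 b1 a2 b2 v -> bad_set a2 b2 a1 b1 v.
Proof. by case. Qed.

Lemma divisible_classC a1 b1 a2 b2 C :
  divisible_class a1 b1 a2 b2 C -> divisible_class a2 b2 a1 b1 C.
Proof.
move=> [k [l [f [q [fU qU E]]]]]; exists l, k, q, f; split=> // v Uv vb.
by have [] := E v Uv (fun vb' => vb (bad_setC vb')).
Qed.

Lemma near_rho (a b : 'I_n) v : rho a b v != 0 -> \forall w \near v, rho a b w != 0.
Proof. by apply: neq0_near; apply: smooth_cont; exact: smooth_rho. Qed.

Lemma open_good a1 b1 a2 b2 v : ~ bad_set a1 b1 a2 b2 v ->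
  \forall w \near v, ~ bad_set a1 b1 a2 b2 w.
Proof.
move=> vb; have [v1|v1] := eqVneq (rho a1 b1 v) 0.
  have v2 : rho a2 b2 v != 0 by apply/eqP => v2; apply: vb.
  by apply: near_imp (near_rho v2) => w /eqP w2 [].
by apply: near_imp (near_rho v1) => w /eqP w1 [].
Qed.

(** Off [bad_set] one of the two denominators is nonzero, and C is locally the corresponding
    quotient. *)
Lemma divisible_smooth a1 b1 a2 b2 C v : divisible_class a1 b1 a2 b2 C ->
  U v -> ~ bad_set a1 b1 a2 b2 v -> smooth_rV C v.
Proof.
have main a b k f : Cinf U f -> U v -> rho a b v != 0 ->
    (forall w, U w -> rho a b w != 0 -> rho a b w ^+ k * C w = f w) -> smooth_rV C v.
  move=> fU Uv v0 E; apply: (@smooth_congr _ _ (fun w => f w / rho a b w ^+ k)).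
    have := near_and (near_open oU Uv) (near_rho v0); apply: near_imp => w [Uw w0].
    by rewrite -E // mulrAC mulfV ?mul1r // expf_neq0.
  apply: smooth_rVM; first exact: Cinf_smooth fU Uv.
  by apply: smooth_rVV; [apply: smooth_rVX; exact: smooth_rho|rewrite expf_neq0].
move=> [k [l [f [q [fU qU E]]]]] Uv vb; have [v1|v1] := eqVneq (rho a1 b1 v) 0.
  have v2 : rho a2 b2 v != 0 by apply/eqP => v2; apply: vb.
  by apply: (main a2 b2 l q) => // w Uw /eqP w0; have [] := E w Uw (fun b => w0 b.2).
by apply: (main a1 b1 k f) => // w Uw /eqP w0; have [] := E w Uw (fun b => w0 b.1).
Qed.

(** Differentiating rho^k C = f and multiplying by rho gives rho^(k+1) C' = rho f' - k rho' f; this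
    is done for both presentations of C. *)
Lemma divisible_derive a1 b1 a2 b2 i C : divisible_class a1 b1 a2 b2 C ->
  divisible_class a1 b1 a2 b2 ('D_'e_i C).
Proof.
move=> CD.
have main a b k f : Cinf U f ->
    (forall v, U v -> ~ bad_set a1 b1 a2 b2 v -> rho a b v ^+ k * C v = f v) ->
    exists2 f', Cinf U f' & forall v, U v -> ~ bad_set a1 b1 a2 b2 v ->
      rho a b v ^+ k.+1 * 'D_'e_i C v = f' v.
  move=> fU E.
  exists (fun v => rho a b v * 'D_'e_i f v - k%:R * 'D_'e_i (rho a b) v * f v).
    have rU : Cinf U (rho a b) by apply: smooth_Cinf => w _; exact: smooth_rho.
    apply: CinfB => //; first by apply: CinfM => //; exact: Cinf_derive.
    apply: CinfM => //; apply: CinfM => //; last exact: Cinf_derive.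
    exact: (Cinf_cst oU).
  move=> v Uv vb.
  have dC := smooth_is_derive i (divisible_smooth CD Uv vb).
  have dr := smooth_is_derive i (smooth_rho a b v).
  have drk := is_deriveX k dr.
  have [_ Ed] := is_deriveM drk dC.
  have -> : 'D_'e_i f v = 'D_'e_i (rho a b ^+ k * C) v.
    apply/esym/near_eq_derive.
    have := near_and (near_open oU Uv) (open_good vb); apply: near_imp => w [Uw wb].
    by rewrite -(E w Uw wb) /GRing.mul /= fctE.
  rewrite Ed -E // -![_ *: _]/(_ * _) fctE.
  move: ('D_'e_i C v) ('D_'e_i (rho a b) v) (rho a b v) (C v) => A B r c.
  case: k {E drk Ed} => [|k] /=; first by rewrite !expr0 expr1; ring.
  by rewrite !exprS -mulr_natl -natr1; ring.
move: (CD) => [k [l [f [q [fU qU E]]]]].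
have [f' f'U fE] := main a1 b1 k f fU (fun v Uv vb => (E v Uv vb).1).
have [q' q'U qE] := main a2 b2 l q qU (fun v Uv vb => (E v Uv vb).2).
by exists k.+1, l.+1, f', q'; split=> // v Uv vb; split; [exact: fE|exact: qE].
Qed.

Lemma divisible_bounded a1 b1 a2 b2 C s : uniq [:: a1; b1; a2; b2] ->
  divisible_class a1 b1 a2 b2 C -> U s -> bad_set a1 b1 a2 b2 s ->
  exists K r : R, [/\ 0 <= K, 0 < r &
    forall v, box s r v -> rho a1 b1 v != 0 -> `|C v| <= K].
Proof.
rewrite /= !inE !negb_or => /and4P[/and3P[ab1 aa1 ab2] /andP[ba2 bb2] ab _] CD Us [s1 s2].
move: (CD) => [k [l [f [q [fU qU E]]]]].
have [|K [r [K0 r0 KP]]] := vanish_bound ab1 oU (k := k + k) fU Us s1.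
  move=> v Uv v1; apply: (vanish_closed fU Uv) => e e0.
  have [d [d0 de dU]] : exists d : R, [/\ 0 < d, d < e & U (v + d *: 'e_a2)].
    have [r r0 rU] := open_sub_box oU Uv; exists (Num.min e r / 2).
    have m0 : 0 < Num.min e r by rewrite lt_min e0.
    have me : Num.min e r <= e by rewrite ge_min lexx.
    have mr : Num.min e r <= r by rewrite ge_min lexx orbT.
    split; [by rewrite divr_gt0|lra|].
    apply: rU; apply: (@box_add _ _ _ _ _ (Num.min e r / 2)) => [j|]; last by lra.
    by apply: norm_unit_le; rewrite gtr0_norm // divr_gt0.
  (* A shift along e_a2 keeps rho_1 = 0 and, the four indices being distinct, makes rho_2
     nonzero. *)
  pose w := if rho a2 b2 v == 0 then v + d *: 'e_a2 else v.
  have a12 : (a1 == a2) = false by apply/negbTE.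
  have b12 : (b1 == a2) = false by apply/negbTE.
  have b22 : (b2 == a2) = false by rewrite eq_sym; apply/negbTE.
  have [vw Uw w1 w2] : [/\ box v e w, U w, rho a1 b1 w = 0 & rho a2 b2 w != 0].
    rewrite /w; case: ifPn => v2; last by split=> //; exact: boxxx.
    split=> //.
    - apply: (@box_add _ _ _ _ _ d) => // j.
      by apply: norm_unit_le; rewrite gtr0_norm.
    - by move: v1; rewrite /rho !mxE eqxx /= a12 b12 /= !mulr0 !addr0.
    - rewrite rho_eq0 negb_and; apply/orP; left; rewrite !mxE !eqxx /= mulr1.
      by move: v2; rewrite rho_eq0 => /andP[/eqP -> _]; rewrite add0r gt_eqF.
  exists w => //; have wb : ~ bad_set a1 b1 a2 b2 w by case=> _ /eqP; rewrite (negPf w2).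
  apply: (@vanish_congr _ _ _ _ _ (fun w => rho a1 b1 w ^+ k * C w)).
    have := near_and (near_open oU Uw) (open_good wb); apply: near_imp => z [Uz zb].
    by have [] := E z Uz zb.
  by apply: vanish_rhoX => //; exact: divisible_smooth Uw wb.
have [r1 r10 r1U] := open_sub_box oU Us.
have [r' [r'0 rr rr1]] : exists r' : R, [/\ 0 < r', r' <= r & r' <= r1].
  by exists (Num.min r r1); rewrite lt_min !ge_min r0 r10 !lexx orbT.
exists K, r'; split=> // v sv v1.
have Uv : U v by apply/r1U/(box_le rr1).
have vb : ~ bad_set a1 b1 a2 b2 v by case=> /eqP; rewrite (negPf v1).
have [fv _] := E v Uv vb; have := KP v (box_le rr sv); rewrite -fv normrM.
(* Thus max^(2k) <= rho_1^k, which cancels the factor rho_1^k in f = rho_1^k C. *)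
have M2 : Num.max `|v 0 a1| `|v 0 b1| ^+ 2 <= rho a1 b1 v.
  have [_|_] := leP `|v 0 a1| `|v 0 b1|; rewrite real_normK ?num_real //.
    by rewrite lerDr sqr_ge0.
  by rewrite lerDl sqr_ge0.
have r00 : 0 < rho a1 b1 v by rewrite lt_def v1 addr_ge0 ?sqr_ge0.
have rk : `|rho a1 b1 v ^+ k| = rho a1 b1 v ^+ k by rewrite gtr0_norm // exprn_gt0.
rewrite rk addnn -mul2n exprM => H.
rewrite -(ler_pM2l (exprn_gt0 k r00)); apply: (le_trans H).
rewrite mulrC; apply: ler_wpM2r => //; apply: lerXn2r => //; rewrite nnegrE.
  exact: sqr_ge0.
exact: ltW.
Qed.

End DivisionClass.

Section Division.
Variables (R : realType) (n : nat) (U : set 'rV[R]_n) (a1 b1 a2 b2 : 'I_n).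
Hypothesis oU : open U.
Hypothesis uniq4 : uniq [:: a1; b1; a2; b2].
Implicit Types (f g h C : 'rV[R]_n -> R) (u v w s : 'rV[R]_n).

Let bad := @bad_set R n a1 b1 a2 b2.
Let good : set 'rV[R]_n := [set v | rho a1 b1 v != 0 /\ rho a2 b2 v != 0].
Let class := divisible_class U a1 b1 a2 b2.

Let good_bad v : good v -> ~ bad v.
Proof. by move=> [/eqP v1 _] []. Qed.

Let neqs : [/\ a1 == b1 = false, a1 == a2 = false, a1 == b2 = false,
  b1 == a2 = false & b1 == b2 = false].
Proof.
move: uniq4; rewrite /= !inE !negb_or => /and4P[/and3P[? ? ?] /andP[? ?] _ _].
by split; apply/negbTE.
Qed.

Let uniq4' : uniq [:: a2; b2; a1; b1].
Proof. by rewrite -(rot_uniq 2) /=. Qed.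

Let good_dense v (e : R) : 0 < e -> exists2 w, box v e w & good w.
Proof.
move=> e0; have [_ a12 _ b12 _] := neqs.
have a21 : (a2 == a1) = false by rewrite eq_sym.
pose d1 := if v 0 a1 == 0 then e / 2 else 0; pose d2 := if v 0 a2 == 0 then e / 2 else 0.
have dP (d x : R) : d = (if x == 0 then e / 2 else 0) -> `|d| < e /\ x + d != 0.
  move=> ->; case: ifPn => [/eqP ->|x0]; last by rewrite normr0 addr0.
  by rewrite add0r gtr0_norm ?gt_eqF ?divr_gt0 //; split=> //; lra.
have [d1e d10] := dP d1 (v 0 a1) erefl; have [d2e d20] := dP d2 (v 0 a2) erefl.
exists (v + d1 *: 'e_a1 + d2 *: 'e_a2); last first.
  split; rewrite rho_eq0 negb_and; apply/orP; left; rewrite !mxE !eqxx /=.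
    by rewrite a12 mulr0 mulr1 addr0.
  by rewrite a21 mulr0 mulr1 addr0.
move=> i; rewrite !mxE eqxx /=; have [->|i1] := eqVneq i a1.
  by rewrite a12 mulr1 mulr0 addr0 addrAC subrr add0r.
have [->|i2] := eqVneq i a2; last by rewrite !mulr0 !addr0 subrr normr0.
by rewrite mulr0 mulr1 addr0 addrAC subrr add0r.
Qed.

Let segment_bound C (v d : 'rV[R]_n) (K : 'I_n -> R) : class C ->
  (forall t : R, 0 <= t <= 1 -> U (v + t *: d) /\ ~ bad (v + t *: d)) ->
  (forall i (t : R), 0 <= t <= 1 -> `|'D_'e_i C (v + t *: d)| <= K i) ->
  `|C (v + d) - C v| <= \sum_i K i * `|d 0 i|.
Proof.
move=> CD vd KP.
have Csm (t : R) : 0 <= t <= 1 -> smooth_rV C (v + t *: d).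
  by move=> /vd[Ut bt]; exact: (divisible_smooth oU CD).
have [t /andP[t0 t1] ->] : exists2 t : R, 0 < t < 1 & C (v + d) - C v =
    \sum_i 'D_'e_i C (v + t *: d) * d 0 i.
  apply: (@MVT_seg _ _ C v d (fun t => \sum_i 'D_'e_i C (v + t *: d) * d 0 i)) => t.
    move=> /andP[t0 t1]; have sC := Csm t; move: sC; rewrite !ltW // => /(_ isT) sC.
    rewrite -[X in is_derive _ _ X _]/(C \o (fun s : R => v + s *: d)).
    apply: (@chain_path R n C (fun s : R => v + s *: d) t (fun i => d 0 i)).
    - by move=> i; apply: near_imp (smooth_near sC) => w /(smooth_is_derive i)[].
    - by move=> i; apply: smooth_cont; exact: smooth_derive.
    - by apply: near_imp (smooth_near sC) => w; exact: smooth_cont.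
    - move=> i.
      have -> : (fun s : R => (v + s *: d) 0 i) = (fun s : R => v 0 i + d 0 i * s).
        by apply/funext => s; rewrite !mxE mulrC.
      have h := is_deriveD (is_derive_cst (v 0 i) t 1) (is_deriveZ (d 0 i) (is_derive_id t 1)).
      by apply: (is_derive_eq h); rewrite add0r [LHS]mulr1.
  by move=> t01; apply: smooth_cont; exact: Csm.
apply: le_trans (ler_norm_sum _ _ _) _; apply: ler_sum => i _.
by rewrite normrM; apply: ler_wpM2r => //; apply: KP; rewrite !ltW.
Qed.

Let convex_lt (x y t r : R) : `|x| < r -> `|y| < r -> 0 <= t <= 1 -> `|x + t * (y - x)| < r.
Proof.
move=> xr yr /andP[t0 t1]; have [->|tn0] := eqVneq t 0; first by rewrite mul0r addr0.
have -> : x + t * (y - x) = (1 - t) * x + t * y by ring.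
apply: le_lt_trans (ler_normD _ _) _; rewrite !normrM (ger0_norm t0).
have t1' : 0 <= 1 - t by rewrite subr_ge0.
have tp : 0 < t by rewrite lt_def tn0.
have h1 : t * `|y| < t * r by rewrite ltr_pM2l.
have h2 : (1 - t) * `|x| <= (1 - t) * r by apply: ler_wpM2l => //; exact: ltW.
by rewrite (ger0_norm t1'); lra.
Qed.

(** The first derivatives belong to the class, so they are bounded near s off [bad_set]. The segment
    from v to w may cross that set, so a detour is taken. *)
Let lipschitz C s : class C -> U s -> bad s -> exists K r : R,
  [/\ 0 <= K, 0 < r & forall v w (e : R), box s r v -> box s r w -> good v -> good w ->
    (forall i, `|w 0 i - v 0 i| <= e) -> `|C w - C v| <= K * e].
Proof.
move=> CD Us bs.
have /choice[K KP] (i : 'I_n) : exists K : R, 0 <= K /\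
    \forall v \near s, ~ bad v -> `|'D_'e_i C v| <= K.
  have dC : class ('D_'e_i C) by exact: divisible_derive.
  have [K1 [r1 [K10 r10 P1]]] := divisible_bounded oU uniq4 dC Us bs.
  have [K2 [r2 [K20 r20 P2]]] :=
    divisible_bounded oU uniq4' (divisible_classC dC) Us (bad_setC bs).
  exists (K1 + K2); split; first exact: addr_ge0.
  have := near_and (nbhsx_box s r10) (nbhsx_box s r20); apply: near_imp => v [v1 v2] vb.
  (* The bound of [divisible_bounded] requires rho_1 to be nonzero; where rho_1 = 0, the symmetric
     presentation takes over. *)
  have [v10|v10] := eqVneq (rho a1 b1 v) 0; last first.
    by apply: le_trans (P1 v v1 v10) _; rewrite lerDl.
  have v20 : rho a2 b2 v != 0 by apply/eqP => v20; apply: vb.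
  by apply: le_trans (P2 v v2 v20) _; rewrite lerDr.
have /nbhs_boxP[r r0 rP] : \forall v \near s,
    U v /\ forall i, ~ bad v -> `|'D_'e_i C v| <= K i.
  apply: near_and; first exact: near_open.
  by apply: near_all => i; have [_] := KP i.
exists (\sum_i K i + \sum_i K i), r; split=> //.
  by apply: addr_ge0; apply: sumr_ge0 => i _; have [] := KP i.
move=> v w e sv sw [v1 v2] [w1 w2] vwe.
pose in1 (i : 'I_n) := (i == a1) || (i == b1).
(* Corner of the detour: on the leg from v to q the coordinates a1 and b1 keep their values at v, so
   rho_1 stays nonzero; on the leg from q to w the coordinates a2 and b2 keep their values at w, so
   rho_2 does. *)
pose q : 'rV[R]_n := \row_i if in1 i then v 0 i else w 0 i.
have [_ a12 a1b2 b12 b1b2] := neqs.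
have in1' i : in1 i -> ((i == a2) = false) /\ ((i == b2) = false).
  by case/orP => /eqP ->.
have bx z (P : R -> 'rV[R]_n) t : 0 <= t <= 1 ->
    (forall i, (P t 0 i = v 0 i + z i * (w 0 i - v 0 i)) /\ 0 <= z i <= 1) -> box s r (P t).
  move=> t01 Pz i; have [-> zi] := Pz i.
  have := convex_lt (sv i) (sw i) zi; congr (`| _ | < _); ring.
have Z00 : 0 <= (0 : R) <= 1 by rewrite lexx ler01.
have Z11 : 0 <= (1 : R) <= 1 by rewrite lexx ler01.
have H1 : `|C q - C v| <= \sum_i K i * `|(q - v) 0 i|.
  rewrite -[in C q](subrK v q) (addrC _ v).
  have P (t : R) : 0 <= t <= 1 -> box s r (v + t *: (q - v)) /\ ~ bad (v + t *: (q - v)).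
    move=> t01; split.
      apply: (bx (fun i => if in1 i then 0 else t) (fun t => v + t *: (q - v))) => // i.
      by rewrite !mxE; case: (in1 i); split=> //; ring.
    have E1 : rho a1 b1 (v + t *: (q - v)) = rho a1 b1 v.
      by rewrite /rho !mxE /in1 !eqxx orbT /=; congr (_ ^+ 2 + _ ^+ 2); ring.
    by case=> /eqP; rewrite E1 (negPf v1).
  apply: (segment_bound (K := K)) => // [t /P[/rP[]]//|i t /P[/rP[_ h]]]; exact: h.
have H2 : `|C w - C q| <= \sum_i K i * `|(w - q) 0 i|.
  rewrite -[in C w](subrK q w) (addrC _ q).
  have P (t : R) : 0 <= t <= 1 -> box s r (q + t *: (w - q)) /\ ~ bad (q + t *: (w - q)).
    move=> t01; split.
      apply: (bx (fun i => if in1 i then t else 1) (fun t => q + t *: (w - q))) => // i.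
      by rewrite !mxE; case: (in1 i); split=> //; ring.
    have E2 : rho a2 b2 (q + t *: (w - q)) = rho a2 b2 w.
      rewrite /rho !mxE /in1 !(eq_sym _ a1) !(eq_sym _ b1) a12 b12 a1b2 b1b2 /=.
      by congr (_ ^+ 2 + _ ^+ 2); ring.
    by case=> _ /eqP; rewrite E2 (negPf w2).
  apply: (segment_bound (K := K)) => // [t /P[/rP[]]//|i t /P[/rP[_ h]]]; exact: h.
have e0 : 0 <= e by apply: le_trans (vwe a1).
have -> : C w - C v = (C q - C v) + (C w - C q) by ring.
apply: le_trans (ler_normD _ _) _; rewrite mulrDl; apply: lerD.
  apply: le_trans H1 _; rewrite mulr_suml; apply: ler_sum => i _.
  apply: ler_wpM2l; first by have [] := KP i.
  by rewrite !mxE; case: (in1 i); rewrite ?subrr ?normr0.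
apply: le_trans H2 _; rewrite mulr_suml; apply: ler_sum => i _.
apply: ler_wpM2l; first by have [] := KP i.
by rewrite !mxE; case: (in1 i); rewrite ?subrr ?normr0.
Qed.

(** A function that is Lipschitz on the dense set [good] near s is Cauchy along it, so it converges
    by completeness. *)
Let limit C s : class C -> U s -> bad s -> exists l : R, forall e, 0 < e ->
  \forall w \near s, good w -> `|l - C w| < e.
Proof.
move=> CD Us bs; have [K [r [K0 r0 KP]]] := lipschitz CD Us bs.
have cl : closure good s.
  move=> B /nbhs_boxP[e e0 eB]; have [w sw gw] := good_dense s e0.
  by exists w; split=> //; exact: eB.
have FF : ProperFilter (within good (nbhs s)) by exact: within_nbhs_proper.
have : cvg (C @ within good (nbhs s)).
  apply/cauchy_cvgP/cauchy_exP => e /= e0.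
  (* Coordinates of two points of this box differ by at most 2d; dividing by K + 1 rather than K
     avoids a zero denominator and yields K * 2d < e. *)
  pose d := Num.min r (e / (K + 1) / 2 / 2).
  have K1 : 0 < K + 1 by lra.
  have d0 : 0 < d by rewrite lt_min r0 !divr_gt0.
  have [w sw gw] := good_dense s d0.
  exists (C w); rewrite /= nbhs_simpl /within /=.
  apply: near_imp (nbhsx_box s d0) => v sv gv.
  have dr : d <= r by rewrite ge_min lexx.
  rewrite /ball /=; apply: le_lt_trans (_ : K * (2 * d) < e).
    apply: KP (box_le dr sv) (box_le dr sw) gv gw _ => i.
    have -> : w 0 i - v 0 i = (w 0 i - s 0 i) - (v 0 i - s 0 i) by ring.
    apply: le_trans (ler_normB _ _) _; rewrite mulr_natl mulr2n.
    by apply: lerD; apply: ltW; [exact: sw|exact: sv].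
  have de : d <= e / (K + 1) / 2 / 2 by rewrite ge_min lexx orbT.
  have : (K + 1) * (2 * d) < e.
    rewrite mulrC -ltr_pdivlMr //.
    have : 0 < e / (K + 1) by rewrite divr_gt0.
    move: de; move: (e / (K + 1)) => z; lra.
  by apply: le_lt_trans; apply: ler_wpM2r; [rewrite mulr_ge0 // ltW|rewrite lerDl].
move=> /cvg_ex[l cl']; exists l => e e0.
exact: (@cvgr_dist_lt _ _ _ _ (within_filter _ _) _ _ cl' e e0).
Qed.

(** The limits change C on [bad_set] only, which the class does not see; continuity is tested on the
    dense set [good]. *)
Let extend C : class C -> exists C', [/\ class C',
  forall v, U v -> {for v, continuous C'} & forall v, U v -> ~ bad v -> C' v = C v].
Proof.
move=> CD.
have /choice[L LP] (s : 'rV[R]_n) : exists l : R, U s -> bad s -> forall e, 0 < e ->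
    \forall w \near s, good w -> `|l - C w| < e.
  have [[Us bs]|nb] := pselect (U s /\ bad s).
    by have [l lP] := limit CD Us bs; exists l.
  by exists 0 => Us bs; case: nb.
pose C' v := if pselect (bad v) then L v else C v.
have E v : ~ bad v -> C' v = C v by rewrite /C'; case: pselect.
have C'l v : U v -> forall e : R, 0 < e -> \forall w \near v, good w -> `|C' v - C w| < e.
  move=> Uv e e0; have [bv|nbv] := pselect (bad v).
    by rewrite /C'; case: pselect => [bv'|//]; exact: LP.
  rewrite E //; have /cont_distP := smooth_cont (divisible_smooth oU CD Uv nbv).
  by move=> /(_ e e0); apply: near_imp.
exists C'; split; last by move=> v _; exact: E.
  move: CD => [k [l [f [q [fU qU fq]]]]]; exists k, l, f, q; split=> // v Uv nb.
  by rewrite E //; exact: fq.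
move=> v Uv; apply/cont_distP => e e0.
have e20 : 0 < e / 2 by rewrite divr_gt0.
have := near_near (near_and (near_open oU Uv) (C'l v Uv _ e20)); apply: near_imp => w wP.
have Uw : U w by have [] := near_here wP.
have /nbhs_boxP[r r0 rP] := near_and wP (C'l w Uw _ e20).
have [z wz gz] := good_dense w r0; have [[_ /(_ gz) vz] /(_ gz) wz'] := rP z wz.
have -> : C' v - C' w = (C' v - C z) - (C' w - C z) by ring.
by apply: le_lt_trans (ler_normB _ _) _; rewrite [e]splitr; exact: ltrD.
Qed.

(** The hypothesis puts the common quotient f / rho_1 = q / rho_2 in the class, with both exponents
    1. Its extension and those of its derivatives are continuous, so [Cinf_ext] applies with the
    complement of [bad_set] as [O]. *)
Lemma rho_division f q : Cinf U f -> Cinf U q ->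
  (forall v, U v -> f v * rho a2 b2 v = rho a1 b1 v * q v) ->
  exists2 c, Cinf U c & forall v, U v -> f v = rho a1 b1 v * c v.
Proof.
move=> fU qU fq.
pose C v := if rho a1 b1 v == 0 then q v / rho a2 b2 v else f v / rho a1 b1 v.
have CD : class C.
  exists 1%N, 1%N, f, q; split=> // v Uv vb; rewrite !expr1 /C.
  have := fq v Uv; case: eqP => v1.
    have /eqP v2 : rho a2 b2 v <> 0 by move=> v2; apply: vb.
    rewrite v1 !mul0r => /eqP; rewrite mulf_eq0 (negPf v2) orbF => /eqP ->.
    by rewrite mulrC divfK.
  move/eqP in v1; move=> E; split; first by rewrite mulrC divfK.
  by apply: (mulfI v1); rewrite mulrCA [rho a1 b1 v * _]mulrC divfK // mulrC.
have [c [cD cc cC]] := extend CD.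
have cU : Cinf U c.
  pose P g := class g /\ forall v, U v -> {for v, continuous g}.
  apply: (@Cinf_ext R n U (fun v => ~ bad v) P oU) => //.
  - move=> v i /contrapT[/eqP + _] e e0; rewrite rho_eq0 => /andP[/eqP v1 /eqP v2].
    have [ab1 _ _ _ _] := neqs.
    (* One of a1 and b1 other than i: once that coordinate is nonzero, the whole line in direction
       e_i avoids [bad_set]. *)
    pose j := if i == a1 then b1 else a1.
    have ji : (j == i) = false.
      by rewrite /j; case: ifPn => [/eqP ->|/negbTE]; rewrite eq_sym ?ab1.
    exists ((e / 2) *: 'e_j); split=> [m|t t0].
      apply: le_lt_trans (norm_unit_le _ _ (lexx _)) _.
      by rewrite gtr0_norm ?divr_gt0 //; lra.
    suff : (v + (e / 2) *: 'e_j + t *: 'e_i) 0 j != 0.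
      move=> nz [/eqP + _]; rewrite rho_eq0.
      move: (v + _ + _) nz => z nz /andP[z1 z2].
      by move: nz; rewrite /j; case: ifP => _; rewrite ?z1 ?z2.
    rewrite !mxE !eqxx /= ji mulr0 mulr1 addr0.
    have -> : v 0 j = 0 by rewrite /j; case: ifP.
    by rewrite add0r gt_eqF // divr_gt0.
  - move=> g [gD cg]; split=> // i.
    have [g' [g'D cg' E]] := extend (divisible_derive oU i gD).
    exists g'; split=> // v Uv nb; rewrite E //; apply: smooth_is_derive.
    exact: (divisible_smooth oU gD).
exists c => // v Uv; apply/eqP; rewrite -subr_eq0; apply/eqP.
have rU : Cinf U (rho a1 b1) by apply: smooth_Cinf => w _; exact: smooth_rho.
have H : Cinf U (fun v => f v - rho a1 b1 v * c v) by apply: CinfB => //; exact: CinfM.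
apply: (@cont_eq0 _ _ (fun v => f v - rho a1 b1 v * c v)); first exact: Cinf_cont H Uv.
move=> e e0; have [r r0 rU'] := open_sub_box oU Uv.
have m0 : 0 < Num.min e r by rewrite lt_min e0.
have [w vw gw] := good_dense v m0; have nb := good_bad gw; exists w.
  by apply: box_le vw; rewrite ge_min lexx.
have Uw : U w by apply: rU'; apply: box_le vw; rewrite ge_min lexx orbT.
rewrite cC // /C; case: gw => w1 _; rewrite (negPf w1) mulrC divfK ?subrr //.
Qed.

End Division.

(** * Coefficients of the fields preserving a product of |z_i|^2 *)

Section EllipticCoefficients.
Variables (R : realType) (n : nat).
Implicit Types (f g X Y : 'rV[R]_n -> R) (u v w : 'rV[R]_n).

Lemma eq_off_coord f g u (m : 'I_n) (c : R) : smooth_rV f u -> smooth_rV g u ->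
  (\forall v \near u, (v : 'rV[R]_n) 0 m != c -> f v = g v) ->
  \forall v \near u, f v = g v.
Proof.
move=> sf sg fg.
have := near_near (near_and (smooth_near (smooth_rVB sf sg)) fg).
apply: near_imp => v vP; apply/eqP; rewrite -subr_eq0; apply/eqP.
have [sv _] := near_here vP.
apply: (@cont_eq0 _ _ (fun v => f v - g v)); first exact: smooth_cont sv.
move=> e e0; have /nbhs_boxP[r r0 rP] := vP.
have [d d0 dP] : exists2 d : R, 0 < d & d < Num.min e r.
  have m0 : 0 < Num.min e r by rewrite lt_min e0.
  by exists (Num.min e r / 2); [rewrite divr_gt0|lra].
have [t [td tc]] : exists t : R, `|t| <= d /\ v 0 m + t != c.
  have [vc|vc] := eqVneq (v 0 m) c; last by exists 0; rewrite normr0 addr0 ltW.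
  by exists d; rewrite gtr0_norm // lexx vc -subr_eq0 addrAC subrr add0r gt_eqF.
have bx s : Num.min e r <= s -> box v s (v + t *: 'e_m).
  move=> es; apply: (@box_add _ _ _ _ _ d) => [j|]; first exact: norm_unit_le.
  exact: lt_le_trans es.
exists (v + t *: 'e_m); first by apply: bx; rewrite ge_min lexx.
have mr : Num.min e r <= r by rewrite ge_min lexx orbT.
by have [_ E] := rP _ (bx r mr); rewrite E ?subrr // !mxE !eqxx mulr1.
Qed.

(** Subtract the Euler part c (x, y): the rest (A, B) satisfies x A = - y B, so A vanishes where y =
    0, Hadamard's lemma gives A = y g, and then B = - x g. This is the rotational part, up to the
    sign of g. *)
Lemma rotational_coefficients X Y c u (a b : 'I_n) : a != b ->
  smooth_rV X u -> smooth_rV Y u -> smooth_rV c u ->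
  (\forall v \near u, (v : 'rV[R]_n) 0 a * X v + v 0 b * Y v = rho a b v * c v) ->
  exists2 g, smooth_rV g u & \forall v \near u,
    X v = c v * (v : 'rV[R]_n) 0 a - g v * v 0 b /\ Y v = c v * v 0 b + g v * v 0 a.
Proof.
move=> ab sX sY sc E; have sx i : smooth_rV (fun v => v 0 i) u by exact: smooth_rV_coord.
pose A v := X v - c v * v 0 a; pose B v := Y v - c v * v 0 b.
have sA : smooth_rV A u by apply: smooth_rVB => //; exact: smooth_rVM.
have sB : smooth_rV B u by apply: smooth_rVB => //; exact: smooth_rVM.
have AB : \forall v \near u, (v : 'rV[R]_n) 0 a * A v = - (v 0 b * B v).
  apply: near_imp E => v E; apply/eqP; rewrite -addr_eq0 /A /B.
  have -> : v 0 a * (X v - c v * v 0 a) + v 0 b * (Y v - c v * v 0 b) =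
    v 0 a * X v + v 0 b * Y v - rho a b v * c v by rewrite /rho; ring.
  by rewrite E subrr.
have ba : (b == a) = false by rewrite eq_sym (negPf ab).
have A0 : \forall v \near u, (v : 'rV[R]_n) 0 b = 0 -> A v = 0.
  have := near_near (near_and (smooth_near sA) AB); apply: near_imp => v vP vb.
  have [sv E0] := near_here vP.
  (* Where y = 0 and x is nonzero the relation gives A = 0 at once; where x = 0 as well, continuity
     along e_a does. *)
  have [va|va] := eqVneq (v 0 a) 0; last first.
    by move: E0; rewrite vb mul0r oppr0 => /eqP; rewrite mulf_eq0 (negPf va) => /eqP.
  apply: (cont_eq0 (smooth_cont sv)) => e e0; have /nbhs_boxP[r r0 rP] := vP.
  pose d := Num.min e r / 2; have m0 : 0 < Num.min e r by rewrite lt_min e0.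
  have d0 : 0 < d by rewrite divr_gt0.
  have dm : d < Num.min e r by rewrite /d; lra.
  have bx s : Num.min e r <= s -> box v s (v + d *: 'e_a).
    move=> es; apply: (@box_add _ _ _ _ _ d) => [j|]; last exact: lt_le_trans es.
    by apply: norm_unit_le; rewrite gtr0_norm.
  exists (v + d *: 'e_a); first by apply: bx; rewrite ge_min lexx.
  have [|_] := rP (v + d *: 'e_a); first by apply: bx; rewrite ge_min lexx orbT.
  have -> : (v + d *: 'e_a) 0 b = 0 by rewrite !mxE eqxx /= ba mulr0 addr0.
  have -> : (v + d *: 'e_a) 0 a = d by rewrite !mxE !eqxx /= mulr1 va add0r.
  by rewrite mul0r oppr0 => /eqP; rewrite mulf_eq0 gt_eqF // => /eqP.
have [g sg gE] := hadamard sA A0.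
have gE' : \forall v \near u, A v = (v : 'rV[R]_n) 0 b * g v.
  by apply: near_imp gE => v; rewrite subr0.
have BE : \forall v \near u, B v = - ((v : 'rV[R]_n) 0 a * g v).
  apply: (eq_off_coord (m := b) (c := 0)) => //; first exact/smooth_rVN/smooth_rVM.
  have := near_and AB gE'; apply: near_imp => v [E1 E2] vb.
  by apply: (mulfI vb); apply: oppr_inj; rewrite -E1 E2; ring.
exists (fun v => - g v); first exact: smooth_rVN.
have := near_and gE' BE; apply: near_imp => v []; rewrite /A /B => E1 E2; split.
  have -> : X v = (X v - c v * v 0 a) + c v * v 0 a by ring.
  by rewrite E1; ring.
have -> : Y v = (Y v - c v * v 0 b) + c v * v 0 b by ring.
by rewrite E2; ring.
Qed.

Lemma rsq_rho i (h0 : (i.*2 < n)%N) (h1 : (i.*2.+1 < n)%N) v :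
  rsq v i = rho (Ordinal h0) (Ordinal h1) v.
Proof.
by rewrite /rsq /rho -[i.*2]/(nat_of_ord (Ordinal h0)) coordE
  -[i.*2.+1]/(nat_of_ord (Ordinal h1)) coordE.
Qed.

Lemma rsq_cancel f q u i j : i != j -> (i.*2.+1 < n)%N -> (j.*2.+1 < n)%N ->
  smooth_rV f u -> smooth_rV q u ->
  (\forall v \near u, f v * rsq v j = rsq v i * q v) ->
  exists2 c, smooth_rV c u & \forall v \near u, f v = rsq v i * c v.
Proof.
move=> ij i1 j1 sf sq E; have i0 := ltnW i1; have j0 := ltnW j1.
have /near_openP[U [oU Uu UP]] :=
  near_and (near_and (smooth_near sf) (smooth_near sq)) E.
have uq : uniq [:: Ordinal i0; Ordinal i1; Ordinal j0; Ordinal j1].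
  rewrite /= !inE !negb_or -!val_eqE /= andbT.
  have d2 : (i.*2 != j.*2)%N by rewrite (inj_eq double_inj).
  have d3 : (i.*2 != j.*2.+1)%N.
    by apply/eqP => /(congr1 odd); rewrite /= !odd_double.
  have d4 : (i.*2.+1 != j.*2)%N.
    by apply/eqP => /(congr1 odd); rewrite /= !odd_double.
  by rewrite ?eqSS d2 d3 d4 !neq_ltn !ltnS !leqnn.
have [||v Uv|c cU fc] := rho_division oU uq (f := f) (q := q).
- by apply: smooth_Cinf => v /UP[[]].
- by apply: smooth_Cinf => v /UP[[]].
- by have [_] := UP v Uv; rewrite !rsq_rho.
exists c; first exact: Cinf_smooth cU Uu.
by apply: near_imp (near_open oU Uu) => v /fc; rewrite rsq_rho.
Qed.

(** Each use of [rsq_cancel] strips one factor |z_j|^2 off the product and provides a new quotient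
    for the next. *)
Lemma rsq_cancel_prod f q u i (s : seq nat) : i \notin s -> (i.*2.+1 < n)%N ->
  {in s, forall j, (j.*2.+1 < n)%N} -> smooth_rV f u -> smooth_rV q u ->
  (\forall v \near u, f v * \prod_(j <- s) rsq v j = rsq v i * q v) ->
  exists2 c, smooth_rV c u & \forall v \near u, f v = rsq v i * c v.
Proof.
move=> + i1 + sf; elim: s q => [|j s IH] q.
  by move=> _ _ sq E; exists q => //; apply: near_imp E => v; rewrite big_nil mulr1.
rewrite inE negb_or => /andP[ij js] sn sq E.
have sp : smooth_rV (fun v => f v * \prod_(j <- s) rsq v j) u.
  apply: smooth_rVM => //; elim: s {IH E js sn} => [|m s IH].
    have -> : (fun v => \prod_(j <- [::]) rsq v j) = cst 1.
      by apply/funext => v; rewrite big_nil.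
    exact: smooth_rV_cst.
  have -> : (fun v => \prod_(j <- m :: s) rsq v j) =
      (fun v => rsq v m * \prod_(j <- s) rsq v j).
    by apply/funext => v; rewrite big_cons.
  by apply: smooth_rVM => //; exact: smooth_rsq.
have j1 : (j.*2.+1 < n)%N by apply: sn; rewrite inE eqxx.
have [|c sc cE] := @rsq_cancel (fun v => f v * \prod_(j <- s) rsq v j) q u i j ij i1 j1 sp sq.
  by apply: near_imp E => v <-; rewrite big_cons mulrAC -mulrA.
by apply: (IH c) => // m ms; apply: sn; rewrite inE ms orbT.
Qed.

(** The hypothesis is half of the identity obtained by applying X to the product of the |z_j|^2. All
    terms but the i-th, and the right-hand side, contain |z_i|^2; so |z_i|^2 divides the i-th term,
    and by the division theorem it divides the factor Re (conj(z_i) X z_i). *)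
Lemma elliptic_coefficients (k : nat) (X : nat -> 'rV[R]_n -> R) b u :
  (k.*2 <= n)%N -> (forall m, smooth_rV (X m) u) -> smooth_rV b u ->
  (\forall v \near u, \sum_(i < k) (coord v i.*2 * X i.*2 v + coord v i.*2.+1 * X i.*2.+1 v) *
     \prod_(j < k | j != i) rsq v j = b v * \prod_(j < k) rsq v j) ->
  forall i : 'I_k, exists c g, [/\ smooth_rV c u, smooth_rV g u & \forall v \near u,
    X i.*2 v = c v * coord v i.*2 - g v * coord v i.*2.+1 /\
    X i.*2.+1 v = c v * coord v i.*2.+1 + g v * coord v i.*2].
Proof.
move=> kn sX sb E i.
have lt1 (j : 'I_k) : (j.*2.+1 < n)%N.
  by apply: leq_trans kn; rewrite -doubleS leq_double.
pose P (j : 'I_k) v := coord v j.*2 * X j.*2 v + coord v j.*2.+1 * X j.*2.+1 v.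
have sP j : smooth_rV (P j) u.
  by apply: smooth_rVD; apply: smooth_rVM => //; exact: smooth_coord.
(* The remaining terms of the identity, divided by |z_i|^2. *)
pose q v := b v * \prod_(j < k | j != i) rsq v j -
  \sum_(i' < k | i' != i) P i' v * \prod_(j < k | (j != i') && (j != i)) rsq v j.
have sq : smooth_rV q u.
  apply: smooth_rVB.
    by apply: smooth_rVM => //; apply: smooth_rV_prod => j _; exact: smooth_rsq.
  apply: smooth_rV_sum => j _; apply: smooth_rVM => //.
  by apply: smooth_rV_prod => m _; exact: smooth_rsq.
have Eq : \forall v \near u,
    P i v * \prod_(j <- [seq val j | j <- enum 'I_k & j != i]) rsq v j = rsq v i * q v.
  apply: near_imp E => v; rewrite (bigD1 i) //= [X in _ = _ * X](bigD1 i) //= => E.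
  rewrite big_map big_filter big_enum_cond /=.
  apply/eqP; rewrite -subr_eq0 /q mulrBr opprB addrA mulrCA -E.
  rewrite -/(P i v) addrAC opprD addrA subrr sub0r addrC subr_eq0 mulr_sumr.
  apply/eqP/eq_bigr => i' i'i; rewrite -/(P i' v) [X in _ = _ * X](bigD1 i) /=; last by rewrite eq_sym.
  by rewrite mulrCA.
have i1 := lt1 i; have i0 := ltnW i1.
have [||c sc cE] := @rsq_cancel_prod (P i) q u i _ _ i1 _ (sP i) sq Eq.
- apply/mapP => -[j]; rewrite mem_filter => /andP[ji _] ij.
  by move: ji; rewrite -val_eqE -ij eqxx.
- by move=> j /mapP[m _ ->]; exact: lt1.
have ab : Ordinal i0 != Ordinal i1 by rewrite -val_eqE /= neq_ltn leqnn.
have [|g sg gE] := @rotational_coefficients (X i.*2) (X i.*2.+1) c u _ _ ab (sX _) (sX _) sc.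
  apply: near_imp cE => v; rewrite -rsq_rho -!coordE => <- //.
exists c, g; split=> //; apply: near_imp gE => v; by rewrite -!coordE.
Qed.

End EllipticCoefficients.

(** * Smooth functions on manifolds *)

Lemma open_near (T : topologicalType) (U : set T) (x : T) :
  open U -> U x -> \forall y \near x, U y.
Proof. by move=> oU Ux; apply: open_nbhs_nbhs. Qed.

Section Charts.
Variables (R : realType) (n : nat).

Lemma chart_near (T : topologicalType) (c : chart R n T) x (P : T -> Prop) :
  is_chart c -> cdom c x ->
  (\forall y \near x, P y) <-> (\forall u \near cmap c x, P (cinv c u)).
Proof.
move=> [oc oi cK cc ci] cx; split=> xP.
  have := ci x cx; rewrite /prop_for /continuous_at cK //; exact.
have := near_and (open_near oc cx) (cc x cx _ xP); apply: near_imp => y [cy].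
by rewrite /= cK.
Qed.

Lemma chart_inv_near (T : topologicalType) (c : chart R n T) x :
  is_chart c -> cdom c x ->
  \forall u \near cmap c x, cmap c (cinv c u) = u /\ cdom c (cinv c u).
Proof.
move=> [oc oi cK cc ci] cx.
have : (cmap c @` cdom c) (cmap c x) by exists x.
move=> /(open_near oi); apply: near_imp => _ [y cy <-].
by rewrite !cK.
Qed.

Lemma smooth_change (T : topologicalType) (c d : chart R n T) x (f : T -> R) :
  is_chart c -> is_chart d -> smooth_transition c d -> cdom c x -> cdom d x ->
  smooth_rV (f \o cinv d) (cmap d x) -> smooth_rV (f \o cinv c) (cmap c x).
Proof.
move=> hc hd cd cx dx fd.
have cK : cinv c (cmap c x) = x by case: hc => _ _ cK _ _; exact: cK.
have := @smooth_compr R n n (f \o cinv d) (fun u => cmap d (cinv c u)) (cmap c x).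
rewrite cK => /(_ (cd x cx dx) fd); apply: smooth_congr.
have [od _ dK _ _] := hd.
have /(chart_near _ hc cx) := open_near od dx; apply: near_imp => u du.
by rewrite /= dK.
Qed.

Variable M : manifold R n.
Implicit Types (c d : chart R n M) (x y : M) (f g : M -> R).

Lemma atlas_coordinates c : atlas c -> coordinates c.
Proof.
move=> ac; split; first exact: atlas_chart.
by move=> d ad; split; exact: atlas_transition.
Qed.

Lemma coordinates_at x : exists2 c, coordinates c & cdom c x.
Proof. by have [c /atlas_coordinates] := atlas_cover x; exists c. Qed.

Lemma smoothE c x f : coordinates c -> cdom c x ->
  smooth f x <-> smooth_rV (f \o cinv c) (cmap c x).
Proof.
move=> [hc cP] cx; split=> [fx|fc d ad dx].
  have [d ad dx] := atlas_cover x; have [cd _] := cP d ad.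
  exact: (smooth_change hc (atlas_chart ad) cd cx dx (fx d ad dx)).
have [_ dc] := cP d ad; exact: (smooth_change (atlas_chart ad) hc dc dx cx fc).
Qed.

Lemma mfd_smooth_near f x : smooth f x -> \forall y \near x, smooth f y.
Proof.
have [c cc cx] := coordinates_at x; have [hc _] := cc.
move=> /(smoothE f cc cx)/smooth_near fx; apply/(chart_near _ hc cx).
have := near_and fx (chart_inv_near hc cx); apply: near_imp => u [fu [uK cu]].
by apply/(smoothE f cc cu); rewrite uK.
Qed.

Lemma mfd_smooth_congr f g x : (\forall y \near x, f y = g y) -> smooth f x -> smooth g x.
Proof.
have [c cc cx] := coordinates_at x; have [hc _] := cc => fg.
move=> /(smoothE f cc cx) fx; apply/(smoothE g cc cx); apply: smooth_congr fx.
exact/(chart_near (fun y => f y = g y) hc cx).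
Qed.

Lemma mfd_smooth_cont f x : smooth f x -> {for x, continuous f}.
Proof.
have [c cc cx] := coordinates_at x; have [hc _] := cc.
move=> /(smoothE f cc cx)/smooth_cont/cont_distP fx; apply/cont_distP => e e0.
apply/(chart_near _ hc cx); have := fx e e0; apply: near_imp => u /=.
by case: hc => _ _ -> .
Qed.

Lemma mfd_smooth_cst a x : smooth (fun _ : M => a) x.
Proof.
have [c cc cx] := coordinates_at x.
by apply/(smoothE _ cc cx); exact: (smooth_rV_cst a).
Qed.

Lemma mfd_smoothD f g x : smooth f x -> smooth g x -> smooth (fun y => f y + g y) x.
Proof.
have [c cc cx] := coordinates_at x.
move=> /(smoothE _ cc cx) fx /(smoothE _ cc cx) gx; apply/(smoothE _ cc cx).
exact: smooth_rVD fx gx.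
Qed.

Lemma mfd_smoothM f g x : smooth f x -> smooth g x -> smooth (fun y => f y * g y) x.
Proof.
have [c cc cx] := coordinates_at x.
move=> /(smoothE _ cc cx) fx /(smoothE _ cc cx) gx; apply/(smoothE _ cc cx).
exact: smooth_rVM fx gx.
Qed.

Lemma mfd_smoothN f x : smooth f x -> smooth (fun y => - f y) x.
Proof.
have [c cc cx] := coordinates_at x.
move=> /(smoothE _ cc cx) fx; apply/(smoothE _ cc cx); exact: smooth_rVN fx.
Qed.

Lemma mfd_smoothB f g x : smooth f x -> smooth g x -> smooth (fun y => f y - g y) x.
Proof. by move=> fx gx; apply: mfd_smoothD => //; exact: mfd_smoothN. Qed.

Lemma mfd_smoothV f x : smooth f x -> f x != 0 -> smooth (fun y => (f y)^-1) x.
Proof.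
have [c cc cx] := coordinates_at x; have [[_ _ cK _ _] _] := cc.
move=> /(smoothE _ cc cx) fx f0; apply/(smoothE _ cc cx).
by apply: smooth_rVV fx _; rewrite /= cK.
Qed.

Lemma mfd_smoothX f k x : smooth f x -> smooth (fun y => f y ^+ k) x.
Proof.
have [c cc cx] := coordinates_at x.
move=> /(smoothE _ cc cx) fx; apply/(smoothE _ cc cx); exact: smooth_rVX fx.
Qed.

Lemma mfd_smooth_sum (J : finType) (P : pred J) (g : J -> M -> R) x :
  (forall j, P j -> smooth (g j) x) -> smooth (fun y => \sum_(j | P j) g j y) x.
Proof.
have [c cc cx] := coordinates_at x => gx; apply/(smoothE _ cc cx).
by apply: (@smooth_rV_sum _ _ _ _ (fun j => g j \o cinv c)) => j /gx/(smoothE _ cc cx).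
Qed.

Lemma mfd_smooth_prod (J : finType) (P : pred J) (g : J -> M -> R) x :
  (forall j, P j -> smooth (g j) x) -> smooth (fun y => \prod_(j | P j) g j y) x.
Proof.
have [c cc cx] := coordinates_at x => gx; apply/(smoothE _ cc cx).
by apply: (@smooth_rV_prod _ _ _ _ (fun j => g j \o cinv c)) => j /gx/(smoothE _ cc cx).
Qed.

Lemma smooth_in_chart c x (h : 'rV[R]_n -> R) : coordinates c -> cdom c x ->
  smooth_rV h (cmap c x) -> smooth (fun y => h (cmap c y)) x.
Proof.
move=> cc cx hx; apply/(smoothE _ cc cx); apply: smooth_congr hx.
by have [hc _] := cc; apply: near_imp (chart_inv_near hc cx) => u [/= ->].
Qed.

Lemma smooth_cmap c x j : coordinates c -> cdom c x -> smooth (fun y => cmap c y 0 j) x.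
Proof.
by move=> cc cx; apply: (smooth_in_chart (h := fun u => u 0 j)) => //; exact: smooth_rV_coord.
Qed.

Lemma smooth_cmap_coord c x k : coordinates c -> cdom c x ->
  smooth (fun y => coord (cmap c y) k) x.
Proof.
by move=> cc cx; apply: (smooth_in_chart (h := fun u => coord u k)) => //; exact: smooth_coord.
Qed.

Lemma cdom_near c x : coordinates c -> cdom c x -> \forall y \near x, cdom c y.
Proof. by move=> [[oc _ _ _ _] _]; exact: open_near. Qed.

Lemma cmapK c x : coordinates c -> cdom c x -> cinv c (cmap c x) = x.
Proof. by move=> [[_ _ cK _ _] _]; exact: cK. Qed.

(** Membership in the maximal atlas for a chart given by explicit maps: smoothness of h yields one
    family of transition maps and smoothness of g the other. *)
Lemma build_coordinates (W : set M) (h : M -> 'rV[R]_n) (g : 'rV[R]_n -> M) :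
  open W -> open (h @` W) -> (forall y, W y -> g (h y) = y) ->
  (forall y, W y -> forall j, smooth (fun z => h z 0 j) y) ->
  (forall y, W y -> {for h y, continuous g} /\ forall d, atlas d -> cdom d y ->
     forall j, smooth_rV (fun u => cmap d (g u) 0 j) (h y)) ->
  coordinates (Chart W h g).
Proof.
move=> oW ohW gK sh sg; split.
  split=> //= x Wx; last by have [] := sg x Wx.
  by apply: row_continuous => j; apply: mfd_smooth_cont; exact: sh.
move=> d ad; split=> x /= hx dx j; first by have [_] := sg x hx; apply.
exact: sh dx j d ad hx.
Qed.

Lemma change_coordinates c (W : set M) (phi psi : 'rV[R]_n -> 'rV[R]_n) :
  coordinates c -> open W -> cancel phi psi -> cancel psi phi ->
  (forall u j, smooth_rV (fun v => phi v 0 j) u) ->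
  (forall u j, smooth_rV (fun v => psi v 0 j) u) ->
  coordinates (Chart (cdom c `&` W) (phi \o cmap c) (cinv c \o psi)).
Proof.
move=> cc oW phiK psiK sphi spsi.
have [[oc oi cK cm ci] cP] := cc.
have psi_cont u : {for u, continuous psi}.
  by apply: row_continuous => j; exact: smooth_cont.
apply: build_coordinates => /=.
- exact: openI.
- rewrite openE => _ [y [cy Wy] <-] /=.
  have : \forall u \near cmap c y, (cmap c @` cdom c) u /\ W (cinv c u).
    apply: near_and; first by apply: open_near => //; exists y.
    by apply: (ci y cy); rewrite cK //; exact: open_near.
  have := psi_cont (phi (cmap c y)); rewrite /prop_for /continuous_at phiK => pc /pc.
  apply: near_imp => u [[z cz zu] Wu]; exists z; last by rewrite /= zu psiK.
  by split=> //; move: Wu; rewrite -zu cK.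
- by move=> y [cy _]; rewrite phiK cK.
- move=> y [cy _] j.
  exact: (smooth_in_chart (h := fun u => phi u 0 j) cc cy).
- move=> y [cy Wy]; split.
    apply: continuous_comp; first exact: psi_cont.
    by rewrite phiK; exact: ci.
  move=> d ad dy j; have [cd _] := cP d ad.
  have := @smooth_compr R n n (fun u => cmap d (cinv c u) 0 j) psi (phi (cmap c y)).
  by rewrite phiK; apply; [exact: spsi|exact: cd].
Qed.

End Charts.

Lemma smooth_map_comp (R : realType) (m n : nat) (M : manifold R m) (N : manifold R n)
    (p : M -> N) (f : N -> R) x :
  smooth_map p -> smooth f (p x) -> smooth (fun y => f (p y)) x.
Proof.
move=> /(_ x)[cp sp] fx; have [c ac cx] := atlas_cover (p x).
have [d dd dx] := coordinates_at x; have [[od oi dK dm di] dP] := dd.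
apply/(smoothE _ dd dx).
have h : smooth_rV (f \o cinv c) (cmap c (p (cinv d (cmap d x)))) by rewrite dK //; exact: fx.
have := @smooth_compr R m n (f \o cinv c) (fun u => cmap c (p (cinv d u))) (cmap d x) _ h.
have H j : smooth_rV (fun u => cmap c (p (cinv d u)) 0 j) (cmap d x).
  by have /(smoothE _ dd dx) := sp c ac cx j.
move=> /(_ H); apply: smooth_congr.
have [oc _ cK _ _] := atlas_chart ac.
have [hd _] := dd; have /(chart_near _ hd dx) := cp _ (open_near oc cx).
by apply: near_imp => u /= cu; rewrite cK.
Qed.

(** * Tangent vectors and vector fields *)

(** Replace the coordinates of v by those of u one after the other: the i-th increment vanishes
    where v_i = u_i, so Hadamard's lemma divides it by v_i - u_i. *)
Lemma hadamard_sum (R : realType) (n : nat) (f : 'rV[R]_n -> R) (u : 'rV[R]_n) :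
  smooth_rV f u -> exists g : 'I_n -> 'rV[R]_n -> R, (forall i, smooth_rV (g i) u) /\
    \forall v \near u, f v = f u + \sum_i (v 0 i - u 0 i) * g i v.
Proof.
move=> fu; pose P (k : nat) (v : 'rV[R]_n) : 'rV[R]_n :=
  \row_j if (j < k)%N then u 0 j else v 0 j.
have P0 v : P 0%N v = v by apply/rowP => j; rewrite mxE ltn0.
have Pn v : P n v = u by apply/rowP => j; rewrite mxE ltn_ord.
have sP k : smooth_rV (fun v => f (P k v)) u.
  apply: smooth_compr => [j|].
    have -> : (fun v => P k v 0 j) = if (j < k)%N then cst (u 0 j) else (fun v => v 0 j).
      by apply/funext => v; rewrite mxE; case: ifP.
    by case: ifP => _; [exact: smooth_rV_cst|exact: smooth_rV_coord].
  have -> : P k u = u by apply/rowP => j; rewrite mxE; case: ifP.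
  exact: fu.
have /choice[g gP] (i : 'I_n) : exists g : 'rV[R]_n -> R, smooth_rV g u /\
    \forall v \near u, f (P i v) - f (P i.+1 v) = (v 0 i - u 0 i) * g v.
  have s1 : smooth_rV (fun v => f (P i v) - f (P i.+1 v)) u by exact: smooth_rVB.
  have e1 : \forall v \near u, (v : 'rV[R]_n) 0 i = u 0 i -> f (P i v) - f (P i.+1 v) = 0.
    apply: near_true => v vi; have -> : P i v = P i.+1 v; last by rewrite subrr.
    apply/rowP => j; rewrite !mxE; have [->|ji] := eqVneq j i.
      by rewrite ltnn ltnSn vi.
    have -> : (j < i.+1)%N = (j < i)%N by rewrite ltnS leq_eqVlt -[_ == _]/(j == i) (negPf ji).
    by [].
  by have [g sg gE] := hadamard s1 e1; exists g.
exists g; split=> [i|]; first by have [] := gP i.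
have : \forall v \near u, forall i : 'I_n,
    f (P i v) - f (P i.+1 v) = (v 0 i - u 0 i) * g i v.
  by apply: near_all => i; have [] := gP i.
apply: near_imp => v E; rewrite -(eq_bigr _ (fun i _ => E i)).
rewrite -(big_mkord xpredT (fun i => f (P i v) - f (P i.+1 v))).
have -> : \sum_(0 <= i < n) (f (P i v) - f (P i.+1 v)) =
    - \sum_(0 <= i < n) (f (P i.+1 v) - f (P i v)).
  by rewrite -sumrN; apply: eq_bigr => i _; rewrite opprB.
by rewrite (telescope_sumr (fun k => f (P k v))) // P0 Pn opprB addrC subrK.
Qed.

Section Tangent.
Variables (R : realType) (n : nat) (M : manifold R n).
Implicit Types (c d : chart R n M) (x y : M) (f g : M -> R) (v w : (M -> R) -> R).

Lemma tangent_congr x v f g : tangent x v -> smooth f x ->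
  (\forall y \near x, f y = g y) -> v f = v g.
Proof. by move=> [vc _ _] fx; exact: vc. Qed.

Lemma tangentZD x v a f g : tangent x v -> smooth f x -> smooth g x ->
  v (fun y => a * f y + g y) = a * v f + v g.
Proof. by move=> [_ vl _]; exact: vl. Qed.

Lemma tangentM x v f g : tangent x v -> smooth f x -> smooth g x ->
  v (fun y => f y * g y) = v f * g x + f x * v g.
Proof. by move=> [_ _ vm]; exact: vm. Qed.

Lemma tangentD x v f g : tangent x v -> smooth f x -> smooth g x ->
  v (fun y => f y + g y) = v f + v g.
Proof.
move=> tv fx gx; rewrite -[v f]mul1r -(tangentZD 1 tv fx gx).
by apply: (tangent_congr tv); [exact: mfd_smoothD|apply: near_true => y; rewrite mul1r].
Qed.

Lemma tangent_cst x v a : tangent x v -> v (fun=> a) = 0.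
Proof.
move=> tv; have s1 (b : R) : smooth (fun _ : M => b) x by exact: mfd_smooth_cst.
(* The product rule for 1 = 1 * 1 gives v 1 = 2 v 1. *)
have := tangentM tv (s1 1) (s1 1).
have -> : (fun y : M => (1 : R) * 1) = (fun=> 1) by apply/funext => y; rewrite mulr1.
move=> E; have v1 : v (fun=> 1) = 0 by move: E; rewrite mulr1 mul1r; lra.
have := tangentZD a tv (s1 1) (s1 0); rewrite v1 mulr0 add0r.
have -> : (fun y : M => a * 1 + 0) = (fun=> a) by apply/funext => y; rewrite mulr1 addr0.
move=> ->; have := tangentZD 1 tv (s1 0) (s1 0).
by rewrite mulr0 addr0; lra.
Qed.

Lemma tangentZ x v a f : tangent x v -> smooth f x -> v (fun y => a * f y) = a * v f.
Proof.
move=> tv fx; have s0 : smooth (fun _ : M => 0 : R) x by exact: mfd_smooth_cst.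
have := tangentZD a tv fx s0.
rewrite (tangent_cst 0 tv) addr0 => <-; congr v.
by apply/funext => y; rewrite addr0.
Qed.

Lemma tangentN x v f : tangent x v -> smooth f x -> v (fun y => - f y) = - v f.
Proof.
move=> tv fx; rewrite -mulN1r -(tangentZ _ tv) //.
by congr v; apply/funext => y; rewrite mulN1r.
Qed.

Lemma tangentB x v f g : tangent x v -> smooth f x -> smooth g x ->
  v (fun y => f y - g y) = v f - v g.
Proof.
move=> tv fx gx; rewrite (tangentD tv) ?(tangentN tv) //; exact: mfd_smoothN.
Qed.

Lemma tangent_sum x v (J : finType) (P : pred J) (f : J -> M -> R) :
  tangent x v -> (forall j, P j -> smooth (f j) x) ->
  v (fun y => \sum_(j | P j) f j y) = \sum_(j | P j) v (f j).
Proof.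
move=> tv fx.
have H (s : seq J) : v (fun y => \sum_(j <- s | P j) f j y) =
    \sum_(j <- s | P j) v (f j) /\ smooth (fun y => \sum_(j <- s | P j) f j y) x.
  elim: s => [|j s [IH sIH]].
    rewrite big_nil.
    have -> : (fun y => \sum_(j <- [::] | P j) f j y) = (fun=> 0).
      by apply/funext => y; rewrite big_nil.
    by split; [exact: tangent_cst tv|exact: mfd_smooth_cst].
  rewrite big_cons; case: (boolP (P j)) => Pj.
    have -> : (fun y => \sum_(j <- j :: s | P j) f j y) =
        (fun y => f j y + \sum_(j <- s | P j) f j y).
      by apply/funext => y; rewrite big_cons Pj.
    rewrite (tangentD tv (fx j Pj) sIH) IH; split=> //.
    exact: mfd_smoothD (fx j Pj) sIH.
  have -> : (fun y => \sum_(j <- j :: s | P j) f j y) =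
      (fun y => \sum_(j <- s | P j) f j y).
    by apply/funext => y; rewrite big_cons (negPf Pj).
  by [].
by have [] := H (index_enum J).
Qed.

(* By Hadamard's lemma. *)
Lemma tangent_eq_coord x v w c : coordinates c -> cdom c x ->
  tangent x v -> tangent x w ->
  (forall i, v (fun y => cmap c y 0 i) = w (fun y => cmap c y 0 i)) ->
  forall f, smooth f x -> v f = w f.
Proof.
move=> cc cx tv tw vw f fx.
have /(smoothE _ cc cx)/hadamard_sum[g [sg fg]] := fx.
have sx i : smooth (fun y => cmap c y 0 i) x by exact: smooth_cmap.
have sgc i : smooth (fun y => g i (cmap c y)) x by exact: smooth_in_chart.
have sa i : smooth (fun y => cmap c y 0 i - cmap c x 0 i) x.
  by apply: mfd_smoothB => //; exact: mfd_smooth_cst.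
(* Applied to Hadamard's expansion, u only sees the values of the g_i at x, since the other factors
   vanish there. *)
have H u : tangent x u ->
    u f = \sum_i g i (cmap c x) * u (fun y => cmap c y 0 i).
  move=> tu; have sE : smooth (fun y => f x + \sum_i (cmap c y 0 i - cmap c x 0 i) *
      g i (cmap c y)) x.
    apply: mfd_smoothD; first exact: mfd_smooth_cst.
    by apply: mfd_smooth_sum => i _; exact: mfd_smoothM.
  rewrite (tangent_congr (g := fun y => f x + \sum_i (cmap c y 0 i - cmap c x 0 i) *
      g i (cmap c y)) tu fx).
    rewrite (tangentD tu); [|exact: mfd_smooth_cst|by apply: mfd_smooth_sum => i _; exact: mfd_smoothM].
    rewrite (tangent_cst _ tu) add0r (tangent_sum tu); last by move=> i _; exact: mfd_smoothM.
    apply: eq_bigr => i _; rewrite (tangentM tu) // subrr mul0r addr0 mulrC.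
    by rewrite (tangentB tu) ?(tangent_cst _ tu) ?subr0 //; exact: mfd_smooth_cst.
  have [hc _] := cc; apply/(chart_near _ hc cx).
  have := near_and fg (chart_inv_near hc cx); apply: near_imp => u' [/= -> [-> _]].
  by rewrite (cmapK cc cx).
by rewrite (H v tv) (H w tw); apply: eq_bigr => i _; rewrite vw.
Qed.

Lemma tangent_ext x v w : (forall f, smooth f x -> v f = w f) -> tangent x v -> tangent x w.
Proof.
move=> vw tv; split=> [f g fx fg|a f g fx gx|f g fx gx].
- rewrite -(vw f fx) -(vw g (mfd_smooth_congr fg fx)); exact: (tangent_congr tv fx fg).
- have sfg : smooth (fun y => a * f y + g y) x.
    have sa : smooth (fun _ : M => a) x by exact: mfd_smooth_cst.
    exact: mfd_smoothD (mfd_smoothM sa fx) gx.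
  by rewrite -(vw _ sfg) -(vw f fx) -(vw g gx); exact: (tangentZD a tv fx gx).
- rewrite -(vw _ (mfd_smoothM fx gx)) -(vw f fx) -(vw g gx); exact: (tangentM tv fx gx).
Qed.

Lemma tangent_comb x a v w : tangent x v -> tangent x w ->
  tangent x (fun f => a * v f + w f).
Proof.
move=> tv tw; split=> [f g fx fg|b f g fx gx|f g fx gx].
- by rewrite (tangent_congr tv fx fg) (tangent_congr tw fx fg).
- by rewrite (tangentZD _ tv) // (tangentZD _ tw) //; ring.
- by rewrite (tangentM tv) // (tangentM tw) //; ring.
Qed.

Lemma tangent0 x : tangent x (fun=> 0).
Proof. by split=> [//|a f g _ _|f g _ _]; ring. Qed.

Lemma tangent_lin x (J : finType) (a : J -> R) (v : J -> (M -> R) -> R) :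
  (forall j, tangent x (v j)) -> tangent x (fun f => \sum_j a j * v j f).
Proof.
move=> tv; suff H (s : seq J) : tangent x (fun f => \sum_(j <- s) a j * v j f) by exact: H.
elim: s => [|j s IH].
  by apply: tangent_ext (tangent0 x) => f _; rewrite big_nil.
apply: tangent_ext (tangent_comb (a j) (tv j) IH) => f _.
by rewrite big_cons.
Qed.

Definition pderiv c (i : 'I_n) y f : R := 'D_'e_i (f \o cinv c) (cmap c y).

Lemma tangent_pderiv c i y : coordinates c -> cdom c y -> tangent y (pderiv c i y).
Proof.
move=> cc cy; have [hc _] := cc; split=> [f g fy fg|a f g fy gy|f g fy gy].
- by apply: near_eq_derive; apply/(chart_near (fun z => f z = g z) hc cy).
- have [_] := is_deriveD (is_deriveZ a (smooth_is_derive i ((smoothE _ cc cy).1 fy)))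
    (smooth_is_derive i ((smoothE _ cc cy).1 gy)); exact.
- have [_ E] := is_deriveM (smooth_is_derive i ((smoothE _ cc cy).1 fy))
    (smooth_is_derive i ((smoothE _ cc cy).1 gy)).
  apply: (etrans E); rewrite /= (cmapK cc cy) addrC -![_ *: _]/(_ * _).
  by rewrite [g y * _]mulrC.
Qed.

Lemma smooth_pderiv c i y f : coordinates c -> cdom c y -> smooth f y ->
  smooth (fun z => pderiv c i z f) y.
Proof.
move=> cc cy fy; apply: (smooth_in_chart (h := 'D_'e_i (f \o cinv c))) => //.
by apply: smooth_derive; apply/(smoothE _ cc cy).
Qed.

Lemma pderiv_coord c i y k : coordinates c -> cdom c y ->
  pderiv c i y (fun z => coord (cmap c z) k) = (k == i :> nat)%:R.
Proof.
move=> cc cy; rewrite /pderiv -(derive_coord k i (cmap c y)).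
apply: near_eq_derive; have [hc _] := cc.
by apply: near_imp (chart_inv_near hc cy) => u [/= ->].
Qed.

Lemma near_vector_field X x : @vector_field R n M X x -> \forall y \near x, vector_field X y.
Proof. exact: near_near. Qed.

Lemma vector_field_tangent X x : @vector_field R n M X x -> tangent x (X x).
Proof. by move=> /near_here[]. Qed.

Lemma vector_field_smooth X x f : @vector_field R n M X x -> smooth f x ->
  smooth (fun z => X z f) x.
Proof. by move=> /near_here[_]; exact. Qed.

Lemma vector_field_congr X Y x : vector_field X x ->
  (\forall y \near x, forall f, smooth f y -> X y f = Y y f) -> @vector_field R n M Y x.
Proof.
move=> vX XY; have := near_and (near_near XY) vX; apply: near_imp => y [XYy [tX sX]]; split.
  exact: tangent_ext (near_here XYy) tX.
move=> f fy; apply: mfd_smooth_congr (sX f fy).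
have := near_and XYy (mfd_smooth_near fy); apply: near_imp => z [XYz fz]; exact: XYz.
Qed.

Lemma vector_field_comb a X Y x : smooth a x -> vector_field X x -> vector_field Y x ->
  @vector_field R n M (fun y f => a y * X y f + Y y f) x.
Proof.
move=> sa vX vY; have := near_and (mfd_smooth_near sa) (near_and vX vY).
apply: near_imp => y [say [[tX sX] [tY sY]]]; split; first exact: tangent_comb.
by move=> f fy; apply: mfd_smoothD; [apply: mfd_smoothM => //; exact: sX|exact: sY].
Qed.

Lemma vector_field0 x : @vector_field R n M (fun _ _ => 0) x.
Proof. by apply: near_true => y; split=> [|f _]; [exact: tangent0|exact: mfd_smooth_cst]. Qed.

Lemma vector_field_lin x (J : finType) (a : J -> M -> R) (X : J -> M -> (M -> R) -> R) :
  (forall j, smooth (a j) x) -> (forall j, vector_field (X j) x) ->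
  vector_field (fun y f => \sum_j a j y * X j y f) x.
Proof.
move=> sa vX.
suff H (s : seq J) : vector_field (fun y f => \sum_(j <- s) a j y * X j y f) x by exact: H.
elim: s => [|j s IH].
  by apply: vector_field_congr (vector_field0 x) _; apply: near_true => y f _; rewrite big_nil.
apply: vector_field_congr (vector_field_comb (sa j) (vX j) IH) _.
by apply: near_true => y f _; rewrite big_cons.
Qed.

Lemma vector_field_pderiv c i x : coordinates c -> cdom c x ->
  vector_field (fun y => pderiv c i y) x.
Proof.
move=> cc cx; apply: near_imp (cdom_near cc cx) => y cy.
by split; [exact: tangent_pderiv|move=> f; exact: smooth_pderiv].
Qed.

Definition commutator (X Y : M -> (M -> R) -> R) : M -> (M -> R) -> R :=
  fun y f => X y (fun z => Y z f) - Y y (fun z => X z f).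

Lemma vector_field_commutator X Y x : vector_field X x -> vector_field Y x ->
  vector_field (commutator X Y) x.
Proof.
move=> vX vY; have := near_and (near_vector_field vX) (near_vector_field vY).
apply: near_imp => y [vXy vYy].
have tX := vector_field_tangent vXy; have tY := vector_field_tangent vYy.
have sX f : smooth f y -> smooth (fun z => X z f) y by exact: vector_field_smooth.
have sY f : smooth f y -> smooth (fun z => Y z f) y by exact: vector_field_smooth.
split; last by move=> f fy; apply: mfd_smoothB; [apply/sX/sY|apply/sY/sX].
have nr Z : vector_field Z y -> forall f g, smooth f y -> smooth g y ->
    \forall z \near y, tangent z (Z z) /\ smooth f z /\ smooth g z.
  move=> vZ f g fy gy; apply: near_and; first by apply: near_imp vZ => z [].
  by apply: near_and; exact: mfd_smooth_near.
split=> [f g fy fg|a f g fy gy|f g fy gy].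
- rewrite /commutator; congr (_ - _).
    apply: (tangent_congr tX (sY _ fy)).
    have := near_and (near_near fg) (nr Y vYy f f fy fy); apply: near_imp => z [fgz [tz [fz _]]].
    exact: (tangent_congr tz fz fgz).
  apply: (tangent_congr tY (sX _ fy)).
  have := near_and (near_near fg) (nr X vXy f f fy fy); apply: near_imp => z [fgz [tz [fz _]]].
  exact: (tangent_congr tz fz fgz).
- have E Z W : tangent y W -> vector_field Z y ->
      W (fun z => Z z (fun w : M => a * f w + g w)) =
      a * W (fun z => Z z f) + W (fun z => Z z g).
    move=> tW vZ; have sZ h : smooth h y -> smooth (fun z => Z z h) y by exact: vector_field_smooth.
    rewrite -(tangentZD a tW (sZ f fy) (sZ g gy)).
    apply: (tangent_congr tW).
      apply: sZ; apply: mfd_smoothD => //; apply: mfd_smoothM => //; exact: mfd_smooth_cst.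
    apply: near_imp (nr Z vZ f g fy gy) => z [tz [fz gz]]; exact: (tangentZD a tz fz gz).
  by rewrite /commutator !E //; ring.
(* The mixed terms Z f * W g + W f * Z g are symmetric in Z and W and cancel in the commutator. *)
- have E Z W : tangent y W -> vector_field Z y ->
      W (fun z => Z z (fun w : M => f w * g w)) =
      W (fun z => Z z f) * g y + Z y f * W g + (W f * Z y g + f y * W (fun z => Z z g)).
    move=> tW vZ; have sZ h : smooth h y -> smooth (fun z => Z z h) y by exact: vector_field_smooth.
    have sf := sZ f fy; have sg := sZ g gy.
    rewrite -(tangentM tW sf gy) -(tangentM tW fy sg).
    rewrite -(tangentD tW); [|exact: mfd_smoothM|exact: mfd_smoothM].
    apply: (tangent_congr tW); first exact/sZ/mfd_smoothM.
    apply: near_imp (nr Z vZ f g fy gy) => z [tz [fz gz]]; exact: (tangentM tz fz gz).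
  by rewrite /commutator !E //; ring.
Qed.

End Tangent.

Lemma tangent_pushforward (R : realType) (m n : nat) (M : manifold R m) (N : manifold R n)
    (p : M -> N) x (v : (M -> R) -> R) :
  smooth_map p -> tangent x v -> tangent (p x) (fun g => v (g \o p)).
Proof.
move=> sp tv; have sc g : smooth g (p x) -> smooth (g \o p) x by exact: smooth_map_comp.
split=> [f g fx fg|a f g fx gx|f g fx gx].
- by apply: (tangent_congr tv (sc _ fx)); exact: ((sp x).1 _ fg).
- exact: (tangentZD a tv (sc _ fx) (sc _ gx)).
- exact: (tangentM tv (sc _ fx) (sc _ gx)).
Qed.

(** * Vector fields preserving an elliptic divisor *)

Section Ideals.
Variables (R : realType) (n : nat) (M : manifold R n).
Variable (I : M -> set (M -> R)).
Hypothesis idI : ideal_sheaf (@smooth R n M) I.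
Implicit Types (X Y : M -> (M -> R) -> R) (x y : M) (f g : M -> R).

Lemma ideal_smooth x f : I x f -> smooth f x.
Proof. by have [H _ _ _ _] := idI x; move=> /H[]. Qed.

Lemma ideal_congr x f g : (\forall y \near x, f y = g y) -> I x f -> I x g.
Proof. by have [_ H _ _ _] := idI x => fg /H; apply. Qed.

Lemma idealD x f g : I x f -> I x g -> I x (fun y => f y + g y).
Proof. by have [_ _ _ H _] := idI x; exact: H. Qed.

Lemma idealM x a f : smooth a x -> I x f -> I x (fun y => a y * f y).
Proof. by have [_ _ _ _ H] := idI x; exact: H. Qed.

Lemma idealB x f g : I x f -> I x g -> I x (fun y => f y - g y).
Proof.
move=> fx gx; apply: idealD => //.
apply: (@ideal_congr _ (fun y => (fun=> -1) y * g y)).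
  by apply: near_true => y; rewrite mulN1r.
by apply: idealM => //; exact: mfd_smooth_cst.
Qed.

Lemma preserves_congr X Y x :
  (\forall y \near x, forall f, smooth f y -> X y f = Y y f) ->
  preserves I X x -> preserves I Y x.
Proof.
move=> XY pX; have := near_and (near_near XY) pX; apply: near_imp => y [XYy Xy] f fI.
apply: ideal_congr (Xy f fI).
have := near_and XYy (mfd_smooth_near (ideal_smooth fI)).
by apply: near_imp => z [XYz fz]; exact: XYz.
Qed.

Lemma preserves_comb a X Y x : smooth a x -> preserves I X x -> preserves I Y x ->
  preserves I (fun y f => a y * X y f + Y y f) x.
Proof.
move=> sa pX pY; have := near_and (mfd_smooth_near sa) (near_and pX pY).
apply: near_imp => y [say [Xy Yy]] f fI.
by apply: idealD; [apply: idealM => //; exact: Xy|exact: Yy].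
Qed.

Lemma preserves0 x : preserves I (fun _ _ => 0) x.
Proof. by apply: near_true => y f _; have [_ _ ? _ _] := idI y. Qed.

Lemma preserves_lin x (J : finType) (a : J -> M -> R) (X : J -> M -> (M -> R) -> R) :
  (forall j, smooth (a j) x) -> (forall j, preserves I (X j) x) ->
  preserves I (fun y f => \sum_j a j y * X j y f) x.
Proof.
move=> sa pX.
suff H (s : seq J) : preserves I (fun y f => \sum_(j <- s) a j y * X j y f) x by exact: H.
elim: s => [|j s IH].
  by apply: preserves_congr (preserves0 x); apply: near_true => y f _; rewrite big_nil.
apply: preserves_congr (preserves_comb (sa j) (pX j) IH).
by apply: near_true => y f _; rewrite big_cons.
Qed.

Lemma preserves_commutator X Y x : preserves I X x -> preserves I Y x ->
  preserves I (commutator X Y) x.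
Proof.
move=> pX pY; have := near_and pX pY; apply: near_imp => y [Xy Yy] f fI.
by apply: idealB; [apply/Xy/Yy|apply/Yy/Xy].
Qed.

End Ideals.

(** * The standard local frame of the elliptic tangent bundle *)

Section StandardFields.
Variables (R : realType) (n : nat).

(* The value at the [j]-th coordinate of the [m]-th field of the standard frame:
   the Euler and rotation fields of the [i]-th plane for [m = 2i, 2i+1 < 2k], and
   [d/dx_m] for [m >= 2k]. *)
Definition std_coef (k m : nat) (u : 'rV[R]_n) (j : nat) : R :=
  if (m < k.*2)%N then
    if odd m then
      if j == m.-1 then - coord u m else if j == m then coord u m.-1 else 0
    else
      if j == m then coord u m else if j == m.+1 then coord u m.+1 else 0
  else (j == m)%:R.

Lemma smooth_std_coef k m j u : smooth_rV (fun v => std_coef k m v j) u.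
Proof.
rewrite /std_coef; case: (m < _)%N; last exact: smooth_rV_cst.
case: (odd m); [case: (j == m.-1); [|case: (j == m)]|case: (j == m); [|case: (j == m.+1)]].
- by apply: smooth_rVN; exact: smooth_coord.
- exact: smooth_coord.
- exact: smooth_rV_cst.
- exact: smooth_coord.
- exact: smooth_coord.
- exact: smooth_rV_cst.
Qed.

(** In complex notation the combination multiplies z_i by the complex number with real part b_(2i)
    and imaginary part b_(2i+1): for j < 2k only the index m = j and its partner in the same plane
    contribute. *)
Lemma std_coef_sum (k : nat) (b : nat -> R) (u : 'rV[R]_n) (j : nat) : (k.*2 <= n)%N -> (j < n)%N ->
  \sum_(m < n) b m * std_coef k m u j =
  if (j < k.*2)%N then
    if odd j then b j.-1 * coord u j + b j * coord u j.-1
    else b j * coord u j - b j.+1 * coord u j.+1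
  else b j.
Proof.
move=> kn jn; rewrite -(big_mkord xpredT (fun m => b m * std_coef k m u j)).
have inj_j : j \in index_iota 0 n by rewrite mem_index_iota.
rewrite (bigD1_seq j) ?iota_uniq //=.
have [jk|jk] := boolP (j < k.*2)%N; last first.
  rewrite {1}/std_coef (negPf jk) eqxx mulr1 big1_seq ?addr0 // => m /andP[mj _].
  rewrite /std_coef; case: ifP => [mk|_]; last by rewrite eq_sym (negPf mj) mulr0.
  have jm : (m < j)%N by rewrite (leq_trans mk) // leqNgt.
  have jm1 : (j == m.-1) = false by apply/eqP => E; move: jm; rewrite E ltnNge leq_pred.
  rewrite jm1 eq_sym (negPf mj); case: ifP => om; rewrite ?mulr0 //.
  case: eqP => [E|]; last by rewrite mulr0.
  have : (m.+1 < k.*2)%N.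
    by rewrite ltn_neqAle mk andbT; apply/eqP => /(congr1 odd); rewrite /= odd_double om.
  by rewrite -E (negPf jk).
have [oj|oj] := boolP (odd j).
  have j0 : (0 < j)%N by case: j oj {jn inj_j jk}.
  have p1 : (j.-1).+1 = j by rewrite prednK.
  have ojp : odd j.-1 = false by move: oj; rewrite -{1}p1 /=; case: odd.
  have inj_p : j.-1 \in index_iota 0 n by rewrite mem_index_iota /= (leq_ltn_trans _ jn) // leq_pred.
  rewrite -big_filter (bigD1_seq j.-1) /=; last first.
  - by apply: filter_uniq; exact: iota_uniq.
  - by rewrite mem_filter inj_p andbT neq_ltn -{2}p1 ltnSn.
  rewrite big1_seq => [|m]; last first.
    rewrite mem_filter => /and3P[mp mj _]; rewrite /std_coef.
    have E1 : (j == m) = false by rewrite eq_sym (negPf mj).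
    have E2 : (j == m.+1) = false by apply/eqP => E; move: mp; rewrite E /= eqxx.
    case: ifP => _; last by rewrite E1 mulr0.
    case: ifP => om; last by rewrite E1 E2 mulr0.
    have E3 : (j == m.-1) = false.
      apply/eqP => E; have m0 : (0 < m)%N by rewrite lt0n; apply: contraTneq om => ->.
      by move: om; rewrite -(prednK m0) -E /= oj.
    by rewrite E1 E3 mulr0.
  rewrite addr0 /std_coef jk oj.
  have -> : (j == j.-1) = false by apply/eqP => E; move: (ltnn j); rewrite -{2}p1 -E ltnSn.
  rewrite eqxx ojp (leq_ltn_trans (leq_pred _) jk).
  by rewrite p1 eqxx addrC.
have jn1 : (j.+1 < k.*2)%N.
  by rewrite ltn_neqAle jk andbT; apply/eqP => /(congr1 odd); rewrite /= odd_double oj.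
have inj_s : j.+1 \in index_iota 0 n by rewrite mem_index_iota /= (leq_trans jn1).
rewrite -big_filter (bigD1_seq j.+1) /=; last first.
- by apply: filter_uniq; exact: iota_uniq.
- by rewrite mem_filter inj_s andbT neq_ltn ltnSn orbT.
rewrite big1_seq => [|m]; last first.
  rewrite mem_filter => /and3P[mp mj _]; rewrite /std_coef.
  have E1 : (j == m) = false by rewrite eq_sym (negPf mj).
  case: ifP => _; last by rewrite E1 mulr0.
  case: ifP => om.
    have E3 : (j == m.-1) = false.
      apply/eqP => E; have m0 : (0 < m)%N by rewrite lt0n; apply: contraTneq om => ->.
      by move: mp; rewrite -(prednK m0) -E eqxx.
    by rewrite E1 E3 mulr0.
  have E2 : (j == m.+1) = false.
    by apply/eqP => E; move: oj; rewrite E /= om.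
  by rewrite E1 E2 mulr0.
by rewrite addr0 /std_coef jk jn1 /= (negPf oj) /= !eqxx mulrN.
Qed.

Variable M : manifold R n.
Implicit Types (c d : chart R n M) (x y : M) (f g : M -> R).

Definition std c (k m : nat) (y : M) (f : M -> R) : R :=
  \sum_(j < n) std_coef k m (cmap c y) j * pderiv c j y f.

Lemma vector_field_std c k m x : coordinates c -> cdom c x -> vector_field (std c k m) x.
Proof.
move=> cc cx; apply: vector_field_lin => j; last exact: vector_field_pderiv.
by apply: (smooth_in_chart (h := fun u => std_coef k m u j)) => //; exact: smooth_std_coef.
Qed.

Lemma std_coord c k m y j : coordinates c -> cdom c y -> (j < n)%N ->
  std c k m y (fun z => coord (cmap c z) j) = std_coef k m (cmap c y) j.
Proof.
move=> cc cy jn; rewrite /std (bigD1 (Ordinal jn)) //= pderiv_coord // eqxx mulr1.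
rewrite big1 ?addr0 // => i ij; rewrite pderiv_coord //.
by rewrite (_ : (j == i) = false) ?mulr0 //; apply/eqP => E; case/eqP: ij; exact: val_inj.
Qed.

Definition std_comb c (k : nat) (b : nat -> R) (y : M) (f : M -> R) : R :=
  \sum_(m < n) b m * std c k m y f.

Lemma std_comb_coord c k b y j : coordinates c -> cdom c y -> (k.*2 <= n)%N -> (j < n)%N ->
  std_comb c k b y (fun z => coord (cmap c z) j) =
  if (j < k.*2)%N then
    if odd j then b j.-1 * coord (cmap c y) j + b j * coord (cmap c y) j.-1
    else b j * coord (cmap c y) j - b j.+1 * coord (cmap c y) j.+1
  else b j.
Proof.
move=> cc cy kn jn; rewrite -(std_coef_sum b) //; apply: eq_bigr => m _.
by rewrite std_coord.
Qed.

Lemma tangent_std_comb c k b y : coordinates c -> cdom c y -> tangent y (std_comb c k b y).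
Proof.
move=> cc cy; apply: tangent_lin => m.
exact: vector_field_tangent (vector_field_std k m cc cy).
Qed.

Lemma tangent_prod x (v : (M -> R) -> R) k (g : nat -> M -> R) :
  tangent x v -> (forall i, smooth (g i) x) ->
  v (fun y => \prod_(i < k) g i y) = \sum_(i < k) v (g i) * \prod_(j < k | j != i) g j x.
Proof.
move=> tv sg; elim: k => [|k IH].
  have -> : (fun y => \prod_(i < 0) g i y) = (fun=> 1) by apply/funext => y; rewrite big_ord0.
  by rewrite (tangent_cst _ tv) big_ord0.
have -> : (fun y => \prod_(i < k.+1) g i y) = (fun y => (\prod_(i < k) g i y) * g k y).
  by apply/funext => y; rewrite big_ord_recr.
rewrite (tangentM tv) // ?IH; last by apply: mfd_smooth_prod => i _.
rewrite big_ord_recr /= mulr_suml; congr (_ + _).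
  apply: eq_bigr => i _; rewrite -mulrA; congr (_ * _).
  rewrite [in RHS]big_mkcond big_ord_recr /= [in LHS]big_mkcond; congr (_ * _).
  by rewrite -val_eqE /= gtn_eqF.
rewrite mulrC; congr (_ * _); rewrite [in RHS]big_mkcond big_ord_recr /= eqxx mulr1.
apply: eq_bigr => i _; by rewrite -val_eqE /= ltn_eqF.
Qed.

Variable (I : M -> set (M -> R)).

Definition rsq_prod c (k : nat) (y : M) : R := \prod_(i < k) rsq (cmap c y) i.

Lemma smooth_rsq_prod c k x : coordinates c -> cdom c x -> smooth (rsq_prod c k) x.
Proof.
move=> cc cx; apply: (smooth_in_chart (h := fun u => \prod_(i < k) rsq u i)) => //.
by apply: smooth_rV_prod => i _; exact: smooth_rsq.
Qed.

Lemma generated1P c k x f :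
  generated (@smooth R n M) (cdom c) (fun _ : 'I_1 => rsq_prod c k) I -> cdom c x ->
  I x f <-> exists2 a, smooth a x & \forall y \near x, f y = a y * rsq_prod c k y.
Proof.
move=> gI cx; rewrite (gI x cx f); split=> [[a [sa E]]|[a sa E]].
  by exists (a ord0) => //; apply: near_imp E => y; rewrite big_ord1.
by exists (fun=> a); split=> //; apply: near_imp E => y; rewrite big_ord1.
Qed.

Lemma ellipticP c k x f : elliptic_coordinates I c k -> cdom c x ->
  I x f <-> exists2 a, smooth a x & \forall y \near x, f y = a y * rsq_prod c k y.
Proof. by move=> [_ _ gI]; exact: generated1P. Qed.

(* In complex notation: [X z_i = (a + ib) z_i] for all [i < k]. *)
Definition elliptic_field c (k : nat) (X : M -> (M -> R) -> R) (x : M) : Prop :=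
  forall i, (i < k)%N -> exists a b, [/\ smooth a x, smooth b x & \forall y \near x,
    X y (fun z => coord (cmap c z) i.*2) =
      a y * coord (cmap c y) i.*2 - b y * coord (cmap c y) i.*2.+1 /\
    X y (fun z => coord (cmap c z) i.*2.+1) =
      a y * coord (cmap c y) i.*2.+1 + b y * coord (cmap c y) i.*2].

Lemma tangent_rsq x v c i : coordinates c -> cdom c x -> tangent x v ->
  v (fun y => rsq (cmap c y) i) =
  2 * (coord (cmap c x) i.*2 * v (fun z => coord (cmap c z) i.*2) +
       coord (cmap c x) i.*2.+1 * v (fun z => coord (cmap c z) i.*2.+1)).
Proof.
move=> cc cx tv; have s j : smooth (fun z => coord (cmap c z) j) x by exact: smooth_cmap_coord.
rewrite /rsq; under [X in v X]eq_fun do rewrite !expr2.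
by rewrite (tangentD tv) ?(tangentM tv) //; [ring|exact: mfd_smoothM|exact: mfd_smoothM].
Qed.

(** The imaginary part of the factor of z_i is a rotation and does not affect |z_i|^2, so X |z_i|^2
    = 2 a_i |z_i|^2, and X multiplies the generator of the ideal by the smooth function sum_i 2
    a_i. *)
Lemma elliptic_field_preserves c k X x : ideal_sheaf (@smooth R n M) I ->
  elliptic_coordinates I c k -> cdom c x ->
  vector_field X x -> elliptic_field c k X x -> preserves I X x.
Proof.
move=> idI ec cx vX eX; have [cc _ _] := ec.
have /choice[a aP] (i : 'I_k) : exists a, smooth a x /\ \forall y \near x,
    X y (fun z => rsq (cmap c z) i) = 2 * a y * rsq (cmap c y) i.
  have [a [b [sa sb E]]] := eX i (ltn_ord i); exists a; split=> //.
  have := near_and (cdom_near cc cx) (near_and vX E).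
  apply: near_imp => y [cy [[tX _] [E1 E2]]].
  by rewrite (tangent_rsq i cc cy tX) E1 E2 /rsq; ring.
have : \forall y \near x, forall i, smooth (a i) y /\ \forall z \near y,
    X z (fun w => rsq (cmap c w) i) = 2 * a i z * rsq (cmap c z) i.
  apply: near_all => i; have [sa E] := aP i.
  by have := near_and (mfd_smooth_near sa) (near_near E); apply: near_imp.
move=> aN; have := near_and (cdom_near cc cx) (near_and (near_vector_field vX) aN).
apply: near_imp => y [cy [vXy aNy]] f /(ellipticP f ec cy)[h sh fh].
have sp : smooth (rsq_prod c k) y by exact: smooth_rsq_prod.
apply/(ellipticP _ ec cy); exists (fun z => X z h + h z * \sum_i 2 * a i z).
  apply: mfd_smoothD; first exact: vector_field_smooth.
  apply: mfd_smoothM => //; apply: mfd_smooth_sum => i _.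
  by apply: mfd_smoothM; [exact: mfd_smooth_cst|have [] := aNy i].
have aE : \forall z \near y, forall i : 'I_k,
    X z (fun w => rsq (cmap c w) i) = 2 * a i z * rsq (cmap c z) i.
  by apply: near_all => i; have [] := aNy i.
have := near_and (near_and (cdom_near cc cy) (near_and vXy aE))
  (near_and (near_near fh) (near_and (mfd_smooth_near sh) (mfd_smooth_near sp))).
apply: near_imp => z [[cz [[tX _] Ez]] [fhz [hz pz]]].
have fz : smooth f z.
  apply: mfd_smooth_congr (mfd_smoothM hz pz); apply: near_imp fhz => w ->//.
rewrite (tangent_congr tX fz fhz) (tangentM tX hz pz) mulrDl; congr (_ + _).
rewrite -mulrA; congr (_ * _).
have sr (i : nat) : smooth (fun w => rsq (cmap c w) i) z.
  by apply: (smooth_in_chart (h := fun u => rsq u i)) => //; exact: smooth_rsq.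
rewrite /rsq_prod (tangent_prod k tX sr) mulr_suml; apply: eq_bigr => i _.
by rewrite Ez -mulrA; congr (_ * _); rewrite [in RHS](bigD1 i).
Qed.

(** Test X on the generator: expanded by the Leibniz rule, X (prod |z_i|^2) = b prod |z_i|^2 is the
    hypothesis of [elliptic_coefficients]. *)
Lemma preserves_elliptic_field c k X x :
  elliptic_coordinates I c k -> cdom c x ->
  vector_field X x -> preserves I X x -> elliptic_field c k X x.
Proof.
move=> ec cx vX /near_here pX; have [cc kn _] := ec; have [hc _] := cc.
have sp : smooth (rsq_prod c k) x by exact: smooth_rsq_prod.
have /pX/(ellipticP _ ec cx)[b sb E] : I x (rsq_prod c k).
  apply/(ellipticP _ ec cx); exists (fun=> 1); first exact: mfd_smooth_cst.
  by apply: near_true => y; rewrite mul1r.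
pose Xm m : 'rV[R]_n -> R := (fun y => X y (fun z => coord (cmap c z) m)) \o cinv c.
have sX m : smooth_rV (Xm m) (cmap c x).
  by apply/(smoothE _ cc cx); apply: vector_field_smooth => //; exact: smooth_cmap_coord.
(* Halved because X |z_i|^2 = 2 Re (conj(z_i) X z_i). *)
have sb' : smooth_rV (fun u => b (cinv c u) / 2) (cmap c x).
  apply: (@smooth_rVM _ _ (b \o cinv c)); first by apply/(smoothE _ cc cx).
  exact: smooth_rV_cst.
have E' : \forall u \near cmap c x,
    \sum_(i < k) (coord u i.*2 * Xm i.*2 u + coord u i.*2.+1 * Xm i.*2.+1 u) *
     \prod_(j < k | j != i) rsq u j = (b (cinv c u) / 2) * \prod_(j < k) rsq u j.
  have /(chart_near _ hc cx) := near_and E (near_and vX (cdom_near cc cx)).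
  move=> H; have := near_and H (chart_inv_near hc cx).
  apply: near_imp => u [[Eu [[tX _] cu]] [uK _]].
  have sr (i : nat) : smooth (fun w => rsq (cmap c w) i) (cinv c u).
    by apply: (smooth_in_chart (h := fun u => rsq u i)) => //; exact: smooth_rsq.
  move: Eu; rewrite /rsq_prod (tangent_prod k tX sr) uK => Eu.
  apply: (@mulfI _ 2); first by rewrite pnatr_eq0.
  have h2 (z w : R) : 2 * (z / 2 * w) = z * w by field.
  rewrite h2 -Eu mulr_sumr; apply: eq_bigr => i _.
  by rewrite (tangent_rsq i cc cu tX) uK mulrA.
move=> i ik; have [a [g [sa sg ag]]] := elliptic_coefficients kn sX sb' E' (Ordinal ik).
exists (a \o cmap c), (g \o cmap c); split; try exact: smooth_in_chart.
apply/(chart_near _ hc cx); have := near_and ag (chart_inv_near hc cx).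
by apply: near_imp => u [/= + [uK cu]]; rewrite uK.
Qed.

Lemma coord_cmap c (i : 'I_n) : (fun y : M => cmap c y 0 i) = (fun y => coord (cmap c y) i).
Proof. by apply/funext => y; rewrite coordE. Qed.

Lemma elliptic_field_comb c k X x : coordinates c -> (k.*2 <= n)%N -> cdom c x ->
  vector_field X x -> elliptic_field c k X x -> exists b : nat -> M -> R,
    (forall m, smooth (b m) x) /\ \forall y \near x, forall f, smooth f y ->
      X y f = std_comb c k (fun m => b m y) y f.
Proof.
move=> cc kn cx vX eX.
have /choice[a aP] (i : 'I_k) : exists ab : (M -> R) * (M -> R),
    smooth ab.1 x /\ smooth ab.2 x /\ \forall y \near x,
    X y (fun z => coord (cmap c z) i.*2) =
      ab.1 y * coord (cmap c y) i.*2 - ab.2 y * coord (cmap c y) i.*2.+1 /\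
    X y (fun z => coord (cmap c z) i.*2.+1) =
      ab.1 y * coord (cmap c y) i.*2.+1 + ab.2 y * coord (cmap c y) i.*2.
  by have [a [b [sa sb E]]] := eX i (ltn_ord i); exists (a, b).
(* The two coefficients of the i-th plane go to the indices 2i and 2i + 1; beyond the planes [insub]
   fails and the coefficient is X x_m. *)
pose b (m : nat) : M -> R :=
  if insub m./2 is Some i then (if odd m then (a i).2 else (a i).1)
  else fun y => X y (fun z => coord (cmap c z) m).
exists b; split=> [m|].
  rewrite /b; case: insub => [i|]; last by apply: vector_field_smooth => //; exact: smooth_cmap_coord.
  by have [s1 [s2 _]] := aP i; case: ifP.
have : \forall y \near x, forall i : 'I_k,
    X y (fun z => coord (cmap c z) i.*2) =
      (a i).1 y * coord (cmap c y) i.*2 - (a i).2 y * coord (cmap c y) i.*2.+1 /\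
    X y (fun z => coord (cmap c z) i.*2.+1) =
      (a i).1 y * coord (cmap c y) i.*2.+1 + (a i).2 y * coord (cmap c y) i.*2.
  by apply: near_all => i; have [_ []] := aP i.
move=> E; have := near_and E (near_and vX (cdom_near cc cx)).
apply: near_imp => y [Ey [[tX _] cy]].
apply: (tangent_eq_coord cc cy tX); first exact: tangent_std_comb.
move=> j; rewrite coord_cmap std_comb_coord //.
case: ifPn => jk; last first.
  rewrite /b insubF //; apply/negbTE; move: jk; rewrite -!leqNgt => jk.
  by rewrite -[k]doubleK; exact: half_leq.
have hk : (j./2 < k)%N by rewrite -ltn_double (leq_ltn_trans _ jk) // -{2}[nat_of_ord j]odd_double_half leq_addl.
have [E1 E2] := Ey (Ordinal hk).
have ins : insub j./2 = Some (Ordinal hk) :> option 'I_k.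
  exact: (insubT (fun m => m < k)%N hk).
rewrite /= in E1 E2; case: ifPn => oj.
  have jE : j./2.*2.+1 = j by rewrite -[RHS]odd_double_half oj.
  have jP : j./2.*2 = j.-1 by rewrite -[in RHS]jE.
  have h1 : (j.-1)./2 = j./2 by rewrite -jP doubleK.
  have o1 : odd j.-1 = false by rewrite -jP odd_double.
  by move: E2; rewrite jE jP /b ins h1 ins oj o1.
have jE : j./2.*2 = j by rewrite -[RHS]odd_double_half (negPf oj).
have h1 : (j.+1)./2 = j./2 by rewrite -{1}jE /= uphalf_double.
by move: E1; rewrite jE /b h1 ins /= oj (negPf oj).
Qed.

Lemma elliptic_field_std c k m x : coordinates c -> (k.*2 <= n)%N -> cdom c x ->
  elliptic_field c k (std c k m) x.
Proof.
move=> cc kn cx i ik; pose e q : R := (m == q :> nat)%:R.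
(* The m-th frame field multiplies z_i by 1 if m = 2i, by the imaginary unit if m = 2i + 1, and by 0
   otherwise. *)
exists (fun=> e i.*2), (fun=> e i.*2.+1); split; try exact: mfd_smooth_cst.
apply: near_imp (cdom_near cc cx) => y cy.
have i2 : (i.*2.+1 < k.*2)%N by rewrite -doubleS leq_double.
have in1 := leq_trans i2 kn; have in0 := ltnW in1.
rewrite !std_coord // /std_coef /e.
case: (ltnP m k.*2) => mk; last first.
  have -> : (i.*2 == m) = false by rewrite ltn_eqF // (leq_trans (ltnW i2)).
  have -> : (i.*2.+1 == m) = false by rewrite ltn_eqF // (leq_trans i2).
  rewrite ![m == _]eq_sym.
  have -> : (i.*2 == m) = false by rewrite ltn_eqF // (leq_trans (ltnW i2)).
  have -> : (i.*2.+1 == m) = false by rewrite ltn_eqF // (leq_trans i2).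
  by rewrite !mul0r subr0 addr0.
have nd (p q : nat) : odd p != odd q -> (p == q) = false.
  by move=> pq; apply/eqP => E; move: pq; rewrite E eqxx.
have oi : odd i.*2 = false by rewrite odd_double.
case: ifPn => om.
  have m0 : (0 < m)%N by rewrite lt0n; apply: contraTneq om => ->.
  have omp : odd m.-1 = false by move: om; rewrite -{1}(prednK m0) /=; case: odd.
  rewrite (nd i.*2 m) ?oi ?om // (nd i.*2.+1 m.-1) /= ?oi ?omp //.
  rewrite (nd m i.*2) ?oi ?om // mul0r sub0r mul0r add0r.
  have [->|mi] := eqVneq m i.*2.+1; first by rewrite /= !eqxx !mul1r.
  have -> : (i.*2 == m.-1) = false.
    by apply/eqP => E; case/eqP: mi; rewrite E prednK.
  by rewrite !mul0r ?oppr0.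
rewrite (nd i.*2.+1 m) /= ?oi ?(negPf om) // (nd i.*2 m.+1) /= ?oi ?(negPf om) //.
rewrite (nd m i.*2.+1) /= ?oi ?(negPf om) // !mul0r subr0 addr0 eqSS.
by have [->|mi] := eqVneq m i.*2; rewrite ?eqxx ?mul1r ?mul0r.
Qed.

End StandardFields.

(** * Centring elliptic coordinates *)

Section Recentering.
Variables (R : realType) (n : nat) (M : manifold R n) (I : M -> set (M -> R)).
Implicit Types (c d : chart R n M) (x y q : M) (f g : M -> R).

(** Generators that differ by a unit e define the same ideal; restricting to W serves to make e a
    unit. *)
Lemma elliptic_change c k (W : set M) (phi psi : 'rV[R]_n -> 'rV[R]_n) (k' : nat) (e : M -> R) :
  elliptic_coordinates I c k -> (k'.*2 <= n)%N -> open W ->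
  cancel phi psi -> cancel psi phi ->
  (forall u j, smooth_rV (fun v => phi v 0 j) u) ->
  (forall u j, smooth_rV (fun v => psi v 0 j) u) ->
  (forall y, cdom c y -> W y -> smooth e y /\ e y != 0) ->
  (forall y, cdom c y -> W y ->
     rsq_prod c k y = e y * \prod_(i < k') rsq (phi (cmap c y)) i) ->
  elliptic_coordinates I (Chart (cdom c `&` W) (phi \o cmap c) (cinv c \o psi)) k'.
Proof.
move=> ec k'n oW phiK psiK sphi spsi eW cE; have [cc kn _] := ec.
split; [exact: change_coordinates|exact: k'n|].
move=> x [/= cx Wx] f; rewrite (ellipticP f ec cx).
have [se e0] := eW x cx Wx.
have N : \forall y \near x, [/\ e y != 0 &
    rsq_prod c k y = e y * \prod_(i < k') rsq (phi (cmap c y)) i].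
  have := near_and (cdom_near cc cx) (open_near oW Wx); apply: near_imp => y [cy Wy].
  by split; [have [] := eW y cy Wy|exact: cE].
split=> [[a sa E]|[a [sa E]]].
  exists (fun _ y => a y * e y); split=> [_|]; first exact: mfd_smoothM.
  by have := near_and N E; apply: near_imp => y [[_ +] ->] => ->; rewrite big_ord1 mulrA.
exists (fun y => a ord0 y * (e y)^-1); first by apply: mfd_smoothM => //; exact: mfd_smoothV.
have := near_and N E; apply: near_imp => y [[ey ->] ->].
by rewrite big_ord1 mulrA divfK.
Qed.

(** Serves to move a plane whose |z_i|^2 is a unit to the last place, where it drops out of the
    product. *)
Definition swap_pair (i k p : nat) : nat := if p == i then k else if p == k then i else p.

Definition swap_index (i k j : nat) : nat := (swap_pair i k j./2).*2 + odd j.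

Lemma swap_pairK i k : involutive (swap_pair i k).
Proof.
move=> p; rewrite /swap_pair; case: (eqVneq p i) => [->|pi].
  by rewrite eqxx; case: eqP.
by case: (eqVneq p k) => [->|pk]; rewrite ?eqxx // (negPf pi) (negPf pk).
Qed.

Lemma swap_indexK i k : involutive (swap_index i k).
Proof.
move=> j; have hj : (swap_index i k j)./2 = swap_pair i k j./2.
  by rewrite /swap_index addnC half_bit_double.
have oj : odd (swap_index i k j) = odd j.
  by rewrite /swap_index oddD odd_double oddb.
by rewrite {1}/swap_index hj oj swap_pairK addnC odd_double_half.
Qed.

Lemma coord_swap i k (u : 'rV[R]_n) m : (i < k.+1)%N -> (k.+1.*2 <= n)%N ->
  coord (\row_(j < n) coord u (swap_index i k j) : 'rV[R]_n) m = coord u (swap_index i k m).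
Proof.
move=> ik kn; have [mn|nm] := ltnP m n.
  by rewrite -[m]/(nat_of_ord (Ordinal mn)) coordE mxE.
rewrite !coord_ge //; have km : (k.+1 <= m./2)%N.
  by rewrite -[k.+1]doubleK; apply: half_leq; exact: leq_trans nm.
rewrite /swap_index /swap_pair gtn_eqF ?(leq_trans ik) // gtn_eqF //.
by rewrite addnC odd_double_half.
Qed.

Lemma rsq_swap i k (u : 'rV[R]_n) p : (i < k.+1)%N -> (k.+1.*2 <= n)%N ->
  rsq (\row_(j < n) coord u (swap_index i k j) : 'rV[R]_n) p = rsq u (swap_pair i k p).
Proof.
move=> ik kn; rewrite /rsq !coord_swap // /swap_index /= doubleK uphalf_double.
by rewrite odd_double addn0 addn1.
Qed.

Lemma prod_swap i k (F : nat -> R) : (i < k.+1)%N ->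
  \prod_(p < k.+1) F p = F i * \prod_(p < k) F (swap_pair i k p).
Proof.
rewrite ltnS leq_eqVlt => /orP[/eqP ->|ik].
  rewrite big_ord_recr /= mulrC; congr (_ * _); apply: eq_bigr => p _.
  by rewrite /swap_pair ltn_eqF.
rewrite big_ord_recr /= (bigD1 (Ordinal ik)) //= [in RHS](bigD1 (Ordinal ik)) //=.
have -> : swap_pair i k i = k by rewrite /swap_pair eqxx.
rewrite -mulrA; congr (_ * _); rewrite mulrC; congr (_ * _).
apply: eq_bigr => p; rewrite -val_eqE /= => pi.
by rewrite /swap_pair (negPf pi) ltn_eqF.
Qed.

Lemma smooth_row (F : 'I_n -> 'rV[R]_n -> R) u j :
  smooth_rV (F j) u -> smooth_rV (fun v => (\row_i F i v : 'rV[R]_n) 0 j) u.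
Proof. by congr smooth_rV; apply/funext => v; rewrite mxE. Qed.

(** [multiplicity] asks for a centred chart. Translation to q leaves the first 2k coordinates alone,
    as they already vanish at q, so the generator is unchanged. *)
Lemma vanishing_multiplicity c k q : elliptic_coordinates I c k -> cdom c q ->
  (forall i : 'I_k, rsq (cmap c q) i = 0) -> multiplicity I q k.
Proof.
move=> ec cq q0; have [cc kn _] := ec.
exists (Chart (cdom c `&` setT) ((fun u => u - cmap c q) \o cmap c)
  (cinv c \o (fun u => u + cmap c q))).
split; [by []|by rewrite /= subrr|].
have z0 (i : 'I_k) : coord (cmap c q) i.*2 = 0 /\ coord (cmap c q) i.*2.+1 = 0.
  have /eqP := q0 i.
  by rewrite /rsq paddr_eq0 ?sqr_ge0 // !sqrf_eq0 => /andP[/eqP -> /eqP ->].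
have coordB (u v : 'rV[R]_n) m : coord (u - v) m = coord u m - coord v m.
  by rewrite /coord; case: insub => [j|] /=; rewrite ?mxE ?subr0.
apply: (elliptic_change (e := fun=> 1) ec) => //.
- exact: openT.
- exact: subrK.
- exact: addrK.
- move=> u j; have -> : (fun v => (v - cmap c q) 0 j) = (fun v => v 0 j - cmap c q 0 j).
    by apply/funext => v; rewrite !mxE.
  by apply: smooth_rVB; [exact: smooth_rV_coord|exact: smooth_rV_cst].
- move=> u j; have -> : (fun v => (v + cmap c q) 0 j) = (fun v => v 0 j + cmap c q 0 j).
    by apply/funext => v; rewrite !mxE.
  by apply: smooth_rVD; [exact: smooth_rV_coord|exact: smooth_rV_cst].
- by move=> y _ _; split; [exact: mfd_smooth_cst|exact: oner_neq0].
- move=> y _ _; rewrite mul1r; apply: eq_bigr => i _.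
  by have [z1 z2] := z0 i; rewrite /rsq !coordB z1 z2 !subr0.
Qed.

(** Induction on k: a factor that is nonzero at q is a unit nearby and is dropped after a swap of
    planes; when all factors vanish at q, the chart is translated. *)
Lemma recenter_elliptic c k q : elliptic_coordinates I c k -> cdom c q ->
  exists m, multiplicity I q m.
Proof.
elim: k c => [|k IH] c ec cq.
  by exists 0%N; apply: (vanishing_multiplicity ec cq) => -[].
have [cc kn _] := ec.
have [[i iq]|allz] := pselect (exists i : 'I_k.+1, rsq (cmap c q) i != 0).
  pose phi (u : 'rV[R]_n) : 'rV[R]_n := \row_(j < n) coord u (swap_index i k j).
  pose W : set M := [set y | cdom c y /\ rsq (cmap c y) i != 0].
  have phiK : involutive phi.
    move=> u; apply/rowP => j; rewrite mxE coord_swap // swap_indexK.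
    by rewrite coordE.
  have sr y : cdom c y -> smooth (fun z => rsq (cmap c z) i) y.
    by move=> cy; apply: (smooth_in_chart (h := fun u => rsq u i)) => //; exact: smooth_rsq.
  have sphi u j : smooth_rV (fun v => phi v 0 j) u.
    by apply: (@smooth_row (fun j v => coord v (swap_index i k j))); exact: smooth_coord.
  apply: (IH (Chart (cdom c `&` W) (phi \o cmap c) (cinv c \o phi))); last by split.
  apply: (elliptic_change (e := fun y => rsq (cmap c y) i) ec) => //.
  - by apply: leq_trans kn; rewrite leq_double.
  - rewrite openE => y [cy y0]; apply: near_and; first exact: cdom_near.
    by apply: neq0_near => //; apply: mfd_smooth_cont; exact: sr.
  - by move=> y cy [_ y0]; split=> //; exact: sr.
  - move=> y cy _; rewrite /rsq_prod (prod_swap _ (ltn_ord i)); congr (_ * _).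
    by apply: eq_bigr => p _; rewrite rsq_swap.
exists k.+1; apply: (vanishing_multiplicity ec cq) => i.
by apply/eqP/negPn/negP => iq; apply: allz; exists i.
Qed.

End Recentering.

(** * Open submanifolds and complex-valued functions *)

Section OpenSubmanifold.
Variables (R : realType) (n : nat) (M : manifold R n) (U : set M).
Hypothesis oU : open U.
Implicit Types (c d : chart R n M) (s t : set_type U) (x y : M).

Definition sub_incl (s : set_type U) : M := \val s.

Lemma sub_inclP s : U (sub_incl s).
Proof. exact: set_valP. Qed.

Lemma sub_incl_inj : injective sub_incl.
Proof. exact: val_inj. Qed.

Lemma sub_incl_continuous : continuous sub_incl.
Proof. exact: initial_continuous. Qed.

Lemma sub_nbhsP s (A : set (set_type U)) :
  nbhs s A <-> exists2 B : set M, nbhs (sub_incl s) B & forall t, B (sub_incl t) -> A t.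
Proof.
split=> [sA|[B sB BA]].
  have [C [oC Cs] CA] : exists2 C, open_nbhs s C & C `<=` A by move: sA; rewrite nbhsE.
  case: oC => B oB BC.
  rewrite -BC in Cs; exists B; first exact: (open_near oB Cs).
  by move=> t Bt; apply: CA; rewrite -BC.
have : nbhs s (sub_incl @^-1` B) by exact: (sub_incl_continuous sB).
by apply: filterS => t; exact: BA.
Qed.

(** Inverse of the inclusion on U, made total by the default point [s0] because the inverse map of a
    chart is a total function. *)
Definition sub_retract (s0 : set_type U) (x : M) : set_type U :=
  if pselect (U x) is left Ux then SigSub (mem_set Ux) else s0.

Lemma sub_retractK s0 x : U x -> sub_incl (sub_retract s0 x) = x.
Proof. by rewrite /sub_retract; case: pselect. Qed.

Lemma sub_inclK s0 s : sub_retract s0 (sub_incl s) = s.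
Proof. by apply: sub_incl_inj; rewrite sub_retractK //; exact: sub_inclP. Qed.

Lemma sub_retract_cont s0 x : U x -> {for x, continuous (sub_retract s0)}.
Proof.
move=> Ux A /sub_nbhsP[B]; rewrite sub_retractK // => xB BA.
have xU := open_near oU Ux; rewrite nbhs_simpl /=.
apply: filterS2 xU xB => y Uy By; apply: BA.
by rewrite sub_retractK.
Qed.

Definition sub_chart (c : chart R n M) (s0 : set_type U) : chart R n (set_type U) :=
  Chart [set s | cdom c (sub_incl s)] (cmap c \o sub_incl) (sub_retract s0 \o cinv c).

Definition sub_atlas : set (chart R n (set_type U)) :=
  [set d | exists c s0, atlas c /\ d = sub_chart c s0].

Lemma sub_hausdorff : hausdorff_space (set_type U).
Proof.
move=> s t st; apply: sub_incl_inj; apply: (@manifold_hausdorff R n M) => A B sA tB.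
have [r [Ar Br]] := st _ _ (sub_incl_continuous sA) (sub_incl_continuous tB).
by exists (sub_incl r).
Qed.

Lemma sub_second_countable : @second_countable (set_type U).
Proof.
have [B cB [oB bB]] := @manifold_second_countable R n M.
exists ((fun b => sub_incl @^-1` b) @` B).
  exact: (card_le_trans (card_image_le _ _) cB).
split=> [_ [b Bb <-]|s A /sub_nbhsP[C sC CA]].
  by exists b => //; exact: oB.
have [b [Bb bs] bC] := bB _ _ sC.
exists (sub_incl @^-1` b); first by split=> //; exists b.
by move=> t bt; apply: CA; exact: bC.
Qed.

Lemma sub_chart_is_chart c s0 : is_chart c -> is_chart (sub_chart c s0).
Proof.
move=> hc; have [oc oi cK cm ci] := hc; split=> /=.
- have := open_comp (f := sub_incl) (D := cdom c) (fun s _ => @sub_incl_continuous s) oc.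
  exact.
- rewrite openE => _ [s cs <-] /=.
  have sU := (chart_near U hc cs).1 (open_near oU (sub_inclP s)).
  have := near_and sU (chart_inv_near hc cs); apply: near_imp => u [Uu [uK cu]].
  exists (sub_retract s0 (cinv c u)) => /=; rewrite ?sub_retractK //.
- by move=> s cs; rewrite /= cK // sub_inclK.
- move=> s cs; apply: continuous_comp; first exact: sub_incl_continuous.
  exact: cm.
- move=> s cs; apply: continuous_comp; first exact: ci.
  by apply: sub_retract_cont; rewrite cK //; exact: sub_inclP.
Qed.

Lemma sub_chart_transition c d s0 t0 : is_chart c -> smooth_transition c d ->
  smooth_transition (sub_chart c s0) (sub_chart d t0).
Proof.
move=> hc cd s /= cs ds j; have := cd _ cs ds j; apply: smooth_congr.
have := (chart_near U hc cs).1 (open_near oU (sub_inclP s)).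
by apply: near_imp => u Uu /=; rewrite sub_retractK.
Qed.

Lemma sub_atlas_chart (d : chart R n (set_type U)) : sub_atlas d -> is_chart d.
Proof. by move=> [c [s0 [ac ->]]]; apply: sub_chart_is_chart; exact: atlas_chart. Qed.

Lemma sub_atlas_transition (d d' : chart R n (set_type U)) : sub_atlas d -> sub_atlas d' -> smooth_transition d d'.
Proof.
move=> [c [s0 [ac ->]]] [c' [s0' [ac' ->]]]; apply: sub_chart_transition.
  exact: atlas_chart.
exact: atlas_transition.
Qed.

Lemma sub_atlas_cover (s : set_type U) : exists2 d, sub_atlas d & cdom d s.
Proof.
have [c ac cs] := atlas_cover (sub_incl s).
by exists (sub_chart c s) => //; exists c, s.
Qed.

Definition open_submanifold : manifold R n :=
  Manifold sub_hausdorff sub_second_countable sub_atlas_chart sub_atlas_transition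
    sub_atlas_cover.

Lemma sub_smoothP s0 (f : open_submanifold -> R) s :
  smooth f s <-> smooth (fun x => f (sub_retract s0 x)) (sub_incl s).
Proof.
have [c ac cs] := atlas_cover (sub_incl s).
have ac' : @atlas R n open_submanifold (sub_chart c s0) by exists c, s0.
rewrite (@smoothE R n open_submanifold _ s f (atlas_coordinates ac')) //.
by rewrite (smoothE _ (atlas_coordinates ac) cs).
Qed.

Lemma sub_smooth (f : M -> R) (s : open_submanifold) :
  smooth f (sub_incl s) -> smooth (fun t : open_submanifold => f (sub_incl t)) s.
Proof.
move=> fs; apply/(sub_smoothP s); apply: mfd_smooth_congr fs.
apply: near_imp (open_near oU (sub_inclP s)) => x Ux /=.
by rewrite sub_retractK.
Qed.

Lemma sub_near (s : open_submanifold) (P : M -> Prop) :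
  (\forall x \near sub_incl s, P x) <-> (\forall t \near s, P (sub_incl t)).
Proof.
split=> [|sP]; first by move=> /sub_incl_continuous.
have Us := sub_inclP s; have := sub_retract_cont (s0 := s) Us.
rewrite /prop_for /continuous_at sub_inclK => /(_ _ sP).
have := open_near oU Us; apply: filterS2 => x Ux /=.
by rewrite sub_retractK.
Qed.

Lemma smooth_map_incl (m : nat) (N : manifold R m) (p : M -> N) :
  smooth_map p -> smooth_map (fun s : open_submanifold => p (sub_incl s)).
Proof.
move=> sp s; have [cp sc] := sp (sub_incl s); split.
  by apply: continuous_comp; [exact: sub_incl_continuous|exact: cp].
move=> c ac cs j; exact: (@sub_smooth (fun y => cmap c (p y) 0 j)) (sc c ac cs j).
Qed.

Lemma smooth_map_corestrict (m : nat) (N : manifold R m) (g : N -> open_submanifold) :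
  smooth_map (fun x : N => sub_incl (g x)) -> smooth_map g.
Proof.
move=> sg x; have [cg sc] := sg x; split.
  move=> A /sub_nbhsP[B xB BA].
  have H : \forall y \near x, B (sub_incl (g y)) by exact: (cg _ xB).
  by apply: near_imp H => y; exact: BA.
by move=> _ [c [s0 [ac ->]]] cx j; exact: sc.
Qed.

End OpenSubmanifold.

Section EuclideanManifold.
Variables (R : realType) (n : nat).

Definition rV_chart : chart R n 'rV[R]_n := Chart setT id id.

Lemma rV_second_countable : @second_countable 'rV[R]_n.
Proof.
pose b (p : 'rV[rat]_n * nat) : set 'rV[R]_n := box (map_mx ratr p.1) (p.2.+1%:R^-1).
exists (range b).
  exact: (card_le_trans (card_image_le _ _) (countableP _)).
split=> [_ [p _ <-]|x A /nbhs_boxP[r r0 rA]]; first exact: open_box.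
(* A rational centre within 1 / (m + 1) of x then gives a box that contains x and lies in the box of
   radius r. *)
have [m m2] : exists m : nat, m.+1%:R^-1 < r / 2.
  have r20 : 0 < r / 2 by rewrite divr_gt0.
  exists (Num.truncn (r / 2)^-1); rewrite invf_plt ?posrE ?ltr0n //.
  exact: truncnS_gt.
have m0 : 0 < (m.+1%:R^-1 : R) by rewrite invr_gt0 ltr0n.
have /choice[q qP] (i : 'I_n) : exists q : rat, `|x 0 i - ratr q| < m.+1%:R^-1.
  have [|q] := @rat_in_itvoo R (x 0 i - m.+1%:R^-1) (x 0 i + m.+1%:R^-1).
    by rewrite ltrD2l; exact: gtrN.
  by rewrite in_itv /= => /andP[q1 q2]; exists q; rewrite distrC ltr_distl q1 q2.
exists (b (\row_i q i, m)).
  by split; [exists (\row_i q i, m)|move=> i; rewrite !mxE; exact: qP].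
move=> w bw; apply: rA => i; have := bw i; rewrite !mxE /= => wi.
have -> : w 0 i - x 0 i = (w 0 i - ratr (q i)) - (x 0 i - ratr (q i)) by ring.
apply: le_lt_trans (ler_normB _ _) _; apply: lt_trans (ltrD wi (qP i)) _.
by rewrite [r]splitr; exact: ltrD.
Qed.

Lemma rV_is_chart c : [set rV_chart] c -> is_chart c.
Proof.
move=> ->; split.
- exact: openT.
- by rewrite image_id; exact: openT.
- by [].
- by move=> x _; exact: cvg_id.
- by move=> x _; exact: cvg_id.
Qed.

Lemma rV_transition c d : [set rV_chart] c -> [set rV_chart] d -> smooth_transition c d.
Proof. by move=> -> -> x _ _ j; exact: smooth_rV_coord. Qed.

Lemma rV_cover (x : 'rV[R]_n) : exists2 c, [set rV_chart] c & cdom c x.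
Proof. by exists rV_chart. Qed.

Definition rV_manifold : manifold R n :=
  Manifold (@norm_hausdorff R 'rV[R]_n) rV_second_countable rV_is_chart rV_transition
    rV_cover.

Lemma rV_smoothP (f : rV_manifold -> R) u : smooth f u <-> smooth_rV f u.
Proof.
have ac : @atlas R n rV_manifold rV_chart by [].
by have /smoothE := atlas_coordinates ac; apply.
Qed.

End EuclideanManifold.

Section ComplexSmooth.
Variables (R : realType).

Lemma ReD (x y : R[i]) : complex.Re (x + y) = complex.Re x + complex.Re y.
Proof. by case: x; case: y. Qed.

Lemma ImD (x y : R[i]) : complex.Im (x + y) = complex.Im x + complex.Im y.
Proof. by case: x; case: y. Qed.

Lemma ReM (x y : R[i]) : complex.Re (x * y) =
  complex.Re x * complex.Re y - complex.Im x * complex.Im y.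
Proof. by case: x; case: y. Qed.

Lemma ImM (x y : R[i]) : complex.Im (x * y) =
  complex.Re x * complex.Im y + complex.Im x * complex.Re y.
Proof. by case: x; case: y. Qed.

Lemma complex_eqP (x y : R[i]) :
  complex.Re x = complex.Re y -> complex.Im x = complex.Im y -> x = y.
Proof. by case: x => a b; case: y => a' b' /= -> ->. Qed.

Definition normsq (z : R[i]) : R := complex.Re z ^+ 2 + complex.Im z ^+ 2.

Lemma normsqM (x y : R[i]) : normsq (x * y) = normsq x * normsq y.
Proof. by rewrite /normsq ReM ImM; ring. Qed.

Lemma normsq_eq0 (z : R[i]) : (normsq z == 0) = (z == 0).
Proof. by rewrite /normsq paddr_eq0 ?sqr_ge0 // !sqrf_eq0 eq_complex. Qed.

Variables (n : nat) (M : manifold R n).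
Implicit Types (f g : M -> R[i]) (x : M).

Lemma csmooth_near f x : csmooth f x -> \forall y \near x, csmooth f y.
Proof. by move=> [fr fi]; apply: near_and; exact: mfd_smooth_near. Qed.

Lemma csmooth_congr f g x : (\forall y \near x, f y = g y) -> csmooth f x -> csmooth g x.
Proof.
by move=> fg [fr fi]; split; [apply: mfd_smooth_congr fr|apply: mfd_smooth_congr fi];
  apply: near_imp fg => y ->.
Qed.

Lemma csmooth_cst a x : csmooth (fun _ : M => a) x.
Proof. by split; exact: mfd_smooth_cst. Qed.

Lemma csmoothD f g x : csmooth f x -> csmooth g x -> csmooth (fun y => f y + g y) x.
Proof.
move=> [fr fi] [gr gi]; split.
  by apply: mfd_smooth_congr (mfd_smoothD fr gr); apply: near_true => y; rewrite ReD.
by apply: mfd_smooth_congr (mfd_smoothD fi gi); apply: near_true => y; rewrite ImD.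
Qed.

Lemma csmoothM f g x : csmooth f x -> csmooth g x -> csmooth (fun y => f y * g y) x.
Proof.
move=> [fr fi] [gr gi]; split.
  apply: mfd_smooth_congr (mfd_smoothB (mfd_smoothM fr gr) (mfd_smoothM fi gi)).
  by apply: near_true => y; rewrite ReM.
apply: mfd_smooth_congr (mfd_smoothD (mfd_smoothM fr gi) (mfd_smoothM fi gr)).
by apply: near_true => y; rewrite ImM.
Qed.

Lemma csmooth_sum (m : nat) (g : 'I_m -> M -> R[i]) x :
  (forall j, csmooth (g j) x) -> csmooth (fun y => \sum_j g j y) x.
Proof.
elim: m g => [|m IH] g gx.
  apply: csmooth_congr (csmooth_cst 0 x).
  by apply: near_true => y; rewrite big_ord0.
apply: csmooth_congr (csmoothD (gx ord0) (IH (fun j => g (lift ord0 j)) (fun j => gx _))).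
by apply: near_true => y; rewrite big_ord_recl.
Qed.

Lemma csmooth_cont f x : csmooth f x -> forall y : R[i], f x != y -> \forall z \near x, f z != y.
Proof.
move=> [fr fi] y; rewrite eq_complex negb_and => /orP[H|H].
  have : \forall z \near x, complex.Re (f z) - complex.Re y != 0.
    apply: neq0_near; last by rewrite subr_eq0.
    by apply: mfd_smooth_cont; apply: mfd_smoothB => //; exact: mfd_smooth_cst.
  by apply: near_imp => z; rewrite subr_eq0 eq_complex => /negPf ->.
have : \forall z \near x, complex.Im (f z) - complex.Im y != 0.
  apply: neq0_near; last by rewrite subr_eq0.
  by apply: mfd_smooth_cont; apply: mfd_smoothB => //; exact: mfd_smooth_cst.
by apply: near_imp => z; rewrite subr_eq0 eq_complex => /negPf ->; rewrite andbF.
Qed.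

Lemma smooth_normsq f x : csmooth f x -> smooth (fun y => normsq (f y)) x.
Proof. by move=> [fr fi]; apply: mfd_smoothD; exact: mfd_smoothX. Qed.

Lemma csmooth_zcoord (c : chart R n M) i x : coordinates c -> cdom c x ->
  csmooth (fun y => zcoord (cmap c y) i) x.
Proof. by move=> cc cx; split; exact: smooth_cmap_coord. Qed.

End ComplexSmooth.

Lemma csmooth_comp (R : realType) (m n : nat) (M : manifold R m) (N : manifold R n)
    (p : M -> N) (f : N -> R[i]) x :
  smooth_map p -> csmooth f (p x) -> csmooth (fun y => f (p y)) x.
Proof. by move=> sp [fr fi]; split; [have := smooth_map_comp sp fr|have := smooth_map_comp sp fi]. Qed.

Section SmoothMaps.
Variables (R : realType).

Lemma smooth_map_id (n : nat) (M : manifold R n) : smooth_map (fun x : M => x).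
Proof.
move=> x; split; first exact: cvg_id.
by move=> c ac cx j; apply: smooth_cmap => //; exact: atlas_coordinates.
Qed.

Lemma smooth_map_compose (k m n : nat) (K : manifold R k) (M : manifold R m) (N : manifold R n)
    (f : K -> M) (g : M -> N) :
  smooth_map f -> smooth_map g -> smooth_map (fun x => g (f x)).
Proof.
move=> sf sg x; split.
  by apply: continuous_comp; [exact: (sf x).1|exact: (sg (f x)).1].
move=> c ac cx j; exact: (smooth_map_comp sf ((sg (f x)).2 c ac cx j)).
Qed.

Lemma rV_smooth_map (m n : nat) (M : manifold R m) (g : M -> rV_manifold R n) :
  (forall x j, smooth (fun y => g y 0 j) x) -> smooth_map g.
Proof.
move=> sg x; split.
  by apply: row_continuous => i; apply: mfd_smooth_cont; exact: sg.
by move=> c -> _ j; exact: sg.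
Qed.

End SmoothMaps.

(** * Pullbacks of ideals and complex divisors *)

Section Divisors.
Variables (R : realType).

Lemma pullback_ideal_sheaf (m n : nat) (S : manifold R m) (T : manifold R n) (p : S -> T)
    (I : T -> set (T -> R[i])) :
  smooth_map p -> ideal_sheaf (@csmooth R n T) I ->
  ideal_sheaf (@csmooth R m S) (pullback (@csmooth R m S) p I).
Proof.
move=> sp idI x; split.
- move=> f [r [a [g [ag E]]]].
  have cg i y : I (p y) (g i) -> csmooth (fun z => g i (p z)) y.
    by have [H _ _ _ _] := idI (p y); move=> /H[sg _]; exact: csmooth_comp.
  split.
    apply: (@csmooth_congr _ _ _ (fun y => \sum_i a i y * g i (p y))).
      by apply: near_imp E => y ->.
    by apply: csmooth_sum => i; have [sa gI] := ag i; apply: csmoothM => //; exact: cg.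
  have H : \forall y \near x, forall i, csmooth (a i) y /\ I (p y) (g i).
    apply: near_all => i; have [sa gI] := ag i; apply: near_and; first exact: csmooth_near.
    have [H _ _ _ _] := idI (p x); have [_ gN] := H _ gI.
    exact: ((sp x).1 _ gN).
  by have := near_and H (near_near E); apply: near_imp => y [Hy Ey]; exists r, a, g.
- move=> f g [r [a [h [ah E]]]] fg; exists r, a, h; split=> //.
  by have := near_and E fg; apply: near_imp => y [E1 <-].
- exists 0%N, (fun i _ => 0), (fun i _ => 0); split; first by case.
  by apply: near_true => y; rewrite big_ord0.
- move=> f g [r1 [a1 [h1 [ah1 E1]]]] [r2 [a2 [h2 [ah2 E2]]]].
  exists (r1 + r2)%N.
  exists (fun i => match fintype.split i with inl j => a1 j | inr j => a2 j end).
  exists (fun i => match fintype.split i with inl j => h1 j | inr j => h2 j end).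
  split; first by move=> i; case: fintype.split => j; [exact: ah1|exact: ah2].
  have := near_and E1 E2; apply: near_imp => y [-> ->]; rewrite big_split_ord /=.
  congr (_ + _); apply: eq_bigr => i _.
    by have -> : fintype.split (lshift r2 i) = inl i by exact: (unsplitK (inl i)).
  by have -> : fintype.split (rshift r1 i) = inr i by exact: (unsplitK (inr i)).
- move=> b f sb [r [a [h [ah E]]]]; exists r, (fun i y => b y * a i y), h; split.
    by move=> i; have [sa hI] := ah i; split=> //; exact: csmoothM.
  by apply: near_imp E => y ->; rewrite mulr_sumr; apply: eq_bigr => i _; rewrite mulrA.
Qed.

(** Nonvanishing of e is an open condition, so a non-zero of e in U is never in the closure of the
    zeros; density puts one in every open set that meets U. *)
Lemma nowhere_dense_zeros (n : nat) (M : manifold R n) (e : M -> R[i]) (U : set M) : open U ->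
  (forall x, U x -> csmooth e x) ->
  (forall (x : M) (A : set M), U x -> nbhs x A -> exists y, [/\ A y, U y & e y != 0]) ->
  interior (closure (U `&` [set y | e y = 0])) = set0.
Proof.
move=> oU se de; apply/seteqP; split=> // x xC.
have [x' [[Ux' _] x'C]] := nbhs_singleton xC _ (nbhs_interior xC).
have [y [yC Uy ey]] := de x' _ Ux' x'C.
have [z [[_ /= ez] /eqP]] := yC _ (csmooth_cont (se y Uy) ey).
by [].
Qed.

Lemma nonzeros_dense (n : nat) (M : manifold R n) (e : M -> R[i]) (U : set M) : open U ->
  interior (closure (U `&` [set y | e y = 0])) = set0 ->
  forall (x : M) (A : set M), U x -> nbhs x A -> exists y, [/\ A y, U y & e y != 0].
Proof.
move=> oU e0 x A Ux xA; apply: contrapT => nE.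
suff : interior (closure (U `&` [set y | e y = 0])) x by rewrite e0.
have := near_and (open_near oU Ux) xA; apply: near_imp => y [Uy Ay].
apply: subset_closure; split=> //=; apply/eqP/negPn/negP => ey; apply: nE.
by exists y.
Qed.

Variables (n : nat) (M : manifold R n).

(** Makes the universal property applicable to the restriction of the blow-down to an open set; the
    same local generators, restricted, do. *)
Lemma divisor_restrict (m : nat) (T : manifold R m) (p : M -> T) (I : T -> set (T -> R[i]))
    (W : set M) (oW : open W) : smooth_map p -> ideal_sheaf (@csmooth R m T) I ->
  complex_divisor (pullback (@csmooth R n M) p I) ->
  complex_divisor (pullback (@csmooth R n (open_submanifold oW))
    (fun s => p (sub_incl s)) I).
Proof.
move=> sp idI [_ dp];
have sincl : @smooth_map R n n (open_submanifold oW) M (@sub_incl _ _ M W).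
  exact: (smooth_map_incl (@smooth_map_id _ _ M)).
split.
  by apply: pullback_ideal_sheaf => //; exact: (smooth_map_incl sp).
move=> s; have [U [e [oU Us se e0 gE]]] := dp (sub_incl s).
exists (@sub_incl _ _ M W @^-1` U), (fun t => e (sub_incl t)); split.
- by have := open_comp (f := @sub_incl _ _ M W) (fun t _ => @sub_incl_continuous _ _ M W t) oU; exact.
- exact: Us.
- by move=> t Ut; apply: (csmooth_comp sincl); exact: se.
- have oU' : open (@sub_incl _ _ M W @^-1` U).
    have := open_comp (f := @sub_incl _ _ M W) (fun t _ => @sub_incl_continuous _ _ M W t) oU.
    exact.
  apply: (@nowhere_dense_zeros n (open_submanifold oW) (fun t => e (sub_incl t))) => //.
    by move=> t Ut; apply: (csmooth_comp sincl); exact: se.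
  move=> t A Ut /(@sub_nbhsP _ _ M W)[B tB BA].
  have := near_and tB (open_near oW (sub_inclP t)) => tBW.
  have [y [[By Wy] Uy ey]] := nonzeros_dense oU e0 Ut tBW.
  exists (sub_retract t y); rewrite /= !sub_retractK //; split=> //.
  by apply: BA; rewrite sub_retractK.
- move=> t Ut f; split.
    move=> [r [a [g [ag E]]]].
    have /choice[b bP] (i : 'I_r) : exists b : M -> R[i], csmooth b (sub_incl t) /\
        \forall y \near sub_incl t, g i (p y) = b y * e y.
      have gI : pullback (@csmooth R n M) p I (sub_incl t) (fun y => g i (p y)).
        exists 1%N, (fun _ _ => 1), (fun _ => g i); split.
          by move=> _; split; [exact: csmooth_cst|have [] := ag i].
        by apply: near_true => y; rewrite big_ord1 mul1r.
      have [b [sb E']] := (gE (sub_incl t) Ut _).1 gI.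
      exists (b ord0); split=> //.
      by apply: near_imp E' => y; rewrite big_ord1.
    exists (fun _ u => \sum_i a i u * b i (sub_incl u)); split.
      move=> _; apply: csmooth_sum => i; apply: csmoothM; first by have [] := ag i.
      by apply: (csmooth_comp sincl); have [] := bP i.
    have H : \forall u \near t, forall i, g i (p (sub_incl u)) = b i (sub_incl u) * e (sub_incl u).
      apply: near_all => i; have [_ bE] := bP i.
      exact: ((@sub_near _ _ M W oW t _).1 bE).
    have := near_and E H; apply: near_imp => u [-> Hu]; rewrite big_ord1 mulr_suml.
    by apply: eq_bigr => i _; rewrite Hu mulrA.
  move=> [a [sa E]].
  have [r [b [g [bg E']]]] : pullback (@csmooth R n M) p I (sub_incl t) e.
    apply/(gE _ Ut); exists (fun _ _ => 1); split; first by move=> _; exact: csmooth_cst.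
    by apply: near_true => y; rewrite big_ord1 mul1r.
  exists r, (fun i u => a ord0 u * b i (sub_incl u)), g; split.
    move=> i; have [sb gI] := bg i; split=> //; apply: csmoothM => //.
    exact: (csmooth_comp sincl).
  have H := (@sub_near _ _ M W oW t _).1 E'.
  have := near_and E H; apply: near_imp => u [-> Hu]; rewrite big_ord1 Hu mulr_sumr.
  by apply: eq_bigr => i _; rewrite mulrA.
Qed.

End Divisors.

(** * Coordinates on the blow-up *)

Section BlowupChart.
Variables (R : realType) (n : nat) (M Mt : manifold R n).
Variables (IY : M -> set (M -> R[i])) (p : Mt -> M).
Hypothesis idY : ideal_sheaf (@csmooth R n M) IY.
Hypothesis bp : blowup IY p.
Variables (c : chart R n M) (beta : 'rV[R]_n -> 'rV[R]_n) (e : rV_manifold R n -> R[i]).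
Hypothesis cc : coordinates c.
Hypothesis sbeta : forall u j, smooth_rV (fun v => beta v 0 j) u.
Hypothesis se : forall u, csmooth e u.

(** The part of the local model that is blown down into the image of the chart c, which need not be
    all of R^n. *)
Let X0 : set (rV_manifold R n) := [set u | (cmap c @` cdom c) (beta u)].

Hypothesis e_dense : forall (u : 'rV[R]_n) r, 0 < r -> exists2 v, box u r v & e v != 0.
Hypothesis beta_inj : forall u v, beta u = beta v -> e u != 0 -> u = v.
Hypothesis e_gen : forall u f, X0 u -> IY (cinv c (beta u)) f ->
  exists2 a : rV_manifold R n -> R[i], csmooth a u &
    \forall v \near u, f (cinv c (beta v)) = a v * e v.
Hypothesis e_in : forall u, X0 u -> exists2 f, IY (cinv c (beta u)) f &
    \forall v \near u, e v = f (cinv c (beta v)).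

Let beta_cont (u : 'rV[R]_n) : {for u, continuous beta}.
Proof. by apply: row_continuous => j; exact: smooth_cont. Qed.

Let oX : open X0.
Proof.
have [[_ oi _ _ _] _] := cc; rewrite openE => u Xu.
exact: (beta_cont (open_near oi Xu)).
Qed.

Let SX : manifold R n := open_submanifold oX.
Let fX (s : SX) : M := cinv c (beta (sub_incl s)).

Let fX_dom (s : SX) : cdom c (fX s) /\ cmap c (fX s) = beta (sub_incl s).
Proof.
have [y cy E] := sub_inclP s.
by rewrite /fX -E (cmapK cc cy).
Qed.

Let smooth_fX : smooth_map fX.
Proof.
move=> s; have [cs Es] := fX_dom s; have [[_ _ _ _ ci] cP] := cc; split.
  apply: (@continuous_comp SX 'rV[R]_n M (fun s => beta (sub_incl s)) (cinv c)).
    apply: (@continuous_comp SX 'rV[R]_n 'rV[R]_n (@sub_incl _ _ _ X0) beta).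
      exact: sub_incl_continuous.
    exact: beta_cont.
  by rewrite -Es; exact: ci.
move=> d ad ds j.
apply: (@sub_smooth _ _ _ _ oX (fun u => cmap d (cinv c (beta u)) 0 j)).
apply/rV_smoothP; apply: (@smooth_compr _ _ _ (fun u => cmap d (cinv c u) 0 j) beta) => //.
by rewrite -Es; have [cd _] := cP d ad; exact: cd.
Qed.

(** [e_gen] and [e_in] say that e generates the pulled back ideal on the model, and [e_dense] that
    its zeros are nowhere dense; so the universal property lifts [fX] to [Mt]. *)
Let divisor_fX : complex_divisor (pullback (@csmooth R n SX) fX IY).
Proof.
split; first exact: pullback_ideal_sheaf.
move=> s; exists setT, (fun t : SX => e (sub_incl t)).
have sincl : @smooth_map R n n SX (rV_manifold R n) (@sub_incl _ _ _ X0).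
  exact: (smooth_map_incl (@smooth_map_id _ _ (rV_manifold R n))).
have sE (t : SX) : csmooth (fun t : SX => e (sub_incl t)) t by exact: (csmooth_comp sincl).
split=> //; first exact: openT.
  apply: nowhere_dense_zeros => //; first exact: openT.
  move=> t A _ /(@sub_nbhsP _ _ _ X0)[B tB BA].
  have tBX : \forall u \near sub_incl t, B u /\ X0 u.
    by apply: near_and => //; apply: open_near => //; exact: sub_inclP.
  have /nbhs_boxP[r r0 rP] := tBX.
  have [v bv ev] := e_dense (sub_incl t) r0; have [Bv Xv] := rP v bv.
  exists (sub_retract t v); rewrite sub_retractK //; split=> //.
  by apply: BA; rewrite sub_retractK.
move=> t _ f; split.
  move=> [r [a [g [ag E]]]].
  have /choice[b bP] (i : 'I_r) : exists b : rV_manifold R n -> R[i], csmooth b (sub_incl t) /\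
      \forall v \near sub_incl t, g i (cinv c (beta v)) = b v * e v.
    by have [b sb E'] := e_gen (sub_inclP t) (ag i).2; exists b.
  exists (fun _ u => \sum_i a i u * b i (sub_incl u)); split.
    move=> _; apply: csmooth_sum => i; apply: csmoothM; first by have [] := ag i.
    by apply: (csmooth_comp sincl); have [] := bP i.
  have H : \forall u \near t, forall i, g i (fX u) = b i (sub_incl u) * e (sub_incl u).
    apply: near_all => i; have [_ bE] := bP i.
    exact: ((@sub_near _ _ _ X0 oX t _).1 bE).
  have := near_and E H; apply: near_imp => u [-> Hu]; rewrite big_ord1 mulr_suml.
  by apply: eq_bigr => i _; rewrite Hu mulrA.
move=> [a [sa E]]; have [g gI gE] := e_in (sub_inclP t).
exists 1%N, a, (fun _ => g); split; first by move=> i; split.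
have := near_and E ((@sub_near _ _ _ X0 oX t _).1 gE).
by apply: near_imp => u [-> Eu]; rewrite !big_ord1 Eu.
Qed.

Variables (V0 : set Mt) (h : Mt -> 'rV[R]_n) (x0 : Mt).
Hypothesis oV : open V0.
Hypothesis Vx0 : V0 x0.
Hypothesis V_dom : forall y, V0 y -> cdom c (p y) /\ beta (h y) = cmap c (p y).
Hypothesis sh : forall y, V0 y -> forall j, smooth (fun z => h z 0 j) y.

Let SV : manifold R n := open_submanifold oV.

Let X0h y : V0 y -> X0 (h y).
Proof. by move=> /V_dom[cy E]; rewrite /X0 /= E; exists (p y). Qed.

(* The lift of [fX] to [Mt] given by the universal property of the blow-up is the
   inverse of [h], by uniqueness of the lifts of the restriction of [p] to [V0]. *)
Lemma blowup_chart : exists g, coordinates (Chart V0 h g).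
Proof.
have [sp dp univ] := bp.
have [g0 [[sg0 pg0] _]] := univ n SX fX smooth_fX divisor_fX.
pose h' (s : SV) : SX := SigSub (mem_set (X0h (sub_inclP s))).
have h'E s : sub_incl (h' s) = h (sub_incl s) by [].
have sh' : smooth_map h'.
  apply: smooth_map_corestrict; apply: rV_smooth_map => s j.
  apply: (@sub_smooth _ _ _ _ oV (fun y => h y 0 j)); apply: sh; exact: sub_inclP.
have [k [_ kuniq]] := univ n SV (fun s => p (sub_incl s)) (smooth_map_incl sp)
  (divisor_restrict oV sp idY dp).
have gh y (Vy : V0 y) : g0 (h' (SigSub (mem_set Vy))) = y.
  have k1 : k = (fun s : SV => sub_incl s).
    apply: kuniq; split=> //; exact: (smooth_map_incl (@smooth_map_id _ _ Mt)).
  have k2 : k = (fun s : SV => g0 (h' s)).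
    apply: kuniq; split; first exact: smooth_map_compose.
    move=> s; rewrite pg0 /fX h'E; have [cs ->] := V_dom (sub_inclP s).
    exact: cmapK.
  by have /(congr1 (@^~ (SigSub (mem_set Vy)))) := etrans (esym k2) k1.
pose s0 : SX := h' (SigSub (mem_set Vx0)).
pose g (u : 'rV[R]_n) : Mt := g0 (sub_retract s0 u).
have retr y (Vy : V0 y) : sub_retract s0 (h y) = h' (SigSub (mem_set Vy)).
  by apply: sub_incl_inj; rewrite sub_retractK //; exact: X0h.
have gK y : V0 y -> g (h y) = y by move=> Vy; rewrite /g (retr y Vy) gh.
have cg u : X0 u -> {for u, continuous g}.
  move=> Xu; apply: continuous_comp; first exact: sub_retract_cont.
  by have [] := sg0 (sub_retract s0 u).
have pg u : X0 u -> p (g u) = cinv c (beta u).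
  by move=> Xu; rewrite /g pg0 /fX sub_retractK.
(* For the other composition: h (g v) and v have the same image under beta, so they agree where e is
   nonzero, and at u by density and continuity. *)
have hg u : X0 u -> V0 (g u) -> h (g u) = u.
  move=> Xu Vu; apply/rowP => j; apply/eqP; rewrite -subr_eq0; apply/eqP.
  have chg : {for u, continuous (fun v : 'rV[R]_n => h (g v) 0 j)}.
    apply: (@continuous_comp _ _ _ g (fun y => h y 0 j)); first exact: cg.
    by apply: mfd_smooth_cont; exact: sh.
  apply: (@cont_eq0 _ _ (fun v => h (g v) 0 j - v 0 j) u).
    by apply: continuousB => //; exact: coord_cont.
  move=> r r0.
  have /nbhs_boxP[r' r'0 rP] : \forall v \near u, box u r v /\ X0 v /\ V0 (g v).
    apply: near_and; first exact: nbhsx_box.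
    apply: near_and; first exact: (open_near oX Xu).
    exact: (cg u Xu _ (open_near oV Vu)).
  have [v bv ev] := e_dense u r'0; have [brv [Xv Vv]] := rP v bv.
  exists v => //; suff <- : v = h (g v) by rewrite subrr.
  apply: beta_inj => //; have [_ ->] := V_dom Vv; rewrite pg //.
  by have [y cy <-] := Xv; rewrite (cmapK cc cy).
exists g; apply: build_coordinates => //.
- rewrite openE => _ [y Vy <-] /=.
  have := near_and (open_near oX (X0h Vy)) (cg _ (X0h Vy) _ (open_near oV _)).
  rewrite gK // => /(_ Vy); apply: near_imp => u [Xu Vu].
  by exists (g u) => //; exact: hg.
- move=> y Vy; split; first exact/cg/X0h.
  move=> d ad dy j; apply/(@rV_smoothP _ _ (fun u => cmap d (g u) 0 j)).
  have [_ sgc] := sg0 (h' (SigSub (mem_set Vy))).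
  rewrite gh in sgc; have /(sub_smoothP s0) := sgc d ad dy j.
  by rewrite h'E.
Qed.

End BlowupChart.

Section ComplexInverse.
Variables (R : realType) (n : nat) (M : manifold R n).

Lemma ReV (z : R[i]) : complex.Re z^-1 = complex.Re z / normsq z.
Proof. by case: z. Qed.

Lemma ImV (z : R[i]) : complex.Im z^-1 = - complex.Im z / normsq z.
Proof. by case: z => a b; rewrite /normsq /= mulNr. Qed.

Lemma csmoothV (f : M -> R[i]) x : csmooth f x -> f x != 0 -> csmooth (fun y => (f y)^-1) x.
Proof.
move=> sf f0; have [fr fi] := sf; have sn := smooth_normsq sf.
have n0 : normsq (f x) != 0 by rewrite normsq_eq0.
split.
  apply: mfd_smooth_congr (mfd_smoothM fr (mfd_smoothV sn n0)).
  by apply: near_true => y; rewrite ReV.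
apply: mfd_smooth_congr (mfd_smoothM (mfd_smoothN fi) (mfd_smoothV sn n0)).
by apply: near_true => y; rewrite ImV.
Qed.

End ComplexInverse.

(** * The standard affine charts of the complex blow-up *)

Section StandardBlowup.
Variables (R : realType) (n l j : nat).
Hypothesis ln : (l.*2 <= n)%N.
Hypothesis lj : l = 0%N \/ (j < l)%N.
Implicit Types (u v w : 'rV[R]_n).

(** Real coordinates of the planes in which z_i is divided by z_j to obtain w_i. *)
Definition divided (l j q : nat) : bool := (q./2 < l)%N && (q./2 != j).

(* The affine chart [z_j = w_j], [z_i = w_i w_j] ([i < l], [i <> j]) of the complex
   blow-up; it is the identity when [l = 0]. *)
Definition blowdown (l j : nat) (w : 'rV[R]_n) : 'rV[R]_n :=
  \row_(q < n) if divided l j q then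
    if odd q then coord w q.-1 * coord w j.*2.+1 + coord w q * coord w j.*2
    else coord w q * coord w j.*2 - coord w q.+1 * coord w j.*2.+1
  else w 0 q.

(** Generator of the pulled back ideal; its zero set is the exceptional locus. For l = 0 the ideal
    is the unit ideal, generated by 1. *)
Definition exceptional (l j : nat) (w : 'rV[R]_n) : R[i] :=
  if l == 0%N then 1 else zcoord w j.

Lemma coord_blowdown w q : (q < n)%N -> coord (blowdown l j w) q =
  if divided l j q then
    if odd q then coord w q.-1 * coord w j.*2.+1 + coord w q * coord w j.*2
    else coord w q * coord w j.*2 - coord w q.+1 * coord w j.*2.+1
  else coord w q.
Proof.
move=> qn; rewrite -[q]/(nat_of_ord (Ordinal qn)) coordE mxE.
by case: ifP => // _; rewrite coordE.
Qed.

Lemma coord_undivided w q : ~~ divided l j q -> coord (blowdown l j w) q = coord w q.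
Proof.
have [qn|qn] := ltnP q n; last by rewrite !coord_ge.
by rewrite coord_blowdown // => /negPf ->.
Qed.

Lemma zcoord_undivided w i : ~~ ((i < l)%N && (i != j)) ->
  zcoord (blowdown l j w) i = zcoord w i.
Proof.
move=> H; rewrite /zcoord !coord_undivided //.
  by rewrite /divided /= uphalf_double.
by rewrite /divided doubleK.
Qed.

Lemma zcoord_divided w i : (i < l)%N -> i != j ->
  zcoord (blowdown l j w) i = zcoord w i * zcoord w j.
Proof.
move=> il ij; have i1 : (i.*2.+1 < n)%N by apply: leq_trans ln; rewrite -doubleS leq_double.
rewrite /zcoord coord_blowdown ?(ltnW i1) // coord_blowdown //.
rewrite /divided /= uphalf_double doubleK il ij odd_double /=.
by apply: complex_eqP; rewrite ?ReM ?ImM /= addrC.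
Qed.

Lemma zcoord_j w : zcoord (blowdown l j w) j = zcoord w j.
Proof. by apply: zcoord_undivided; rewrite eqxx andbF. Qed.

Lemma zcoord_blowdown w i : (i < l)%N ->
  zcoord (blowdown l j w) i = (if i == j then 1 else zcoord w i) * zcoord w j.
Proof.
move=> il; case: eqVneq => [->|ij]; last exact: zcoord_divided.
by rewrite zcoord_j mul1r.
Qed.

Lemma smooth_blowdown u q : smooth_rV (fun v => blowdown l j v 0 q) u.
Proof.
have -> : (fun v => blowdown l j v 0 q) = (fun v => if divided l j q then
    if odd q then coord v q.-1 * coord v j.*2.+1 + coord v q * coord v j.*2
    else coord v q * coord v j.*2 - coord v q.+1 * coord v j.*2.+1
  else v 0 q) by apply/funext => v; rewrite mxE.
case: (divided l j q); last exact: smooth_rV_coord.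
case: (odd q).
  by apply: smooth_rVD; apply: smooth_rVM; exact: smooth_coord.
by apply: smooth_rVB; apply: smooth_rVM; exact: smooth_coord.
Qed.

Lemma csmooth_zcoord_rV i u : @csmooth R n (rV_manifold R n) (fun w => zcoord w i) u.
Proof. by split; apply/rV_smoothP; exact: smooth_coord. Qed.

Lemma csmooth_exceptional u : @csmooth R n (rV_manifold R n) (exceptional l j) u.
Proof.
rewrite /exceptional; case: (l == 0%N); first exact: csmooth_cst.
exact: csmooth_zcoord_rV.
Qed.

Lemma exceptional_dense u (r : R) : 0 < r -> exists2 v, box u r v & exceptional l j v != 0.
Proof.
move=> r0; rewrite /exceptional; case: lj => [->|jl].
  by exists u; [exact: boxxx|rewrite eqxx oner_neq0].
rewrite gtn_eqF ?(leq_ltn_trans _ jl) //.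
have j0 : (j.*2 < n)%N by apply: leq_trans ln; rewrite ltn_double.
have [z0|z0] := eqVneq (zcoord u j) 0; last by exists u; [exact: boxxx|].
exists (u + (r / 2) *: 'e_(Ordinal j0)).
  apply: (@box_add _ _ _ _ _ (r / 2)) => [q|]; last by lra.
  by apply: norm_unit_le; rewrite gtr0_norm ?divr_gt0.
rewrite eq_complex negb_and; apply/orP; left => /=.
move/eqP: z0; rewrite eq_complex => /andP[/= /eqP u0 _].
rewrite -[j.*2]/(nat_of_ord (Ordinal j0)) coordE !mxE !eqxx /= mulr1.
by rewrite -[u 0 _]coordE /= u0 add0r gt_eqF // divr_gt0.
Qed.

(** Odd n is covered: the last coordinate is then the real part of a z_i whose imaginary part is the
    default 0. *)
Lemma zcoord_eqP u v : (forall i, zcoord u i = zcoord v i) -> u = v.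
Proof.
move=> uv; apply/rowP => q; have := uv (q./2); rewrite /zcoord => -[].
have E := odd_double_half q; rewrite -!coordE.
by case: (odd q) E; rewrite ?add1n ?add0n => ->.
Qed.

Lemma blowdown_inj u v : blowdown l j u = blowdown l j v -> exceptional l j u != 0 -> u = v.
Proof.
move=> uv eu; apply: zcoord_eqP => i.
have [/andP[il ij]|H] := boolP ((i < l)%N && (i != j)); last first.
  by rewrite -(zcoord_undivided u H) uv zcoord_undivided.
have l0 : (l == 0%N) = false by rewrite gtn_eqF // (leq_ltn_trans _ il).
move: eu; rewrite /exceptional l0 => eu.
have E : zcoord u j = zcoord v j by rewrite -zcoord_j uv zcoord_j.
by apply: (mulIf eu); rewrite -zcoord_divided // uv zcoord_divided // E.
Qed.

Lemma rsq_normsq u i : rsq u i = normsq (zcoord u i).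
Proof. by []. Qed.

(** Each of the l - 1 planes i < l, i <> j contributes one factor |w_j|^2; for l = 0 the truncated
    predecessor gives the empty power. *)
Lemma prod_blowdown k u : (l <= k)%N -> \prod_(i < k) rsq (blowdown l j u) i =
  normsq (exceptional l j u) ^+ l.-1 * \prod_(i < k) rsq u i.
Proof.
move=> lk; rewrite /exceptional; case: lj => [l0|jl].
  have -> : l.-1 = 0%N by rewrite l0.
  rewrite expr0 mul1r; apply: eq_bigr => i _.
  by rewrite !rsq_normsq zcoord_undivided // l0.
have l0 : (l == 0%N) = false by rewrite gtn_eqF // (leq_ltn_trans _ jl).
rewrite l0; have jk := leq_trans jl lk.
rewrite (bigD1 (Ordinal jk)) //= [in RHS](bigD1 (Ordinal jk)) //=.
rewrite !rsq_normsq zcoord_j mulrCA; congr (_ * _).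
have -> : \prod_(i < k | i != Ordinal jk) rsq (blowdown l j u) i =
    \prod_(i < k | i != Ordinal jk) ((if (i < l)%N then normsq (zcoord u j) else 1) * rsq u i).
  apply: eq_bigr => i; rewrite -val_eqE /= => ij; rewrite !rsq_normsq; case: ifP => il.
    by rewrite zcoord_divided // normsqM mulrC.
  by rewrite zcoord_undivided ?il // mul1r.
rewrite big_split /=; congr (_ * _); rewrite -big_mkcondr /=.
rewrite prodr_const; congr (_ ^+ _).
rewrite (eq_card (B := [pred i : 'I_k | (i < l)%N && (i != Ordinal jk)])); last first.
  by move=> i; rewrite !inE andbC.
have H : #|[pred i : 'I_k | (i < l)%N]| = l.
  rewrite -sum1_card (eq_bigl (fun i : 'I_k => (i < l)%N)) //.
  by rewrite (big_ord_narrow lk) sum1_card card_ord.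
rewrite -[l in RHS]H (cardD1 (Ordinal jk) [pred i : 'I_k | (i < l)%N]) inE /= jl /=.
by apply: eq_card => i; rewrite !inE andbC.
Qed.

End StandardBlowup.

Section BlowupCoordinates.
Variables (R : realType) (n l : nat) (M Mt : manifold R n) (I : M -> set (M -> R)).
Variables (Y : set M) (IY : M -> set (M -> R[i])) (p : Mt -> M).

(* [l' = 0] encodes a chart in which [IY] is the unit ideal. *)
Definition adapted_chart (c : chart R n M) (k l' : nat) : Prop :=
  [/\ elliptic_coordinates I c k, (l' <= k)%N & forall x, cdom c x -> forall f,
    IY x f <-> if l' == 0%N then csmooth f x else
      exists a : 'I_l' -> M -> R[i], (forall i, csmooth (a i) x) /\
        \forall y \near x, f y = \sum_i a i y * zcoord (cmap c y) i].

(** Charts in which p is the standard blow-down. The value l' = 0 is for points away from Y, where p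
    becomes the identity in the charts; keeping l' apart from l lets the same arguments serve both
    cases. *)
Definition blowup_coordinates (d : chart R n Mt) (c : chart R n M) (k l' j : nat) : Prop :=
  [/\ adapted_chart c k l', l' = 0%N \/ l' = l /\ (j < l)%N, coordinates d &
    forall y, cdom d y -> cdom c (p y) /\ cmap c (p y) = blowdown l' j (cmap d y)].

Lemma smooth_coord_row (m : nat) (S : manifold R m) (h : S -> 'rV[R]_n) s q :
  (forall j, smooth (fun t => h t 0 j) s) -> smooth (fun t => coord (h t) q) s.
Proof.
move=> sh; rewrite /coord; case: insub => [i|] /=; first exact: sh.
exact: mfd_smooth_cst.
Qed.

Lemma csmooth_zcoord_row (m : nat) (S : manifold R m) (h : S -> 'rV[R]_n) s i :
  (forall j, smooth (fun t => h t 0 j) s) -> csmooth (fun t => zcoord (h t) i) s.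
Proof. by move=> sh; split; exact: smooth_coord_row. Qed.

(** Stated for any map q that factors through the model by h, since it serves twice: on the model
    itself, to verify the hypotheses of [blowup_chart], and for p in the resulting charts. *)
Lemma exceptional_generator (m : nat) (S : manifold R m) (q : S -> M) (h : S -> 'rV[R]_n)
    (c : chart R n M) (k l' j : nat) s :
  adapted_chart c k l' -> l' = 0%N \/ (j < l')%N ->
  {for s, continuous q} ->
  (forall f : M -> R[i], csmooth f (q s) -> csmooth (fun t => f (q t)) s) ->
  (forall r, smooth (fun t => h t 0 r) s) ->
  (\forall t \near s, cdom c (q t) /\ cmap c (q t) = blowdown l' j (h t)) ->
  (forall f, IY (q s) f -> exists2 a, csmooth a s &
    \forall t \near s, f (q t) = a t * exceptional l' j (h t)) /\
  exists2 f, IY (q s) f & \forall t \near s, exceptional l' j (h t) = f (q t).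
Proof.
move=> [[cc kn _] lk iY] lj cq sq sh E.
have ln : (l'.*2 <= n)%N by apply: leq_trans kn; rewrite leq_double.
have [cs _] := nbhs_singleton E; rewrite /exceptional.
move: (iY _ cs); case: (boolP (l' == 0%N)) => l0 iYs; split.
- move=> f /iYs sf; exists (fun t => f (q t)); first exact: sq.
  by apply: near_true => t; rewrite mulr1.
- by exists (fun=> 1); [apply/iYs; exact: csmooth_cst|exact: near_true].
- move=> f /iYs[a [sa aE]].
  (* Uses z_i = w_i w_j for i <> j and z_j = 1 * w_j. *)
  exists (fun t => \sum_i a i (q t) * (if i == j :> nat then 1 else zcoord (h t) i)).
    apply: csmooth_sum => i; apply: csmoothM; first exact: sq.
    by case: (nat_of_ord i == j); [exact: csmooth_cst|exact: csmooth_zcoord_row].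
  have := near_and E (cq _ aE); apply: near_imp => t [[_ Et] ->].
  rewrite mulr_suml; apply: eq_bigr => i _.
  by rewrite Et zcoord_blowdown // mulrA.
- case: lj => [l'0|jl]; first by rewrite l'0 in l0.
  exists (fun y => zcoord (cmap c y) j).
    apply/iYs; exists (fun i _ => (i == Ordinal jl)%:R); split.
      by move=> i; exact: csmooth_cst.
    apply: near_true => y; rewrite (bigD1 (Ordinal jl)) //= eqxx mul1r big1 ?addr0 //.
    by move=> i /negPf ->; rewrite mul0r.
  by apply: near_imp E => t [_ ->]; rewrite zcoord_j.
Qed.

Hypothesis idY : ideal_sheaf (@csmooth R n M) IY.
Hypothesis bp : blowup IY p.

(** Any smooth factorization h of p through the standard blow-down near x is a chart: [blowup_chart]
    applies on a neighbourhood where the factorization holds. *)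
Lemma build_blowup_coordinates (c : chart R n M) k l' j (h : Mt -> 'rV[R]_n) x :
  adapted_chart c k l' -> l' = 0%N \/ l' = l /\ (j < l)%N ->
  (forall r, smooth (fun t => h t 0 r) x) ->
  (\forall y \near x, cdom c (p y) /\ cmap c (p y) = blowdown l' j (h y)) ->
  exists2 d, cdom d x & blowup_coordinates d c k l' j.
Proof.
move=> ac lj sh E; have [[cc kn _] lk _] := ac.
have ln : (l'.*2 <= n)%N by apply: leq_trans kn; rewrite leq_double.
have lj' : l' = 0%N \/ (j < l')%N by case: lj => [|[->]]; [left|right].
have : \forall y \near x, (cdom c (p y) /\ cmap c (p y) = blowdown l' j (h y)) /\
    forall r, smooth (fun t => h t 0 r) y.
  by apply: near_and E _; apply: near_all => r; exact: mfd_smooth_near.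
move=> /near_openP[V0 [oV Vx VP]].
have gen u : (cmap c @` cdom c) (blowdown l' j u) ->
  (forall f, IY (cinv c (blowdown l' j u)) f ->
    exists2 a : rV_manifold R n -> R[i], csmooth a u &
    \forall v \near (u : rV_manifold R n), f (cinv c (blowdown l' j v)) = a v * exceptional l' j v) /\
  exists2 f, IY (cinv c (blowdown l' j u)) f &
    \forall v \near (u : rV_manifold R n), exceptional l' j v = f (cinv c (blowdown l' j v)).
  move=> [y cy Ey].
  have sb r : smooth_rV (fun v => blowdown l' j v 0 r) u by exact: smooth_blowdown.
  have cb : {for u, continuous (@blowdown R n l' j)}.
    by apply: row_continuous => r; exact: smooth_cont.
  have [hc _] := cc; have [_ _ _ _ ci] := hc.
  apply: (@exceptional_generator n (rV_manifold R n) (fun v => cinv c (blowdown l' j v)) id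
    c k l' j u ac lj').
  - apply: (@continuous_comp 'rV[R]_n 'rV[R]_n M (@blowdown R n l' j) (cinv c)) => //.
    by rewrite -Ey; exact: ci.
  - have H (f : M -> R) : smooth f (cinv c (blowdown l' j u)) ->
        smooth (fun v : rV_manifold R n => f (cinv c (blowdown l' j v))) u.
      rewrite -Ey (cmapK cc cy) => /(smoothE _ cc cy) sf; apply/rV_smoothP.
      by apply: (smooth_compr (h := f \o cinv c)) => //; rewrite -Ey.
    by move=> f [f1 f2]; split; [exact: (H (fun y => complex.Re (f y)))|
      exact: (H (fun y => complex.Im (f y)))].
  - by move=> r; apply/rV_smoothP; exact: smooth_rV_coord.
  - have := chart_inv_near hc cy; rewrite Ey => /cb; apply: near_imp => v /= [E1 E2].
    by split.
have [g cg] := @blowup_chart R n M Mt IY p idY bp c (@blowdown R n l' j) (@exceptional R n l' j)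
  cc (fun u j0 => smooth_blowdown _ _ u j0) (fun u => csmooth_exceptional l' j u)
  (fun u r r0 => exceptional_dense ln lj' u r0)
  (fun u v => @blowdown_inj R n l' j ln u v)
  (fun u f Xu => (gen u Xu).1 f) (fun u Xu => (gen u Xu).2)
  V0 h x oV Vx (fun y Vy => let H := (VP y Vy).1 in conj H.1 (esym H.2))
  (fun y Vy => (VP y Vy).2).
exists (Chart V0 h g) => //; split => // y Vy.
by have [] := VP y Vy.
Qed.

End BlowupCoordinates.

(** * Charts of the blow-up at every point *)

Section BlowupAtlas.
Variables (R : realType) (n l : nat) (M Mt : manifold R n) (I : M -> set (M -> R)).
Variables (Y : set M) (IY : M -> set (M -> R[i])) (p : Mt -> M).
Hypothesis bp : blowup IY p.

(** The components z_i of p are multiples a_i e of a generator e, and e is a combination of the z_i,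
    so e = N e with N a combination of the a_i. As the non-zeros of e are dense, N = 1 at x, and
    some a_j is nonzero there. *)
Lemma divisor_quotients (c : chart R n M) x : coordinates c -> cdom c (p x) ->
  generated (@csmooth R n M) (cdom c) (fun (i : 'I_l) y => zcoord (cmap c y) i) IY ->
  exists (a : 'I_l -> Mt -> R[i]) (e : Mt -> R[i]) (j : 'I_l),
    [/\ forall i, csmooth (a i) x, a j x != 0 &
        \forall y \near x, forall i : 'I_l, zcoord (cmap c (p y)) i = a i y * e y].
Proof.
move=> cc cx gY; have [sp [_ dp] _] := bp.
have [U [e [oU Ux se e0 gE]]] := dp x; have cp := (sp x).1.
have zI (i : 'I_l) : IY (p x) (fun y => zcoord (cmap c y) i).
  apply/(gY _ cx); exists (fun m _ => (m == i)%:R); split.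
    by move=> m; exact: csmooth_cst.
  apply: near_true => y; rewrite (bigD1 i) //= eqxx mul1r big1 ?addr0 //.
  by move=> m /negPf ->; rewrite mul0r.
have /choice[a aP] (i : 'I_l) : exists a : Mt -> R[i], csmooth a x /\
    \forall y \near x, zcoord (cmap c (p y)) i = a y * e y.
  have : pullback (@csmooth R n Mt) p IY x (fun y => zcoord (cmap c (p y)) i).
    exists 1%N, (fun _ _ => 1), (fun _ y => zcoord (cmap c y) i); split.
      by move=> _; split; [exact: csmooth_cst|exact: zI].
    by apply: near_true => y; rewrite big_ord1 mul1r.
  move=> /(gE x Ux)[a [sa E]]; exists (a ord0); split; first exact: sa.
  by apply: near_imp E => y ->; rewrite big_ord1.
have E : \forall y \near x, forall i : 'I_l, zcoord (cmap c (p y)) i = a i y * e y.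
  by apply: near_all => i; exact: (aP i).2.
have : pullback (@csmooth R n Mt) p IY x e.
  apply/(gE x Ux); exists (fun _ _ => 1); split; first by move=> _; exact: csmooth_cst.
  by apply: near_true => y; rewrite big_ord1 mul1r.
move=> [r [b [g [bg eE]]]].
have /choice[A AP] (m : 'I_r) : exists A : 'I_l -> M -> R[i], (forall i, csmooth (A i) (p x)) /\
    \forall y \near p x, g m y = \sum_i A i y * zcoord (cmap c y) i.
  exact: (gY _ cx (g m)).1 (bg m).2.
pose N y := \sum_i (\sum_m b m y * A m i (p y)) * a i y.
have sN : csmooth N x.
  apply: csmooth_sum => i; apply: csmoothM; last exact: (aP i).1.
  apply: csmooth_sum => m; apply: csmoothM; first exact: (bg m).1.
  by apply: csmooth_comp => //; exact: (AP m).1.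
have NE : \forall y \near x, e y = N y * e y.
  have H : \forall y \near x, forall m, g m (p y) = \sum_i A m i (p y) * zcoord (cmap c (p y)) i.
    by apply: near_all => m; exact: cp _ (AP m).2.
  have := near_and E (near_and eE H); apply: near_imp => y [Ey [eEy Hy]].
  rewrite [LHS]eEy mulr_suml.
  under eq_bigr => m _ do rewrite Hy mulr_sumr.
  rewrite exchange_big; apply: eq_bigr => i _ /=; rewrite -mulrA -Ey mulr_suml.
  by apply: eq_bigr => m _; rewrite mulrA.
have N1 : N x = 1.
  apply/eqP/negPn/negP => /(csmooth_cont sN) N1.
  have [y [[y1 yE] Uy ey]] := nonzeros_dense oU e0 Ux (near_and N1 NE).
  move: y1; rewrite -(inj_eq (mulIf ey)) mul1r => /eqP; apply.
  exact: esym.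
suff [j aj] : exists j, a j x != 0.
  by exists a, e, j; split=> // i; exact: (aP i).1.
apply: contrapT => nE; have N0 : N x = 0.
  apply: big1 => i _; have -> : a i x = 0 by apply/eqP/negPn/negP => ai; apply: nE; exists i.
  by rewrite mulr0.
by have := oner_neq0 R[i]; rewrite -N1 N0 eqxx.
Qed.

Hypothesis idY : ideal_sheaf (@csmooth R n M) IY.

(** The candidate coordinates are w_i = a_i / a_j in the divided planes and those of p elsewhere;
    then z_i = a_i e = w_i a_j e = w_i z_j. *)
Lemma blowup_coordinates_on (c : chart R n M) k x : cdom c (p x) -> (l <= k)%N ->
  holomorphic_coordinates l Y IY c -> elliptic_coordinates I c k ->
  exists (d : chart R n Mt) (j : nat), cdom d x /\ blowup_coordinates l I IY p d c k l j.
Proof.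
move=> cx lk [cc ln _ gY] ec.
have [a [e [j [sa aj E]]]] := divisor_quotients cc cx gY.
have [sp _ _] := bp; have cp := (sp x).1.
(* The index j exists, so l is positive and the unit-ideal branch of [adapted_chart] does not
   occur. *)
have l0 : l <> 0%N by apply/eqP; rewrite -lt0n (leq_ltn_trans _ (ltn_ord j)).
have ac : adapted_chart I IY c k l.
  split=> // y cy f; rewrite (gY _ cy).
  by case: eqP.
pose w (i : nat) (y : Mt) : R[i] := oapp (fun i : 'I_l => a i y * (a j y)^-1) 0 (insub i).
have wE (i : 'I_l) y : w i y = a i y * (a j y)^-1 by rewrite /w valK.
have sw i : csmooth (w i) x.
  rewrite /w; case: insub => [m|] /=; last exact: csmooth_cst.
  by apply: csmoothM; [exact: sa|exact: csmoothV].
pose h y : 'rV[R]_n := \row_(q < n) if divided l j q then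
  (if odd q then complex.Im (w q./2 y) else complex.Re (w q./2 y)) else cmap c (p y) 0 q.
have scp r : smooth (fun y => cmap c (p y) 0 r) x.
  exact: (@smooth_map_comp R n n Mt M p (fun y => cmap c y 0 r) x sp (smooth_cmap r cc cx)).
suff [d dx dP] : exists2 d, cdom d x & blowup_coordinates l I IY p d c k l j by exists d, j.
apply: (@build_blowup_coordinates R n l M Mt I IY p idY bp c k l j h).
- exact: ac.
- by right.
- move=> r; have -> : (fun y => h y 0 r) = fun y => if divided l j r then
      (if odd r then complex.Im (w r./2 y) else complex.Re (w r./2 y)) else cmap c (p y) 0 r.
    by apply/funext => y; rewrite mxE.
  by case: divided => //; case: odd; have [] := sw r./2.
- have := near_and (near_and E (csmooth_cont (sa j) aj)) (cp _ (cdom_near cc cx)).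
  apply: near_imp => y [[Ey ay] cy]; split=> //.
  have hU q : ~~ divided l j q -> coord (h y) q = coord (cmap c (p y)) q.
    have [qn|qn] := ltnP q n; last by rewrite !coord_ge.
    by rewrite -[q]/(nat_of_ord (Ordinal qn)) !coordE mxE => /negPf ->.
  have hj : zcoord (h y) j = zcoord (cmap c (p y)) j.
    by rewrite /zcoord !hU // /divided /= ?uphalf_double ?doubleK eqxx andbF.
  apply: zcoord_eqP => i.
  have [/andP[il ij]|H] := boolP ((i < l)%N && (i != j)); last first.
    rewrite zcoord_undivided // /zcoord !hU //; first by rewrite /divided /= uphalf_double.
    by rewrite /divided doubleK.
  have hi : zcoord (h y) i = w i y.
    have i1 : (i.*2.+1 < n)%N by apply: leq_trans ln; rewrite -doubleS leq_double.
    rewrite /zcoord -[i.*2.+1]/(nat_of_ord (Ordinal i1)) -[i.*2]/(nat_of_ord (Ordinal (ltnW i1))).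
    rewrite !coordE !mxE /divided /= uphalf_double doubleK il ij odd_double /=.
    by case: (w i y).
  rewrite zcoord_divided // hi hj (wE (Ordinal il)) (Ey (Ordinal il)) Ey.
  by rewrite mulrA divfK.
Qed.

(** Off the closed set Y the ideal is the unit ideal. An elliptic chart restricted to the complement
    of Y is adapted with l' = 0, and its composite with p is a chart of [Mt] near x: p is a local
    diffeomorphism there. *)
Lemma blowup_coordinates_off x : closed Y -> elliptic_divisor I ->
  (forall x, ~ Y x -> forall f, IY x f <-> csmooth f x) -> ~ Y (p x) ->
  exists (d : chart R n Mt) (c : chart R n M) (k j : nat),
    cdom d x /\ blowup_coordinates l I IY p d c k 0 j.
Proof.
move=> clY [_ eI] offY nYx; have [k [c [cx _ ec]]] := eI (p x).
have [cc kn _] := ec; have [sp _ _] := bp; have cp := (sp x).1.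
have oY : open (~` Y) by rewrite openC.
have sid (u : 'rV[R]_n) r : smooth_rV (fun v : 'rV[R]_n => (@id 'rV[R]_n) v 0 r) u.
  exact: smooth_rV_coord.
have ec' := @elliptic_change R n M I c k (~` Y) id id k (fun=> 1) ec kn oY (fun u => erefl)
  (fun u => erefl) sid sid (fun y _ _ => conj (@mfd_smooth_cst R n M 1 y) (oner_neq0 R))
  (fun y _ _ => esym (mul1r _)).
set c' := Chart _ _ _ in ec'; have [cc' _ _] := ec'.
have ac : adapted_chart I IY c' k 0 by split=> // y [_ nYy] f; rewrite (offY _ nYy).
suff [d dx dP] : exists2 d, cdom d x & blowup_coordinates l I IY p d c' k 0 0 by exists d, c', k, 0%N.
apply: (@build_blowup_coordinates R n l M Mt I IY p idY bp c' k 0 0 (fun y => cmap c' (p y))) => //.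
- by left.
- move=> r; apply: (@smooth_map_comp R n n Mt M p (fun y => cmap c' y 0 r) x sp).
  by apply: smooth_cmap => //; split.
- have := cp _ (@cdom_near R n M c' (p x) cc' (conj cx nYx)); apply: near_imp => y cy.
  by split=> //; apply: zcoord_eqP => i; rewrite zcoord_undivided.
Qed.

Lemma blowup_coordinates_at x : elliptic_divisor I -> holomorphic_ideal l Y IY ->
  adapted l Y IY I -> exists (d : chart R n Mt) (c : chart R n M) (k l' j : nat),
    cdom d x /\ blowup_coordinates l I IY p d c k l' j.
Proof.
move=> eI [clY _ offY _] ad; have [Yx|nYx] := pselect (Y (p x)).
  have [c [k [cx lk hc ec]]] := ad _ Yx.
  have [d [j dP]] := blowup_coordinates_on cx lk hc ec.
  by exists d, c, k, l, j.
have [d [c [k [j dP]]]] := blowup_coordinates_off clY eI offY nYx.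
by exists d, c, k, 0%N, j.
Qed.

End BlowupAtlas.

(** * The elliptic divisor on the blow-up *)

Section LiftedDivisor.
Variables (R : realType) (n l : nat) (M Mt : manifold R n) (I : M -> set (M -> R)).
Variables (IY : M -> set (M -> R[i])) (p : Mt -> M).
Implicit Types (d : chart R n Mt) (c : chart R n M) (x y : Mt).

(* [I_|Dt| = |e|^(-2(l-1)) p^*I_|D|], where [e] generates [p^*I_Y]; if [l = 0], then
   [Y] is empty, [e] is a unit and the truncated exponent [l.-1 = 0] is harmless. *)
Definition lifted_ideal x (f : Mt -> R) : Prop :=
  smooth f x /\ exists (e : Mt -> R[i]) (g : M -> R) (a : Mt -> R),
    [/\ csmooth e x,
        forall h, IY (p x) h -> exists2 b, csmooth b x & \forall y \near x, h (p y) = b y * e y,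
        I (p x) g, smooth a x &
        \forall y \near x, f y * normsq (e y) ^+ l.-1 = a y * g (p y)].

Hypothesis sp : smooth_map p.

Lemma blowup_ellipticity d c k l' j : blowup_coordinates l I IY p d c k l' j ->
  [/\ elliptic_coordinates I c k, coordinates d, (l'.*2 <= n)%N, (l' <= k)%N &
      l' = 0%N \/ (j < l')%N].
Proof.
move=> [[ec lk _] lj cd _]; have [_ kn _] := ec; split=> //.
  by apply: leq_trans kn; rewrite leq_double.
by case: lj => [|[->]]; [left|right].
Qed.

Lemma csmooth_exceptional_chart d l' j x : coordinates d -> cdom d x ->
  csmooth (fun y => exceptional l' j (cmap d y)) x.
Proof.
move=> cd dx; rewrite /exceptional; case: (l' == 0%N); first exact: csmooth_cst.
exact: csmooth_zcoord.
Qed.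

Lemma exceptional_dense_chart d c k l' j x (A : set Mt) :
  blowup_coordinates l I IY p d c k l' j -> cdom d x -> nbhs x A ->
  exists y, [/\ A y, cdom d y & exceptional l' j (cmap d y) != 0].
Proof.
move=> bd dx xA; have [_ cd ln _ lj] := blowup_ellipticity bd; have [hd _] := cd.
have /(chart_near A hd dx) := xA => /(near_and (chart_inv_near hd dx)).
move=> /nbhs_boxP[r r0 rP]; have [v /rP[[dv cv] Av] ev] := exceptional_dense ln lj (cmap d x) r0.
by exists (cinv d v); rewrite dv.
Qed.

(** The non-zeros of the exceptional function are dense, so its powers cancel among smooth germs. *)
Lemma cancel_exceptional d c k l' j x (f : Mt -> R) m :
  blowup_coordinates l I IY p d c k l' j -> cdom d x -> smooth f x ->
  (\forall y \near x, f y * normsq (exceptional l' j (cmap d y)) ^+ m = 0) ->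
  \forall y \near x, f y = 0.
Proof.
move=> bd dx sf E; have [_ cd _ _ _] := blowup_ellipticity bd.
have := near_and (cdom_near cd dx) (near_and (mfd_smooth_near sf) (near_near E)).
apply: near_imp => y [dy [sfy Ey]]; apply/eqP/negPn/negP => fy.
have [z [[fz /eqP]]] := exceptional_dense_chart bd dy
  (near_and (neq0_near (mfd_smooth_cont sfy) fy) Ey).
by rewrite mulf_eq0 (negPf fz) expf_eq0 normsq_eq0 /= => /andP[_ /eqP ->] _ /eqP.
Qed.

(** The exponent is written with l also when l' = 0: the exceptional function is then 1. *)
Lemma rsq_prod_blowdown d c k l' j y : blowup_coordinates l I IY p d c k l' j -> cdom d y ->
  rsq_prod c k (p y) = normsq (exceptional l' j (cmap d y)) ^+ l.-1 * rsq_prod d k y.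
Proof.
move=> bd dy; have [_ _ ln lk lj] := blowup_ellipticity bd.
have [_ l'E _ /(_ y dy)[_ E]] := bd.
rewrite /rsq_prod E prod_blowdown //; case: l'E => [->|[-> _]] //.
by rewrite /exceptional eqxx /normsq /= expr1n expr0n addr0 !expr1n.
Qed.

Lemma exceptional_generator_chart d c k l' j x :
  blowup_coordinates l I IY p d c k l' j -> cdom d x ->
  (forall f, IY (p x) f -> exists2 a, csmooth a x &
    \forall y \near x, f (p y) = a y * exceptional l' j (cmap d y)) /\
  exists2 f, IY (p x) f & \forall y \near x, exceptional l' j (cmap d y) = f (p y).
Proof.
move=> bd dx; have [ac _ _ dE] := bd; have [_ cd _ _ lj] := blowup_ellipticity bd.
apply: (exceptional_generator ac lj (sp x).1).
- by move=> f; exact: csmooth_comp.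
- by move=> r; exact: smooth_cmap.
- by apply: near_imp (cdom_near cd dx) => y /dE.
Qed.

(** Compares the chart-free definition with its local form. Any admissible e divides the pulled back
    ideal, so the exceptional function is b e; this turns the defining relation into one for the
    exceptional function, whose power cancels. Conversely, the exceptional function and the
    generator of I in the chart c are admissible. *)
Lemma lifted_idealP d c k l' j x f : blowup_coordinates l I IY p d c k l' j -> cdom d x ->
  lifted_ideal x f <->
  exists2 a, smooth a x & \forall y \near x, f y = a y * rsq_prod d k y.
Proof.
move=> bd dx; have [ec cd _ _ _] := blowup_ellipticity bd.
have [_ _ _ dE] := bd; have [cx _] := dE x dx.
have [gen [e0 e0Y e0E]] := exceptional_generator_chart bd dx.
have NP : \forall y \near x, rsq_prod c k (p y) =
    normsq (exceptional l' j (cmap d y)) ^+ l.-1 * rsq_prod d k y.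
  by apply: near_imp (cdom_near cd dx) => y; exact: rsq_prod_blowdown bd.
split=> [[sf [e [g [a [se eY gI sa E]]]]]|[a sa E]]; last first.
  split.
    apply: mfd_smooth_congr (mfd_smoothM sa (smooth_rsq_prod k cd dx)).
    by apply: near_imp E => y ->.
  exists (fun y => exceptional l' j (cmap d y)), (rsq_prod c k), a; split=> //.
  - exact: csmooth_exceptional_chart.
  - apply/(ellipticP _ ec cx); exists (fun=> 1); first exact: mfd_smooth_cst.
    by apply: near_true => y; rewrite mul1r.
  - by have := near_and E NP; apply: near_imp => y [-> ->]; rewrite mulrAC mulrA.
have [b sb bE] := eY _ e0Y.
have /(ellipticP _ ec cx)[b' sb' b'E] := gI.
(* The relation is multiplied by |b|^(2(l-1)), which replaces e by the exceptional function b e. *)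
pose A y := normsq (b y) ^+ l.-1 * (a y * b' (p y)).
have sA : smooth A x.
  apply: mfd_smoothM; first by apply: mfd_smoothX; exact: smooth_normsq.
  by apply: mfd_smoothM => //; exact: smooth_map_comp.
exists A => //.
have sF : smooth (fun y => f y - A y * rsq_prod d k y) x.
  by apply: mfd_smoothB => //; apply: mfd_smoothM => //; exact: smooth_rsq_prod.
suff : \forall y \near x, f y - A y * rsq_prod d k y = 0.
  by apply: near_imp => y /eqP; rewrite subr_eq0 => /eqP.
apply: (cancel_exceptional (m := l.-1) bd dx sF).
have := near_and (near_and E NP) (near_and (near_and e0E bE) ((sp x).1 _ b'E)).
apply: near_imp => y [[Ey Py] [[e0y by_] b'y]].
have eE : exceptional l' j (cmap d y) = b y * e y by rewrite e0y.
rewrite mulrBl; apply/eqP; rewrite subr_eq0 -mulrA [rsq_prod d k y * _]mulrC -Py /A.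
by rewrite eE normsqM exprMn mulrCA Ey b'y; apply/eqP; ring.
Qed.

Hypothesis atlas_at : forall x, exists (d : chart R n Mt) (c : chart R n M) (k l' j : nat),
  cdom d x /\ blowup_coordinates l I IY p d c k l' j.

Lemma lifted_ideal_sheaf : ideal_sheaf (@smooth R n Mt) lifted_ideal.
Proof.
move=> x; have [d [c [k [l' [j [dx bd]]]]]] := atlas_at x.
have P := lifted_idealP _ bd dx; have [_ cd _ _ _] := blowup_ellipticity bd; split.
- move=> f If; split; first by case: If.
  have /P[a sa E] := If.
  have := near_and (near_and (near_near E) (mfd_smooth_near sa)) (cdom_near cd dx).
  by apply: near_imp => y [[Ey say] dy]; apply/(lifted_idealP _ bd dy); exists a.
- move=> f g /P[a sa E] fg; apply/P; exists a => //.
  by have := near_and E fg; apply: near_imp => y [-> <-].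
- apply/P; exists (fun=> 0); first exact: mfd_smooth_cst.
  by apply: near_true => y; rewrite mul0r.
- move=> f g /P[a sa Ea] /P[b sb Eb]; apply/P; exists (fun y => a y + b y).
    exact: mfd_smoothD.
  by have := near_and Ea Eb; apply: near_imp => y [-> ->]; rewrite mulrDl.
- move=> b f sb /P[a sa E]; apply/P; exists (fun y => b y * a y); first exact: mfd_smoothM.
  by apply: near_imp E => y ->; rewrite mulrA.
Qed.

Lemma lifted_elliptic_coordinates d c k l' j : blowup_coordinates l I IY p d c k l' j ->
  elliptic_coordinates lifted_ideal d k.
Proof.
move=> bd; have [[_ kn _] cd _ _ _] := blowup_ellipticity bd.
split=> // x dx f; rewrite (lifted_idealP f bd dx); split=> [[a sa E]|[a [sa E]]].
  by exists (fun=> a); split=> //; apply: near_imp E => y ->; rewrite big_ord1.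
by exists (a ord0) => //; apply: near_imp E => y ->; rewrite big_ord1.
Qed.

Lemma lifted_elliptic_divisor : elliptic_divisor lifted_ideal.
Proof.
split=> [|x]; first exact: lifted_ideal_sheaf.
have [d [c [k [l' [j [dx bd]]]]]] := atlas_at x.
exact: recenter_elliptic (lifted_elliptic_coordinates bd) dx.
Qed.

End LiftedDivisor.

(** * Lifting the standard frame *)

(** Each |z_i|^2 vanishes only inside the hyperplane where the real part of z_i is zero, so the
    factors cancel one at a time off a hyperplane. *)
Lemma rsq_prod_regular (R : realType) (n k : nat) (f : 'rV[R]_n -> R) u : (k.*2 <= n)%N ->
  smooth_rV f u -> (\forall v \near u, f v * \prod_(i < k) rsq v i = 0) ->
  \forall v \near u, f v = 0.
Proof.
elim: k f => [|k IH] f kn sf E.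
  by apply: near_imp E => v; rewrite big_ord0 mulr1.
have k0 : (k.*2 < n)%N by apply: leq_trans kn; rewrite doubleS ltnS leqnSn.
have := IH (fun v => f v * rsq v k) (leq_trans _ kn) (smooth_rVM sf (smooth_rsq k u)).
rewrite leq_double leqnSn => /(_ isT) H.
apply: (eq_off_coord (m := Ordinal k0) (c := 0)) => //; first exact: smooth_rV_cst.
have {}H : \forall v \near u, f v * rsq v k = 0.
  by apply: H; apply: near_imp E => v <-; rewrite big_ord_recr /= mulrAC mulrA.
apply: near_imp H => v /eqP; rewrite mulf_eq0 => /orP[/eqP //|].
rewrite /rsq paddr_eq0 ?sqr_ge0 // !sqrf_eq0 => /andP[+ _].
by rewrite -[k.*2]/(nat_of_ord (Ordinal k0)) coordE => ->.
Qed.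

Lemma cancel_rsq_prod (R : realType) (n : nat) (M : manifold R n) (c : chart R n M) k x f :
  coordinates c -> cdom c x -> (k.*2 <= n)%N -> smooth f x ->
  (\forall y \near x, f y * rsq_prod c k y = 0) -> \forall y \near x, f y = 0.
Proof.
move=> cc cx kn sf E; have [hc _] := cc; apply/(chart_near _ hc cx).
have sf' : smooth_rV (f \o cinv c) (cmap c x) by apply/(smoothE _ cc cx).
apply: (rsq_prod_regular kn sf').
have /(chart_near _ hc cx) H := E.
have := near_and H (chart_inv_near hc cx); apply: near_imp => u [+ [uK _]].
by rewrite /rsq_prod uK.
Qed.

(** The hypotheses are the imaginary and real parts of b z = 0, and multiplication by conj(z) gives
    b |z|^2 = 0. The boolean, the parity of a real index in the applications, selects a part of
    b. *)
Lemma complex_mul_eq0 (R : comNzRingType) (b0 b1 z0 z1 : R) :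
  b0 * z1 + b1 * z0 = 0 -> b0 * z0 - b1 * z1 = 0 ->
  forall o : bool, (if o then b1 else b0) * (z0 ^+ 2 + z1 ^+ 2) = 0.
Proof.
move=> E1 E0 [].
  rewrite (_ : _ * _ = z0 * (b0 * z1 + b1 * z0) - z1 * (b0 * z0 - b1 * z1)); last by ring.
  by rewrite E1 E0; ring.
rewrite (_ : _ * _ = z1 * (b0 * z1 + b1 * z0) + z0 * (b0 * z0 - b1 * z1)); last by ring.
by rewrite E1 E0; ring.
Qed.

Section LiftedFrame.
Variables (R : realType) (n l : nat) (M Mt : manifold R n) (I : M -> set (M -> R)).
Variables (IY : M -> set (M -> R[i])) (p : Mt -> M).
Variables (d : chart R n Mt) (c : chart R n M) (k l' j : nat).
Hypothesis sp : smooth_map p.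
Hypothesis bd : blowup_coordinates l I IY p d c k l' j.
Implicit Types (x y : Mt).

Let ec : elliptic_coordinates I c k. Proof. by have [] := blowup_ellipticity bd. Qed.
Let cc : coordinates c. Proof. by have [] := ec. Qed.
Let cd : coordinates d. Proof. by have [] := blowup_ellipticity bd. Qed.
Let kn : (k.*2 <= n)%N. Proof. by have [] := ec. Qed.
Let lk : (l' <= k)%N. Proof. by have [] := blowup_ellipticity bd. Qed.
Let jl : l' = 0%N \/ (j < l')%N. Proof. by have [] := blowup_ellipticity bd. Qed.
Let dE y : cdom d y -> cdom c (p y) /\ cmap c (p y) = blowdown l' j (cmap d y).
Proof. by have [_ _ _] := bd; apply. Qed.

Let divided_lt q : divided l' j q -> [/\ (q < k.*2)%N, (j.*2.+1 < k.*2)%N & (q < l'.*2)%N].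
Proof.
move=> /andP[ql _]; have q2 : (q < l'.*2)%N by rewrite -ltn_half_double.
split=> //; first by rewrite (leq_trans q2) // leq_double.
case: jl => [l0|jl0]; first by rewrite l0 in ql.
by rewrite -doubleS leq_double (leq_trans jl0).
Qed.

Lemma tangent_blowdown y (v : (Mt -> R) -> R) q : cdom d y -> tangent y v -> (q < n)%N ->
  v (fun z => coord (cmap c (p z)) q) =
  let u := cmap d y in let D m := v (fun z => coord (cmap d z) m) in
  if divided l' j q then
    if odd q then D q.-1 * coord u j.*2.+1 + coord u q.-1 * D j.*2.+1 +
      (D q * coord u j.*2 + coord u q * D j.*2)
    else D q * coord u j.*2 + coord u q * D j.*2 -
      (D q.+1 * coord u j.*2.+1 + coord u q.+1 * D j.*2.+1)
  else D q.
Proof.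
move=> dy tv qn /=; have s m : smooth (fun z => coord (cmap d z) m) y by exact: smooth_cmap_coord.
have E : \forall z \near y, coord (blowdown l' j (cmap d z)) q = coord (cmap c (p z)) q.
  by apply: near_imp (cdom_near cd dy) => z /dE[_ ->].
rewrite -(tangent_congr tv _ E); last first.
  by apply: (smooth_in_chart (h := fun u => coord (blowdown l' j u) q)) => //;
    apply: (smooth_compr (h := fun u => coord u q)) => [r|]; [exact: smooth_blowdown|exact: smooth_coord].
have -> : (fun z => coord (blowdown l' j (cmap d z)) q) = fun z => if divided l' j q then
    if odd q then coord (cmap d z) q.-1 * coord (cmap d z) j.*2.+1 +
      coord (cmap d z) q * coord (cmap d z) j.*2
    else coord (cmap d z) q * coord (cmap d z) j.*2 -
      coord (cmap d z) q.+1 * coord (cmap d z) j.*2.+1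
  else coord (cmap d z) q by apply/funext => z; rewrite coord_blowdown.
case: (divided l' j q) => //; case: (odd q).
  by rewrite (tangentD tv (mfd_smoothM (s _) (s _)) (mfd_smoothM (s _) (s _))) !(tangentM tv).
by rewrite (tangentB tv (mfd_smoothM (s _) (s _)) (mfd_smoothM (s _) (s _))) !(tangentM tv).
Qed.

(* [sum_m a_m F_m] lifts to [sum_m (lift_coef a)_m F~_m] in terms of the standard frames
   in [c] and [d]: the coefficient of [w_i d/dw_i]
   is [a_i - a_j] for divided [i], and [a_i] otherwise. *)
Definition lift_coef (a : nat -> R) (q : nat) : R :=
  a q - (divided l' j q)%:R * a (j.*2 + odd q)%N.

(** Inverts [lift_coef] by the opposite correction: the coefficients of the plane j, which enter the
    correction, are themselves unchanged. *)
Definition unlift_coef (b : nat -> R) (q : nat) : R :=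
  b q + (divided l' j q)%:R * b (j.*2 + odd q)%N.

Let undivided_j (b : bool) : divided l' j (j.*2 + b) = false.
Proof. by rewrite /divided addnC half_bit_double eqxx andbF. Qed.

Lemma unlift_coefK b q : lift_coef (unlift_coef b) q = b q.
Proof.
rewrite /lift_coef /unlift_coef undivided_j mul0r addr0.
by rewrite addrK.
Qed.

Let divided_pred q : odd q -> divided l' j q.-1 = divided l' j q.
Proof. by case: q => // q /= oq; rewrite /divided /= uphalf_half (negPf oq). Qed.

Let divided_succ q : ~~ odd q -> divided l' j q.+1 = divided l' j q.
Proof. by move=> oq; rewrite /divided /= uphalf_half (negPf oq). Qed.

(** In complex notation z_i = w_i w_j is multiplied by the sum of the factors of w_i and w_j, that
    is (a_i - a_j) + a_j = a_i. Comparison on coordinates suffices for tangent vectors. *)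
Lemma lift_comb a y g : cdom d y -> smooth g (p y) ->
  std_comb d k (lift_coef a) y (g \o p) = std_comb c k a (p y) g.
Proof.
move=> dy sg; have [cy yE] := dE dy.
have td := tangent_std_comb k (lift_coef a) cd dy.
apply: (tangent_eq_coord cc cy (tangent_pushforward sp td) (tangent_std_comb k a cc cy)) => // q.
rewrite coord_cmap std_comb_coord // -[LHS]/(std_comb d k (lift_coef a) y
  (fun z => coord (cmap c (p z)) q)) (tangent_blowdown dy td) //=.
have [dq|ndq] := boolP (divided l' j q); last first.
  rewrite std_comb_coord // yE coord_undivided // /lift_coef (negPf ndq) mul0r subr0.
  case: ifP => // qk; case: ifPn => oq.
    by rewrite divided_pred // (negPf ndq) mul0r subr0 coord_undivided // divided_pred.
  by rewrite divided_succ // (negPf ndq) mul0r subr0 coord_undivided // divided_succ.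
have [qk jk _] := divided_lt dq; rewrite qk yE.
have j1n : (j.*2.+1 < n)%N by exact: leq_trans kn.
have j0n := ltnW j1n; have j0k := ltnW jk.
have oj : odd j.*2 = false by rewrite odd_double.
have nj : divided l' j j.*2 = false by have := undivided_j false; rewrite addn0.
have nj1 : divided l' j j.*2.+1 = false by have := undivided_j true; rewrite addn1.
have Lj : lift_coef a j.*2 = a j.*2 by rewrite /lift_coef nj mul0r subr0.
have Lj1 : lift_coef a j.*2.+1 = a j.*2.+1 by rewrite /lift_coef nj1 mul0r subr0.
have dj0 := std_comb_coord (lift_coef a) cd dy kn j0n.
have dj1 := std_comb_coord (lift_coef a) cd dy kn j1n.
rewrite jk j0k /= oj /= Lj Lj1 in dj0 dj1.
case: ifPn => oq.
  have [q' qE] : exists q', q'.+1 = nat_of_ord q by exists q.-1; case: (nat_of_ord q) oq.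
  have q'n : (q' < n)%N by rewrite ltnW // qE.
  have q'k : (q' < k.*2)%N by rewrite ltnW // qE.
  have := divided_pred oq; rewrite dq -qE /= => dq'.
  have oq' : odd q' = false by move: oq; rewrite -qE /= => /negPf.
  have qn := ltn_ord q; rewrite -qE in qn dq qk oq *.
  rewrite /= in dq' oq' *; rewrite !coord_blowdown // dq dq' /= oq' /= dj0 dj1.
  rewrite !std_comb_coord // qk q'k /= oq' /= /lift_coef dq dq' /= oq' /= addn0 addn1.
  by ring.
have q1k : (q.+1 < k.*2)%N.
  have := qk; rewrite -!ltn_half_double /=; rewrite uphalf_half (negPf oq) //.
have q1n : (q.+1 < n)%N by exact: leq_trans kn.
have := divided_succ oq; rewrite dq => dq'.
rewrite !coord_blowdown // dq dq' /= (negPf oq) /= dj0 dj1.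
rewrite !std_comb_coord // qk q1k /= (negPf oq) /= /lift_coef dq dq' /= (negPf oq) /= addn0 addn1.
by ring.
Qed.

Definition lifted_std (m : nat) (y : Mt) (f : Mt -> R) : R :=
  std_comb d k (lift_coef (fun q => (q == m)%:R)) y f.

Lemma std_comb_unit (m : 'I_n) (q : M) g : std_comb c k (fun r => (r == m)%:R) q g = std c k m q g.
Proof.
rewrite /std_comb (bigD1 m) //= eqxx mul1r big1 ?addr0 // => i /negPf im.
by rewrite -[(_ == _ :> nat)]/(i == m) im mul0r.
Qed.

Lemma lifted_std_related (m : 'I_n) y g : cdom d y -> smooth g (p y) ->
  lifted_std m y (g \o p) = std c k m (p y) g.
Proof. by move=> dy sg; rewrite /lifted_std lift_comb // std_comb_unit. Qed.

Lemma lifted_std_sum (a : nat -> R) y f :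
  std_comb d k (lift_coef a) y f = \sum_(m < n) a m * lifted_std m y f.
Proof.
rewrite /lifted_std /std_comb.
under [RHS]eq_bigr => m _ do rewrite mulr_sumr.
rewrite exchange_big; apply: eq_bigr => q _ /=.
under eq_bigr => m _ do rewrite mulrA.
rewrite -mulr_suml; congr (_ * _).
have pick (r : nat) : (r < n)%N -> \sum_(m < n) a m * (r == m)%:R = a r.
  move=> rn; rewrite (bigD1 (Ordinal rn)) //= eqxx mulr1 big1 ?addr0 // => i ir.
  by rewrite eq_sym -[r]/(nat_of_ord (Ordinal rn)) -[(_ == _ :> nat)]/(i == Ordinal rn) (negPf ir) mulr0.
rewrite /lift_coef -(pick q) //; case: (boolP (divided l' j q)) => dq; last first.
  by rewrite mul0r subr0; apply: eq_bigr => m _; rewrite mul0r subr0.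
have [_ jk _] := divided_lt dq.
have jn : (j.*2 + odd q < n)%N.
  by apply: leq_ltn_trans (leq_trans jk kn); rewrite -addn1 leq_add2l; case: odd.
rewrite -(pick (j.*2 + odd q)%N) // mul1r -sumrB; apply: eq_bigr => m _.
by rewrite mul1r mulrBr.
Qed.

Lemma vector_field_lifted_std m x : cdom d x -> vector_field (lifted_std m) x.
Proof.
move=> dx; apply: (@vector_field_lin R n Mt x 'I_n (fun q _ => lift_coef (fun q => (q == m)%:R) q)
  (fun q => std d k q)) => q; first exact: mfd_smooth_cst.
exact: vector_field_std.
Qed.

Let ecd : elliptic_coordinates (lifted_ideal l I IY p) d k.
Proof. exact: lifted_elliptic_coordinates bd. Qed.

Hypothesis idI : ideal_sheaf (@smooth R n M) I.
Hypothesis idIt : ideal_sheaf (@smooth R n Mt) (lifted_ideal l I IY p).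

Lemma preserves_lifted_std m x : cdom d x -> preserves (lifted_ideal l I IY p) (lifted_std m) x.
Proof.
move=> dx; apply: (@preserves_lin R n Mt _ idIt x 'I_n
  (fun q _ => lift_coef (fun q => (q == m)%:R) q) (fun q => std d k q)) => q.
  exact: mfd_smooth_cst.
apply: (elliptic_field_preserves idIt ecd dx); first exact: vector_field_std.
exact: elliptic_field_std.
Qed.

Lemma preserves_std m x : cdom d x -> preserves I (std c k m) (p x).
Proof.
move=> /dE[cx _]; apply: (elliptic_field_preserves idI ec cx); first exact: vector_field_std.
exact: elliptic_field_std.
Qed.

Lemma preserves_std_sum X x : cdom d x -> vector_field X (p x) -> preserves I X (p x) ->
  exists a : 'I_n -> M -> R, (forall m, smooth (a m) (p x)) /\
    \forall q \near p x, forall g, smooth g q -> X q g = \sum_m a m q * std c k m q g.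
Proof.
move=> /dE[cx _] vX pX.
have [b [sb E]] := elliptic_field_comb cc kn cx vX (preserves_elliptic_field ec cx vX pX).
by exists (fun m => b m).
Qed.

(** The field is a combination of the standard frame in the chart d; [unlift_coef] converts its
    coefficients to the lifted frame. *)
Lemma preserves_lifted_std_sum Z x : cdom d x -> vector_field Z x ->
  preserves (lifted_ideal l I IY p) Z x ->
  exists a : 'I_n -> Mt -> R, (forall m, smooth (a m) x) /\
    \forall y \near x, forall f, smooth f y -> Z y f = \sum_m a m y * lifted_std m y f.
Proof.
move=> dx vZ pZ.
have [b [sb E]] := elliptic_field_comb cd kn dx vZ (preserves_elliptic_field ecd dx vZ pZ).
exists (fun m y => unlift_coef (fun q => b q y) m); split.
  move=> m; apply: mfd_smoothD => //; apply: mfd_smoothM => //; exact: mfd_smooth_cst.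
apply: near_imp E => y Ey f sf; rewrite Ey // -lifted_std_sum.
by apply: eq_bigr => q _; rewrite unlift_coefK.
Qed.

(** The standard fields degenerate on D, so they are independent only generically: in each plane the
    complex coefficient times z_i is zero, hence the coefficient times the generator is, and the
    generator cancels among smooth germs. *)
Lemma std_independent (b : 'I_n -> Mt -> R) x : cdom d x -> (forall m, smooth (b m) x) ->
  (\forall y \near x, forall g, smooth g (p y) -> \sum_m b m y * std c k m (p y) g = 0) ->
  \forall y \near x, forall m, b m y = 0.
Proof.
move=> dx sb E; apply: near_all => m.
apply: (cancel_rsq_prod (k := k) cd dx kn (sb m)).
have sF : smooth (fun y => b m y * rsq_prod d k y) x.
  by apply: mfd_smoothM => //; exact: smooth_rsq_prod.
apply: (cancel_exceptional (m := l.-1) bd dx sF).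
have := near_and E (cdom_near cd dx); apply: near_imp => y [Ey dy].
have [cy _] := dE dy.
rewrite -mulrA [rsq_prod d k y * _]mulrC -(rsq_prod_blowdown bd dy).
pose B q := oapp (fun i : 'I_n => b i y) 0 (insub q).
have BE (i : 'I_n) : B i = b i y by rewrite /B valK.
have {}Ey q : (q < n)%N -> std_comb c k B (p y) (fun z => coord (cmap c z) q) = 0.
  move=> qn; rewrite -(Ey (fun z => coord (cmap c z) q)); last exact: smooth_cmap_coord.
  by apply: eq_bigr => i _; rewrite BE.
rewrite -BE; have mn := ltn_ord m; have := Ey m mn; rewrite std_comb_coord //.
case: ifPn => [mk|_ ->]; last by rewrite mul0r.
have hk : (m./2 < k)%N by rewrite ltn_half_double.
suff H : B m * rsq (cmap c (p y)) m./2 = 0.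
  by move=> _; rewrite /rsq_prod (bigD1 (Ordinal hk)) //= mulrA H mul0r.
have i1k : ((nat_of_ord m)./2.*2.+1 < k.*2)%N by rewrite -doubleS leq_double.
have i1n := leq_trans i1k kn; have i0n := ltnW i1n; have i0k := ltnW i1k.
have := odd_double_half m; have := Ey _ i0n; have := Ey _ i1n.
rewrite !std_comb_coord // i0k i1k /= odd_double /= /rsq.
move=> E1 E0; have := complex_mul_eq0 E1 E0 (odd m).
by case: (odd m); rewrite ?add1n ?add0n => <- mE; rewrite mE.
Qed.

(* [p] is a local diffeomorphism away from the exceptional locus, which has dense
   complement. *)
Lemma related0 Z x : cdom d x -> vector_field Z x ->
  (\forall y \near x, forall g, smooth g (p y) -> Z y (g \o p) = 0) ->
  \forall y \near x, forall f, smooth f y -> Z y f = 0.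
Proof.
move=> dx vZ E.
have E0 : \forall y \near x, forall q, (q < n)%N -> ~~ divided l' j q ->
    Z y (fun z => coord (cmap d z) q) = 0.
  have := near_and E (near_and vZ (cdom_near cd dx)); apply: near_imp => y [Ey [[tZ _] dy]] q qn nq.
  have [cy _] := dE dy.
  have := Ey _ (smooth_cmap_coord q cc cy); rewrite -[Z y _]/(Z y (fun z => coord (cmap c (p z)) q)).
  by rewrite (tangent_blowdown dy tZ qn) /= (negPf nq).
suff H : \forall y \near x, forall q : 'I_n, Z y (fun z => coord (cmap d z) q) = 0.
  have := near_and H (near_and vZ (cdom_near cd dx)); apply: near_imp => y [Hy [[tZ _] dy]] f sf.
  by apply: (tangent_eq_coord cd dy tZ (tangent0 y)) => // q; rewrite coord_cmap.
apply: near_all => q; have [dq|nq] := boolP (divided l' j q); last first.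
  by apply: near_imp E0 => y; apply.
have sF : smooth (fun y => Z y (fun z => coord (cmap d z) q)) x.
  by apply: vector_field_smooth => //; exact: smooth_cmap_coord.
apply: (cancel_exceptional (m := 1) bd dx sF).
have := near_and (near_and E E0) (near_and vZ (cdom_near cd dx)).
apply: near_imp => y [[Ey E0y] [[tZ _] dy]]; have [cy _] := dE dy.
have [qk jk _] := divided_lt dq.
have l0 : (l' == 0%N) = false.
  by apply/negbTE; move: dq => /andP[+ _]; rewrite -lt0n => /(leq_ltn_trans _) ->.
have i1k : ((nat_of_ord q)./2.*2.+1 < k.*2)%N by rewrite -doubleS leq_double ltn_half_double.
have i1n := leq_trans i1k kn; have i0n := ltnW i1n.
have j1n := leq_trans jk kn; have j0n := ltnW j1n.
(* As Z kills the undivided w_j, applying it to z_i = w_i w_j leaves w_j * Z w_i = 0. *)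
have D0 : Z y (fun z => coord (cmap d z) j.*2) = 0.
  by apply: E0y => //; have := undivided_j false; rewrite addn0 => ->.
have D1 : Z y (fun z => coord (cmap d z) j.*2.+1) = 0.
  by apply: E0y => //; have := undivided_j true; rewrite addn1 => ->.
have d0 : divided l' j (nat_of_ord q)./2.*2 by move: dq; rewrite /divided doubleK.
have d1 : divided l' j (nat_of_ord q)./2.*2.+1 by move: dq; rewrite /divided /= uphalf_double.
have C q' : Z y (fun z => coord (cmap c (p z)) q') = 0 by exact: (Ey _ (smooth_cmap_coord q' cc cy)).
have := C (nat_of_ord q)./2.*2; have := C (nat_of_ord q)./2.*2.+1.
rewrite (tangent_blowdown dy tZ i1n) (tangent_blowdown dy tZ i0n) /= d0 d1 odd_double /=.
rewrite D0 D1 !mulr0 !addr0 /exceptional l0 expr1 -rsq_normsq /rsq.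
move=> C1 C0; have := complex_mul_eq0 C1 C0 (odd q).
have := odd_double_half q.
by case: (odd q); rewrite ?add1n ?add0n => qE; rewrite qE.
Qed.

End LiftedFrame.

(** * Lie algebroids from injective anchors *)

Section Commutators.
Variables (R : realType) (n : nat) (M : manifold R n).
Implicit Types (X Y : M -> (M -> R) -> R) (x y : M) (f g a : M -> R).

Lemma commutator_congr X X' Y Y' x f : vector_field X x -> vector_field Y x -> smooth f x ->
  (\forall y \near x, forall g, smooth g y -> X y g = X' y g) ->
  (\forall y \near x, forall g, smooth g y -> Y y g = Y' y g) ->
  commutator X Y x f = commutator X' Y' x f.
Proof.
move=> vX vY sf EX EY; rewrite /commutator.
have sX := vector_field_smooth vX sf; have sY := vector_field_smooth vY sf.
have FX : \forall y \near x, X y f = X' y f.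
  by have := near_and EX (mfd_smooth_near sf); apply: near_imp => y [E /E].
have FY : \forall y \near x, Y y f = Y' y f.
  by have := near_and EY (mfd_smooth_near sf); apply: near_imp => y [E /E].
rewrite (tangent_congr (vector_field_tangent vX) sY FY).
rewrite (tangent_congr (vector_field_tangent vY) sX FX).
rewrite (nbhs_singleton EX); last by apply: mfd_smooth_congr sY.
by rewrite (nbhs_singleton EY) //; apply: mfd_smooth_congr sX.
Qed.

Lemma commutator_anti X Y x f : commutator X Y x f = - commutator Y X x f.
Proof. by rewrite /commutator opprB. Qed.

Lemma commutator_suml (J : finType) (a : J -> M -> R) (X : J -> M -> (M -> R) -> R) Y x f :
  (forall j, smooth (a j) x) -> (forall j, vector_field (X j) x) -> vector_field Y x ->
  smooth f x ->
  commutator (fun y g => \sum_j a j y * X j y g) Y x f =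
  \sum_j a j x * commutator (X j) Y x f - \sum_j Y x (a j) * X j x f.
Proof.
move=> sa vX vY sf; rewrite /commutator.
have tY := vector_field_tangent vY.
have sX j : smooth (fun y => X j y f) x by exact: vector_field_smooth.
rewrite (tangent_sum tY); last by move=> j _; exact: mfd_smoothM.
rewrite -!sumrB; apply: eq_bigr => j _; rewrite (tangentM tY) //; ring.
Qed.

Lemma commutator_sumr (J : finType) (a : J -> M -> R) X (Y : J -> M -> (M -> R) -> R) x f :
  (forall j, smooth (a j) x) -> vector_field X x -> (forall j, vector_field (Y j) x) ->
  smooth f x ->
  commutator X (fun y g => \sum_j a j y * Y j y g) x f =
  \sum_j a j x * commutator X (Y j) x f + \sum_j X x (a j) * Y j x f.
Proof.
move=> sa vX vY sf; rewrite commutator_anti commutator_suml // opprB addrC; congr (_ + _).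
by rewrite -sumrN; apply: eq_bigr => j _; rewrite [in RHS]commutator_anti mulrN.
Qed.

End Commutators.

Section Sections.
Variables (R : realType) (n : nat) (M : manifold R n) (V : vector_bundle M).
Implicit Types (s t : forall y, V y) (x y : M).

Lemma section_congr s t x : section s x -> (\forall y \near x, s y = t y) -> section t x.
Proof.
have [e /nbhs_singleton[_ eP]] := local_frame V x.
move=> /eP[a [sa E]] st; apply/eP; exists a; split=> //.
by have := near_and E st; apply: near_imp => y [<- ->].
Qed.

Lemma near_section s x : section s x -> \forall y \near x, section s y.
Proof.
have [e eP] := local_frame V x; have [_ /(_ s)[+ _]] := nbhs_singleton eP.
move=> /[apply] -[a [sa E]].
have na : \forall y \near x, forall i, smooth (a i) y by apply: near_all => i; exact: mfd_smooth_near.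
have := near_and eP (near_and na (near_near E)); apply: near_imp => y [[_ ey] [ay Ey]].
by apply/ey; exists a.
Qed.

Lemma section_comb (a : M -> R) s t x : smooth a x -> section s x -> section t x ->
  section (fun y => a y *: s y + t y) x.
Proof.
have [e /nbhs_singleton[_ eP]] := local_frame V x.
move=> sa /eP[b [sb Eb]] /eP[b' [sb' Eb']]; apply/eP; exists (fun i y => a y * b i y + b' i y); split.
  by move=> i; apply: mfd_smoothD => //; exact: mfd_smoothM.
have := near_and Eb Eb'; apply: near_imp => y [-> ->].
rewrite scaler_sumr -big_split; apply: eq_bigr => i _ /=.
by rewrite scalerA scalerDl.
Qed.

Lemma section0 x : section (fun y => 0 : V y) x.
Proof.
have [e /nbhs_singleton[_ eP]] := local_frame V x.
apply/eP; exists (fun _ _ => 0); split; first by move=> i; exact: mfd_smooth_cst.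
by apply: near_true => y; rewrite big1 // => i _; rewrite scale0r.
Qed.

Lemma sectionD s t x : section s x -> section t x -> section (fun y => s y + t y) x.
Proof.
move=> ss st; apply: section_congr (section_comb (@mfd_smooth_cst R n M 1 x) ss st) _.
by apply: near_true => y; rewrite scale1r.
Qed.

Lemma sectionZ (a : M -> R) s x : smooth a x -> section s x -> section (fun y => a y *: s y) x.
Proof.
move=> sa ss; apply: section_congr (section_comb sa ss (section0 x)) _.
by apply: near_true => y; rewrite addr0.
Qed.

Lemma sectionN s x : section s x -> section (fun y => - s y) x.
Proof.
move=> ss; apply: section_congr (sectionZ (@mfd_smooth_cst R n M (-1) x) ss) _.
by apply: near_true => y; rewrite scaleN1r.
Qed.

Lemma section_sum (J : finType) (s : J -> forall y, V y) x : (forall j, section (s j) x) ->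
  section (fun y => \sum_j s j y) x.
Proof.
move=> ss; suff H (r : seq J) : section (fun y => \sum_(j <- r) s j y) x by exact: H.
elim: r => [|j r IH].
  by apply: section_congr (section0 x) _; apply: near_true => y; rewrite big_nil.
apply: section_congr (sectionD (ss j) IH) _.
by apply: near_true => y; rewrite big_cons.
Qed.

End Sections.

Section AnchoredBundle.
Variables (R : realType) (n : nat) (M : manifold R n) (V : vector_bundle M).
Variable anc : forall x, V x -> (M -> R) -> R.
Hypothesis ancT : forall x (v : V x), tangent x (anc v).
Hypothesis ancL : forall x (a : R) (v w : V x) f, smooth f x ->
  anc (a *: v + w) f = a * anc v f + anc w f.
Hypothesis ancS : forall s x, section s x -> vector_field (fun y => anc (s y)) x.
Hypothesis anc_inj : forall s x, section s x ->
  (\forall y \near x, forall f, smooth f y -> anc (s y) f = 0) -> \forall y \near x, s y = 0.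
Hypothesis anc_inv : forall s t x, section s x -> section t x -> exists2 r, section r x &
  \forall y \near x, forall f, smooth f y ->
    anc (r y) f = commutator (fun y => anc (s y)) (fun y => anc (t y)) y f.
Implicit Types (s t r : forall y, V y) (x y : M).

Local Notation field s := (fun y => anc (s y)).

Lemma anc0 x f : smooth f x -> anc (0 : V x) f = 0.
Proof.
move=> sf; have := ancL 1 (0 : V x) 0 sf; rewrite scale1r addr0 mul1r => /eqP.
by rewrite -subr_eq0 opprD addrA subrr add0r oppr_eq0 => /eqP.
Qed.

Lemma ancD x (v w : V x) f : smooth f x -> anc (v + w) f = anc v f + anc w f.
Proof. by move=> sf; rewrite -[v]scale1r ancL // mul1r scale1r. Qed.

Lemma ancZ x a (v : V x) f : smooth f x -> anc (a *: v) f = a * anc v f.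
Proof. by move=> sf; rewrite -[a *: v]addr0 ancL // anc0 // addr0. Qed.

Lemma ancN x (v : V x) f : smooth f x -> anc (- v) f = - anc v f.
Proof. by move=> sf; rewrite -scaleN1r ancZ // mulN1r. Qed.

Lemma anc_sum x (J : finType) (a : J -> R) (v : J -> V x) f : smooth f x ->
  anc (\sum_j a j *: v j) f = \sum_j a j * anc (v j) f.
Proof.
move=> sf; elim/big_ind2 : _ => [|v1 w1 v2 w2 <- <-|j _]; first exact: anc0.
  exact: ancD.
exact: ancZ.
Qed.

Lemma anc_eq s t x : section s x -> section t x ->
  (\forall y \near x, forall f, smooth f y -> anc (s y) f = anc (t y) f) ->
  \forall y \near x, s y = t y.
Proof.
move=> ss st E; have sN := section_comb (@mfd_smooth_cst R n M (-1) x) st ss.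
suff : \forall y \near x, -1 *: t y + s y = 0.
  by apply: near_imp => y /eqP; rewrite scaleN1r addrC subr_eq0 => /eqP.
apply: (anc_inj sN); apply: near_imp E => y Ey f sf.
by rewrite ancL // Ey // mulN1r addrC subrr.
Qed.

Lemma near_anc_smooth s x f : section s x -> smooth f x -> smooth (fun y => anc (s y) f) x.
Proof. by move=> ss sf; exact: (vector_field_smooth (ancS ss) sf). Qed.

Let bracket_value s t x (v : V x) : Prop := exists r, [/\ section s x, section t x, section r x, r x = v &
  \forall y \near x, forall f, smooth f y -> anc (r y) f = commutator (field s) (field t) y f].

(** The bracket is forced: its value at x is that of any section whose anchor is the commutator near
    x, and [anc_inj] makes the choice irrelevant. The default 0 is for arguments that are not smooth
    sections near x. *)
Definition anchored_bracket s t x : V x :=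
  if pselect (exists v : V x, bracket_value s t v) is left h then projT1 (cid h) else 0.

(** Criterion for bracket identities: exhibit the expected value as a smooth section and compare
    anchors. *)
Lemma anchored_bracket_eq s t r x : section s x -> section t x -> section r x ->
  (\forall y \near x, forall f, smooth f y -> anc (r y) f = commutator (field s) (field t) y f) ->
  anchored_bracket s t x = r x.
Proof.
move=> ss st sr E; rewrite /anchored_bracket; case: pselect => [h|nh]; last first.
  by exfalso; apply: nh; exists (r x), r; split.
case: (cid h) => v [r' [_ _ sr' rv E']] /=; rewrite -rv.
suff H : \forall y \near x, r' y = r y by exact: (nbhs_singleton H).
apply: (anc_eq sr' sr).
by have := near_and E E'; apply: near_imp => y [Ey E'y] f sf; rewrite Ey // E'y.
Qed.

Lemma anchored_bracketP s t x : section s x -> section t x ->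
  section (anchored_bracket s t) x /\ \forall y \near x, forall f, smooth f y ->
    anc (anchored_bracket s t y) f = commutator (field s) (field t) y f.
Proof.
move=> ss st; have [r sr rE] := anc_inv ss st.
have E : \forall y \near x, r y = anchored_bracket s t y.
  have := near_and (near_and (near_section ss) (near_section st)) (near_and (near_section sr) (near_near rE)).
  by apply: near_imp => y [[ssy sty] [sry Ey]]; rewrite (anchored_bracket_eq ssy sty sry Ey).
split; first exact: section_congr sr E.
by have := near_and E rE; apply: near_imp => y [<-].
Qed.

Lemma anchored_bracket_section s t x : section s x -> section t x ->
  section (anchored_bracket s t) x.
Proof. by move=> ss /(anchored_bracketP ss)[]. Qed.

Lemma anc_anchored_bracket s t x f : section s x -> section t x -> smooth f x ->
  anc (anchored_bracket s t x) f = commutator (field s) (field t) x f.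
Proof. by move=> ss st sf; have [_ /nbhs_singleton ->] := anchored_bracketP ss st. Qed.

(* As the anchor is injective on sections, this and the following identities
   only need to be checked for the commutators of the anchors. *)
Lemma anchored_bracket_local s s' t x : section s x -> section t x ->
  (\forall y \near x, s y = s' y) -> anchored_bracket s t x = anchored_bracket s' t x.
Proof.
move=> ss st E; have [sr rE] := anchored_bracketP ss st.
apply/esym/anchored_bracket_eq => //; first exact: section_congr ss E.
have := near_and rE (near_and (near_near E) (near_and (near_section ss) (near_section st))).
apply: near_imp => y [Ey [ssy [s1 s2]]] f sf; rewrite Ey //.
apply: commutator_congr => //; try exact: ancS.
  by apply: near_imp ssy => z ->.
exact: near_true.
Qed.

Lemma anchored_bracket_anti s t x : section s x -> section t x ->
  anchored_bracket s t x = - anchored_bracket t s x.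
Proof.
move=> ss st; have [sr rE] := anchored_bracketP st ss.
have E (y : M) : -1 *: anchored_bracket t s y = - anchored_bracket t s y by rewrite scaleN1r.
rewrite -E; apply: (anchored_bracket_eq (r := fun y => -1 *: anchored_bracket t s y)) => //.
  by apply: sectionZ => //; exact: mfd_smooth_cst.
by apply: near_imp rE => y Ey f sf; rewrite ancZ // Ey // mulN1r -commutator_anti.
Qed.

Lemma anchored_bracket_add s s' t x : section s x -> section s' x -> section t x ->
  anchored_bracket (fun y => s y + s' y) t x = anchored_bracket s t x + anchored_bracket s' t x.
Proof.
move=> ss ss' st; have [sr rE] := anchored_bracketP ss st; have [sr' rE'] := anchored_bracketP ss' st.
apply: (anchored_bracket_eq (r := fun y => anchored_bracket s t y + anchored_bracket s' t y)) => //.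
- exact: sectionD.
- exact: sectionD.
have := near_and (near_and rE rE') (near_and (near_section ss) (near_and (near_section ss') (near_section st))).
apply: near_imp => y [[Ey E'y] [ssy [ss'y sty]]] f sf; rewrite ancD // Ey // E'y // /commutator.
have sa := near_anc_smooth ssy sf; have sa' := near_anc_smooth ss'y sf.
have sf' := near_anc_smooth sty sf.
have E : \forall z \near y, anc (s z) f + anc (s' z) f = anc (s z + s' z) f.
  by apply: near_imp (mfd_smooth_near sf) => z sfz; rewrite ancD.
rewrite ancD // -(tangent_congr (ancT _) (mfd_smoothD sa sa') E) (tangentD (ancT _)) //.
by ring.
Qed.

Lemma anchored_bracket_leibniz (f : M -> R) s t x : smooth f x -> section s x -> section t x ->
  anchored_bracket s (fun y => f y *: t y) x =
  f x *: anchored_bracket s t x + anc (s x) f *: t x.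
Proof.
move=> sf ss st; have [sr rE] := anchored_bracketP ss st.
apply: (anchored_bracket_eq (r := fun y => f y *: anchored_bracket s t y + anc (s y) f *: t y)) => //.
- exact: sectionZ.
- apply: section_comb => //; apply: sectionZ => //; exact: near_anc_smooth.
have := near_and (near_and rE (mfd_smooth_near sf)) (near_and (near_section ss) (near_section st)).
apply: near_imp => y [[Ey sfy] [ssy sty]] g sg; rewrite ancL // ancZ // Ey // /commutator.
have sa := near_anc_smooth ssy sg; have sb := near_anc_smooth sty sg.
have E : \forall z \near y, f z * anc (t z) g = anc (f z *: t z) g.
  by apply: near_imp (mfd_smooth_near sg) => z sgz; rewrite ancZ.
rewrite ancZ // -(tangent_congr (ancT _) (mfd_smoothM sfy sb) E) (tangentM (ancT _)) //.
by ring.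
Qed.

Lemma anc_double_bracket s t u y f : section s y -> section t y -> section u y -> smooth f y ->
  anc (anchored_bracket s (anchored_bracket t u) y) f =
  anc (s y) (fun z => anc (t z) (fun w => anc (u w) f)) -
  anc (s y) (fun z => anc (u z) (fun w => anc (t w) f)) -
  (anc (t y) (fun z => anc (u z) (fun w => anc (s w) f)) -
   anc (u y) (fun z => anc (t z) (fun w => anc (s w) f))).
Proof.
move=> ss st su sf; have sr := anchored_bracket_section st su.
rewrite (anc_anchored_bracket ss sr sf) /commutator (anc_anchored_bracket st su); last exact: near_anc_smooth.
congr (_ - _); have st' := near_anc_smooth st sf; have su' := near_anc_smooth su sf.
rewrite -(tangentB (ancT _)); [|exact: near_anc_smooth|exact: near_anc_smooth].
apply: (tangent_congr (ancT _)); first exact: near_anc_smooth.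
have := near_and (mfd_smooth_near sf) (near_and (near_section st) (near_section su)).
by apply: near_imp => z [sfz [stz suz]]; rewrite anc_anchored_bracket.
Qed.

Lemma anchored_bracket_jacobi s t u x : section s x -> section t x -> section u x ->
  anchored_bracket s (anchored_bracket t u) x + anchored_bracket t (anchored_bracket u s) x
    + anchored_bracket u (anchored_bracket s t) x = 0.
Proof.
move=> ss st su; have B := anchored_bracket_section.
have sJ := sectionD (sectionD (B _ _ _ ss (B _ _ _ st su)) (B _ _ _ st (B _ _ _ su ss)))
  (B _ _ _ su (B _ _ _ ss st)).
suff H : \forall y \near x, forall f, smooth f y -> anc (anchored_bracket s (anchored_bracket t u) y
    + anchored_bracket t (anchored_bracket u s) y + anchored_bracket u (anchored_bracket s t) y) f = 0.
  exact: (nbhs_singleton (anc_inj sJ H)).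
have := near_and (near_section ss) (near_and (near_section st) (near_section su)).
apply: near_imp => y [ssy [sty suy]] f sf.
(* Each double bracket expands into four triple compositions, and the twelve terms cancel in
   pairs. *)
rewrite !ancD // !anc_double_bracket //; ring.
Qed.

Definition anchored_algebroid : lie_algebroid M :=
  @LieAlgebroid R n M V anc anchored_bracket ancT ancL ancS anchored_bracket_section
    anchored_bracket_local anchored_bracket_anti anchored_bracket_add anchored_bracket_jacobi
    anchored_bracket_leibniz anc_anchored_bracket.

End AnchoredBundle.

(** * The pulled back algebroid *)

Section LiftedAlgebroid.
Variables (R : realType) (n : nat) (M Mt : manifold R n) (p : Mt -> M).
Variables (I : M -> set (M -> R)) (It : Mt -> set (Mt -> R)).

Definition related_near (X : M -> (M -> R) -> R) (Z : Mt -> (Mt -> R) -> R) (x : Mt) : Prop :=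
  \forall y \near x, forall g, smooth g (p y) -> Z y (g \o p) = X (p y) g.

(** All that the construction of the algebroid uses about the blow-up, free of charts. Generation
    gives existence of lifts and surjectivity of the anchor; independence along p gives its
    injectivity; the last clause, uniqueness of lifts, makes it well defined. *)
Definition lifting_frame (x : Mt) (F : 'I_n -> M -> (M -> R) -> R)
    (Ft : 'I_n -> Mt -> (Mt -> R) -> R) : Prop :=
  [/\ forall m, [/\ vector_field (F m) (p x), preserves I (F m) (p x), vector_field (Ft m) x,
        preserves It (Ft m) x & related_near (F m) (Ft m) x],
      forall X, vector_field X (p x) -> preserves I X (p x) ->
        exists a : 'I_n -> M -> R, (forall m, smooth (a m) (p x)) /\
        \forall q \near p x, forall g, smooth g q -> X q g = \sum_m a m q * F m q g,
      forall Z, vector_field Z x -> preserves It Z x ->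
        exists a : 'I_n -> Mt -> R, (forall m, smooth (a m) x) /\
        \forall y \near x, forall f, smooth f y -> Z y f = \sum_m a m y * Ft m y f,
      forall b : 'I_n -> Mt -> R, (forall m, smooth (b m) x) ->
        (\forall y \near x, forall g, smooth g (p y) -> \sum_m b m y * F m (p y) g = 0) ->
        \forall y \near x, forall m, b m y = 0 &
      forall Z, vector_field Z x -> related_near (fun _ _ => 0) Z x ->
        \forall y \near x, forall f, smooth f y -> Z y f = 0].

Hypothesis sp : smooth_map p.
Hypothesis idI : ideal_sheaf (@smooth R n M) I.
Hypothesis idIt : ideal_sheaf (@smooth R n Mt) It.
Hypothesis frames : forall x, exists F Ft, lifting_frame x F Ft.

Let near_p x (P : M -> Prop) : (\forall q \near p x, P q) -> \forall y \near x, P (p y).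
Proof. exact: (sp x).1. Qed.

(** Expand X in the frame F and use its coefficients, composed with p, in the frame Ft. *)
Lemma lift_exists X x : vector_field X (p x) -> preserves I X (p x) ->
  exists Z, [/\ vector_field Z x, preserves It Z x & related_near X Z x].
Proof.
move=> vX pX; have [F [Ft [FP gF _ _ _]]] := frames x.
have [a [sa E]] := gF X vX pX; exists (fun y f => \sum_m a m (p y) * Ft m y f).
have sap m : smooth (fun y => a m (p y)) x by exact: smooth_map_comp.
split.
- by apply: (@vector_field_lin R n Mt x 'I_n (fun m y => a m (p y))) => // m; have [] := FP m.
- by apply: (@preserves_lin R n Mt It idIt x 'I_n (fun m y => a m (p y))) => // m; have [] := FP m.
have rF : \forall y \near x, forall m g, smooth g (p y) -> Ft m y (g \o p) = F m (p y) g.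
  by apply: near_all => m; have [] := FP m.
have := near_and (near_p E) rF; apply: near_imp => y [Ey ry] g sg.
by rewrite Ey //; apply: eq_bigr => m _; rewrite ry.
Qed.

Variable A : lie_algebroid M.
Hypothesis EA : elliptic_tangent_bundle I A.
Implicit Types (x y : Mt) (t : forall q, A q).

(** Has the shape of [decomposition], so that the corresponding clause of a morphism holds by
    definition when the fibre maps are identities. *)
Definition pullback_section (s : forall x, A (p x)) (x : Mt) : Prop :=
  exists (r : nat) (a : 'I_r -> Mt -> R) (t : 'I_r -> forall q, A q),
  [/\ forall i, smooth (a i) x, forall i, section (t i) (p x) &
      \forall y \near x, s y = \sum_i a i y *: t i (p y)].

Lemma frame_section (q : M) (e : 'I_(rank A) -> forall q, A q) :
  (forall s, section s q <-> exists a : 'I_(rank A) -> M -> R, (forall i, smooth (a i) q) /\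
     \forall z \near q, s z = \sum_i a i z *: e i z) -> forall i, section (e i) q.
Proof.
move=> eP i; apply/eP; exists (fun m _ => (m == i)%:R); split.
  by move=> m; exact: mfd_smooth_cst.
apply: near_true => z; rewrite (bigD1 i) //= eqxx scale1r big1 ?addr0 // => m /negPf ->.
by rewrite scale0r.
Qed.

Lemma pullback_frame x : exists e : 'I_(rank A) -> forall y, A (p y),
  \forall y \near x,
    (forall v : A (p y), exists! a : 'I_(rank A) -> R, v = \sum_i a i *: e i y) /\
    (forall s, pullback_section s y <->
       exists a : 'I_(rank A) -> Mt -> R, (forall i, smooth (a i) y) /\
         \forall z \near y, s z = \sum_i a i z *: e i z).
Proof.
have [e eP] := local_frame A (p x); exists (fun i y => e i (p y)).
apply: near_imp (near_p eP) => y [bas eS]; split=> // s; split; last first.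
  move=> [a [sa E]]; exists (rank A), a, e; split=> //; exact: frame_section.
move=> [r [a [t [sa st E]]]].
have /choice[b bP] (i : 'I_r) : exists b : 'I_(rank A) -> M -> R, (forall m, smooth (b m) (p y)) /\
    \forall z \near p y, t i z = \sum_m b m z *: e m z by exact/eS.
exists (fun m z => \sum_i a i z * b i m (p z)); split.
  move=> m; apply: mfd_smooth_sum => i _; apply: mfd_smoothM => //.
  by apply: smooth_map_comp => //; exact: (bP i).1.
have H : \forall z \near y, forall i, t i (p z) = \sum_m b i m (p z) *: e m (p z).
  by apply: near_all => i; apply: (near_p (bP i).2).
have := near_and E H; apply: near_imp => z [-> Hz].
under eq_bigr => i _ do rewrite Hz scaler_sumr.
rewrite exchange_big; apply: eq_bigr => m _ /=; rewrite scaler_suml.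
by apply: eq_bigr => i _; rewrite scalerA.
Qed.

Definition pullback_bundle : vector_bundle Mt :=
  @VectorBundle R n Mt (fun x => A (p x)) (rank A) pullback_section pullback_frame.

Let anchor_sum q (J : finType) (a : J -> R) (v : J -> A q) f : smooth f q ->
  anchor (\sum_j a j *: v j) f = \sum_j a j * anchor (v j) f.
Proof. exact: (anc_sum (@anchor_linear _ _ _ A)). Qed.

Let anchor_lift t x : section t (p x) -> exists Z,
  [/\ vector_field Z x, preserves It Z x & related_near (fun q => anchor (t q)) Z x].
Proof. by move=> st; have [pA _ _] := EA; apply: lift_exists; [exact: anchor_smooth|exact: pA]. Qed.

Let section_through q (v : A q) : exists2 t, section t q & t q = v.
Proof.
have [e /nbhs_singleton[bas eS]] := local_frame A q.
have [a [aE _]] := bas v; exists (fun z => \sum_i a i *: e i z); last exact: esym.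
apply: section_sum => i; apply: sectionZ; first exact: mfd_smooth_cst.
exact: (frame_section eS i).
Qed.

Let lift_through x (v : A (p x)) : exists Z t,
  [/\ section t (p x), t (p x) = v, vector_field Z x & related_near (fun q => anchor (t q)) Z x].
Proof.
have [t st tv] := section_through v; have [Z [vZ _ rZ]] := anchor_lift st.
by exists Z, t.
Qed.

(** The vector cannot simply be lifted through dp, which need not be injective on the exceptional
    locus: a local section of A through it is lifted instead, and the lift is evaluated at x. *)
Definition pullback_anchor x (v : A (p x)) : (Mt -> R) -> R := projT1 (cid (lift_through v)) x.

(** Independence of the choices. The difference of two sections through the same vector is sum a_i
    e_i in a local frame, with a_i zero at p x. Its lift sum (a_i \o p) E_i vanishes at x, and by
    uniqueness of lifts it is the difference of the two chosen lifts. *)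
Lemma pullback_anchorE x t Z f : section t (p x) -> vector_field Z x ->
  related_near (fun q => anchor (t q)) Z x -> smooth f x ->
  pullback_anchor (t (p x)) f = Z x f.
Proof.
move=> st vZ rZ sf; rewrite /pullback_anchor; case: (cid _) => Z' [t' [st' tt' vZ' rZ']] /=.
have [F [Ft [_ _ _ _ rel0]]] := frames x.
have [e /nbhs_singleton[bas eS]] := local_frame A (p x).
have [a [sa aE]] : exists a : 'I_(rank A) -> M -> R, (forall i, smooth (a i) (p x)) /\
    \forall q \near p x, -1 *: t q + t' q = \sum_i a i q *: e i q.
  by apply/eS; apply: section_comb => //; exact: mfd_smooth_cst.
have a0 i : a i (p x) = 0.
  have [b [_ bU]] := bas 0; have E1 : b = fun i => a i (p x).
    by apply: bU; rewrite -(nbhs_singleton aE) tt' scaleN1r addrC subrr.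
  have E2 : b = fun=> 0 by apply: bU; rewrite big1 // => m _; rewrite scale0r.
  by have := congr1 (fun g => g i) E1; rewrite E2.
have /choice[E EP] i := anchor_lift (frame_section eS i).
(* Related to the zero field, hence zero near x. *)
pose W y g := -1 * (\sum_i a i (p y) * E i y g) + (-1 * Z y g + Z' y g).
have sap i : smooth (fun y => a i (p y)) x by exact: smooth_map_comp.
have vS : vector_field (fun y g => \sum_i a i (p y) * E i y g) x.
  by apply: (@vector_field_lin R n Mt x _ (fun i y => a i (p y))) => // i; have [] := EP i.
have vW : vector_field W x.
  apply: (@vector_field_comb R n Mt (fun=> -1)) => //; first exact: mfd_smooth_cst.
  by apply: (@vector_field_comb R n Mt (fun=> -1)) => //; exact: mfd_smooth_cst.
have rW : related_near (fun _ _ => 0) W x.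
  have rE : \forall y \near x, forall i g, smooth g (p y) -> E i y (g \o p) = anchor (e i (p y)) g.
    by apply: near_all => i; have [] := EP i.
  have := near_and (near_p aE) (near_and rE (near_and rZ rZ')).
  apply: near_imp => y [ay [Ey [Zy Z'y]]] g sg; rewrite /W Zy // Z'y //.
  under eq_bigr => i _ do rewrite Ey //.
  by rewrite -anchor_sum // -ay anchor_linear //; ring.
have := nbhs_singleton (rel0 W vW rW) f sf; rewrite /W big1; last first.
  by move=> i _; rewrite a0 mul0r.
by rewrite mulr0 add0r mulN1r addrC => /eqP; rewrite subr_eq0 => /eqP.
Qed.

(** At a fixed y near x the coefficients are frozen to constants: the section with these constant
    coefficients passes through the given vector, and the same combination of the Z_i lifts it. So
    one neighbourhood serves all coefficients. *)
Lemma pullback_anchor_sum x r (t : 'I_r -> forall q, A q) (Z : 'I_r -> Mt -> (Mt -> R) -> R) :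
  (forall i, section (t i) (p x)) -> (forall i, vector_field (Z i) x) ->
  (forall i, related_near (fun q => anchor (t i q)) (Z i) x) ->
  \forall y \near x, forall (a : 'I_r -> R) f, smooth f y ->
    pullback_anchor (\sum_i a i *: t i (p y)) f = \sum_i a i * Z i y f.
Proof.
move=> st vZ rZ.
have N : \forall y \near x, forall i, [/\ section (t i) (p y), vector_field (Z i) y &
    related_near (fun q => anchor (t i q)) (Z i) y].
  apply: near_all => i.
  have := near_and (near_p (near_section (st i))) (near_and (near_vector_field (vZ i)) (near_near (rZ i))).
  by apply: near_imp => y [? [? ?]].
apply: near_imp N => y Ny a f sf.
apply: (@pullback_anchorE y (fun q => \sum_i a i *: t i q) (fun y f => \sum_i a i * Z i y f)) => //.
- apply: section_sum => i; apply: sectionZ; first exact: mfd_smooth_cst.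
  by have [] := Ny i.
- apply: (@vector_field_lin R n Mt y _ (fun i _ => a i)) => [i|i]; first exact: mfd_smooth_cst.
  by have [] := Ny i.
have rN : \forall z \near y, forall i g, smooth g (p z) -> Z i z (g \o p) = anchor (t i (p z)) g.
  by apply: near_all => i; have [] := Ny i.
apply: near_imp rN => z zN g sg; rewrite anchor_sum //.
by apply: eq_bigr => i _; rewrite zN.
Qed.

Lemma pullback_anchor_tangent x (v : A (p x)) : tangent x (pullback_anchor v).
Proof.
rewrite /pullback_anchor; case: (cid _) => Z [t [_ _ vZ _]] /=.
exact: vector_field_tangent.
Qed.

Lemma pullback_anchor_linear x (a : R) (v w : A (p x)) f : smooth f x ->
  pullback_anchor (a *: v + w) f = a * pullback_anchor v f + pullback_anchor w f.
Proof.
move=> sf; have [Z [t [st <- vZ rZ]]] := lift_through v.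
have [Z' [t' [st' <- vZ' rZ']]] := lift_through w.
rewrite (pullback_anchorE st vZ rZ sf) (pullback_anchorE st' vZ' rZ' sf).
apply: (@pullback_anchorE x (fun q => a *: t q + t' q) (fun y f => a * Z y f + Z' y f)) => //.
- by apply: section_comb => //; exact: mfd_smooth_cst.
- by apply: (@vector_field_comb R n Mt (fun=> a)) => //; exact: mfd_smooth_cst.
have := near_and rZ rZ'; apply: near_imp => y [Zy Z'y] g sg.
by rewrite anchor_linear // Zy // Z'y.
Qed.

Lemma pullback_anchor_related x (v : A (p x)) g : smooth g (p x) ->
  anchor v g = pullback_anchor v (g \o p).
Proof.
move=> sg; have [Z [t [st <- vZ rZ]]] := lift_through v.
rewrite (pullback_anchorE st vZ rZ) ?(nbhs_singleton rZ) //.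
exact: smooth_map_comp.
Qed.

Lemma pullback_section_field s x : pullback_section s x -> exists Z,
  [/\ vector_field Z x, preserves It Z x &
      \forall y \near x, forall f, smooth f y -> pullback_anchor (s y) f = Z y f].
Proof.
move=> [r [a [t [sa st E]]]]; have /choice[Z ZP] i := anchor_lift (st i).
exists (fun y f => \sum_i a i y * Z i y f); split.
- by apply: vector_field_lin => // i; have [] := ZP i.
- by apply: preserves_lin => // i; have [] := ZP i.
have := near_and E (pullback_anchor_sum st (fun i => let: And3 v _ _ := ZP i in v)
  (fun i => let: And3 _ _ r := ZP i in r)).
by apply: near_imp => y [-> Ey] f sf; rewrite Ey.
Qed.

Lemma pullback_anchor_smooth s x : pullback_section s x ->
  vector_field (fun y => pullback_anchor (s y)) x.
Proof.
move=> /pullback_section_field[Z [vZ _ E]]; apply: vector_field_congr vZ _.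
by apply: near_imp E => y Ey f sf; rewrite Ey.
Qed.

Lemma pullback_anchor_preserves s x : pullback_section s x ->
  preserves It (fun y => pullback_anchor (s y)) x.
Proof.
move=> /pullback_section_field[Z [_ pZ E]]; apply: (preserves_congr idIt) pZ.
by apply: near_imp E => y Ey f sf; rewrite Ey.
Qed.

(** Expand Z in the lifted frame; each F_m is the anchor of a section t_m of A, and the same
    coefficients applied to the t_m \o p give s. *)
Lemma pullback_anchor_surj Z x : vector_field Z x -> preserves It Z x ->
  exists2 s, pullback_section s x &
    \forall y \near x, forall f, smooth f y -> pullback_anchor (s y) f = Z y f.
Proof.
move=> vZ pZ; have [F [Ft [FP _ gFt _ _]]] := frames x; have [_ _ surjA] := EA.
have [a [sa E]] := gFt Z vZ pZ.
have /choice[t tP] m : exists t, section t (p x) /\ \forall q \near p x, forall g, smooth g q ->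
    anchor (t q) g = F m q g.
  by have [vF pF _ _ _] := FP m; have [t st tE] := surjA _ _ vF pF; exists t.
exists (fun y => \sum_m a m y *: t m (p y)).
  by exists n, a, t; split=> // [m|]; [exact: (tP m).1|exact: near_true].
have rF m : related_near (fun q => anchor (t m q)) (Ft m) x.
  have [_ _ _ _ r] := FP m; have := near_and r (near_p (tP m).2).
  by apply: near_imp => y [ry ty] g sg; rewrite ry // ty.
have vF m : vector_field (Ft m) x by have [] := FP m.
have := near_and E (pullback_anchor_sum (fun m => (tP m).1) vF rF).
by apply: near_imp => y [Ey Sy] f sf; rewrite Sy // Ey.
Qed.

(** Injectivity for A allows s to be written in the t_m \o p, where t_m has anchor F_m. Pushing the
    zero anchor forward gives a relation among the F_m along p, and independence kills its
    coefficients. *)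
Lemma pullback_anchor_inj s x : pullback_section s x ->
  (\forall y \near x, forall f, smooth f y -> pullback_anchor (s y) f = 0) ->
  \forall y \near x, s y = 0.
Proof.
move=> [r [a [u [sa su E]]]] s0; have [F [Ft [FP gF _ indep _]]] := frames x.
have [pA injA surjA] := EA.
have /choice[t tP] m : exists t, section t (p x) /\ \forall q \near p x, forall g, smooth g q ->
    anchor (t q) g = F m q g.
  by have [vF pF _ _ _] := FP m; have [t st tE] := surjA _ _ vF pF; exists t.
have /choice[b bP] (i : 'I_r) : exists b : 'I_n -> M -> R, (forall m, smooth (b m) (p x)) /\
    \forall q \near p x, u i q = \sum_m b m q *: t m q.
  have [b [sb bE]] := gF _ (anchor_smooth (su i)) (pA _ _ (su i)); exists b; split=> //.
  have sd : section (fun q => -1 *: (\sum_m b m q *: t m q) + u i q) (p x).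
    apply: section_comb => //; first exact: mfd_smooth_cst.
    by apply: section_sum => m; apply: sectionZ => //; exact: (tP m).1.
  have tE : \forall q \near p x, forall m g, smooth g q -> anchor (t m q) g = F m q g.
    by apply: near_all => m; exact: (tP m).2.
  have := injA _ _ sd; move=> H; have {}H : \forall q \near p x, -1 *: (\sum_m b m q *: t m q) + u i q = 0.
    apply: H; have := near_and bE tE; apply: near_imp => q [bq tq] g sg.
    rewrite anchor_linear // bq // anchor_sum //.
    by under eq_bigr => m _ do rewrite tq //; rewrite mulN1r addrC subrr.
  by apply: near_imp H => q /eqP; rewrite scaleN1r addrC subr_eq0 => /eqP.
pose B m y := \sum_i a i y * b i m (p y).
have sB m : smooth (B m) x.
  apply: mfd_smooth_sum => i _; apply: mfd_smoothM => //.
  by apply: smooth_map_comp => //; exact: (bP i).1.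
have uE : \forall y \near x, forall i, u i (p y) = \sum_m b i m (p y) *: t m (p y).
  by apply: near_all => i; apply: (near_p (bP i).2).
have sE : \forall y \near x, s y = \sum_m B m y *: t m (p y).
  have := near_and E uE; apply: near_imp => y [-> uy].
  under eq_bigr => i _ do rewrite uy scaler_sumr.
  rewrite exchange_big; apply: eq_bigr => m _ /=; rewrite scaler_suml.
  by apply: eq_bigr => i _; rewrite scalerA.
have tE : \forall y \near x, forall m g, smooth g (p y) -> anchor (t m (p y)) g = F m (p y) g.
  by apply: near_all => m; apply: (near_p (tP m).2).
have B0 : \forall y \near x, forall m, B m y = 0.
  apply: indep => //; have := near_and s0 (near_and sE tE); apply: near_imp => y [sy [Ey ty]] g sg.
  have := sy _ (smooth_map_comp sp sg); rewrite -pullback_anchor_related // Ey anchor_sum //.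
  by under eq_bigr => m _ do rewrite ty //.
have := near_and sE B0; apply: near_imp => y [-> By].
by rewrite big1 // => m _; rewrite By scale0r.
Qed.

Lemma pullback_anchor_involutive (s s' : forall y, A (p y)) x :
  pullback_section s x -> pullback_section s' x ->
  exists2 r, pullback_section r x & \forall y \near x, forall f, smooth f y ->
    pullback_anchor (r y) f =
    commutator (fun y => pullback_anchor (s y)) (fun y => pullback_anchor (s' y)) y f.
Proof.
move=> ss st; apply: pullback_anchor_surj.
  by apply: vector_field_commutator; exact: pullback_anchor_smooth.
by apply: (preserves_commutator idIt); exact: pullback_anchor_preserves.
Qed.

Definition pullback_algebroid : lie_algebroid Mt :=
  @anchored_algebroid R n Mt pullback_bundle pullback_anchor pullback_anchor_tangent
    pullback_anchor_linear pullback_anchor_smooth pullback_anchor_inj pullback_anchor_involutive.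

Lemma pullback_elliptic : elliptic_tangent_bundle It pullback_algebroid.
Proof.
split; [exact: pullback_anchor_preserves|exact: pullback_anchor_inj|].
by move=> Z x vZ pZ; have [s ss sE] := pullback_anchor_surj vZ pZ; exists s.
Qed.

Lemma pullback_section_comp t x : section t (p x) -> pullback_section (fun y => t (p y)) x.
Proof.
move=> st; exists 1%N, (fun _ _ => 1), (fun=> t); split=> //; first by move=> _; exact: mfd_smooth_cst.
by apply: near_true => y; rewrite big_ord1 scale1r.
Qed.

(** Related fields have related commutators: each relation is used once for g and once for the
    derivative of g along the other section. *)
Lemma related_commutator t u T U x : section t (p x) -> section u (p x) ->
  vector_field T x -> vector_field U x ->
  related_near (fun q => anchor (t q)) T x -> related_near (fun q => anchor (u q)) U x ->
  related_near (fun q => anchor (bracket t u q)) (commutator T U) x.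
Proof.
move=> st su vT vU rT rU.
have H (w : forall q, A q) W y g : section w (p y) -> vector_field W y ->
    related_near (fun q => anchor (w q)) W y -> smooth g (p y) ->
    (\forall z \near y, W z (g \o p) = anchor (w (p z)) g).
  move=> sw vW rW sg; have := near_and rW (near_p (mfd_smooth_near sg)).
  by apply: near_imp => z [Wz sgz]; rewrite Wz.
have := near_and (near_and (near_and (near_near rT) (near_near rU))
    (near_and (near_vector_field vT) (near_vector_field vU)))
  (near_and (near_p (near_section st)) (near_p (near_section su))).
apply: near_imp => y [[[rTy rUy] [vTy vUy]] [sty suy]] g sg.
have sat : smooth (fun q => anchor (t q) g) (p y).
  exact: (vector_field_smooth (anchor_smooth sty) sg).
have sau : smooth (fun q => anchor (u q) g) (p y).
  exact: (vector_field_smooth (anchor_smooth suy) sg).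
have sgp := smooth_map_comp sp sg.
rewrite anchor_bracket // /commutator.
rewrite (tangent_congr (vector_field_tangent vTy) (vector_field_smooth vUy sgp) (H _ _ _ _ suy vUy rUy sg)).
rewrite (tangent_congr (vector_field_tangent vUy) (vector_field_smooth vTy sgp) (H _ _ _ _ sty vTy rTy sg)).
by congr (_ - _); [exact: (nbhs_singleton rTy _ sau)|exact: (nbhs_singleton rUy _ sat)].
Qed.

(** The bracket formula becomes the Leibniz rule for commutators of combinations of the lifts: its
    right-hand side is a section, so it is the bracket as soon as its anchor is the commutator. *)
Lemma pullback_morphism :
  @lie_algebroid_morphism R n n Mt M pullback_algebroid A p (fun x v => v).
Proof.
split=> //.
- exact: pullback_anchor_related.
move=> s s' x ss ss' r a t r' b u [sa st sE] [sb su s'E].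
have /choice[T TP] i := anchor_lift (st i); have /choice[U UP] j := anchor_lift (su j).
have vT i : vector_field (T i) x by have [] := TP i.
have vU j : vector_field (U j) x by have [] := UP j.
have rT i : related_near (fun q => anchor (t i q)) (T i) x by have [] := TP i.
have rU j : related_near (fun q => anchor (u j q)) (U j) x by have [] := UP j.
pose rhs y : A (p y) := \sum_i \sum_j (a i y * b j y) *: bracket (t i) (u j) (p y)
  + \sum_j pullback_anchor (s y) (b j) *: u j (p y)
  - \sum_i pullback_anchor (s' y) (a i) *: t i (p y).
have sa' i : smooth (fun y => pullback_anchor (s' y) (a i)) x.
  exact: (vector_field_smooth (pullback_anchor_smooth ss') (sa i)).
have sb' j : smooth (fun y => pullback_anchor (s y) (b j)) x.
  exact: (vector_field_smooth (pullback_anchor_smooth ss) (sb j)).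
have srhs : @section R n Mt pullback_bundle rhs x.
  apply: sectionD; last first.
    apply: sectionN; apply: section_sum => i; apply: sectionZ => //.
    exact: pullback_section_comp.
  apply: sectionD; last first.
    by apply: section_sum => j; apply: sectionZ => //; exact: pullback_section_comp.
  apply: section_sum => i; apply: section_sum => j; apply: sectionZ; first exact: mfd_smoothM.
  by apply: pullback_section_comp; exact: bracket_section.
apply: (@anchored_bracket_eq R n Mt pullback_bundle pullback_anchor pullback_anchor_linear
  pullback_anchor_inj s s' rhs x ss ss' srhs).
have nS : \forall y \near x, forall f, smooth f y -> pullback_anchor (s y) f = \sum_i a i y * T i y f.
  by have := near_and sE (pullback_anchor_sum st vT rT); apply: near_imp => y [-> Ey] f; exact: Ey.
have nS' : \forall y \near x, forall f, smooth f y -> pullback_anchor (s' y) f = \sum_j b j y * U j y f.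
  by have := near_and s'E (pullback_anchor_sum su vU rU); apply: near_imp => y [-> Ey] f; exact: Ey.
have nT : \forall y \near x, forall i, [/\ section (t i) (p y), vector_field (T i) y,
    related_near (fun q => anchor (t i q)) (T i) y & smooth (a i) y].
  apply: near_all => i; have := near_and (near_and (near_p (near_section (st i)))
    (near_vector_field (vT i))) (near_and (near_near (rT i)) (mfd_smooth_near (sa i))).
  by apply: near_imp => y [[? ?] [? ?]].
have nU : \forall y \near x, forall j, [/\ section (u j) (p y), vector_field (U j) y,
    related_near (fun q => anchor (u j q)) (U j) y & smooth (b j) y].
  apply: near_all => j; have := near_and (near_and (near_p (near_section (su j)))
    (near_vector_field (vU j))) (near_and (near_near (rU j)) (mfd_smooth_near (sb j))).
  by apply: near_imp => y [[? ?] [? ?]].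
have nss := near_and (@near_section R n Mt pullback_bundle s x ss)
  (@near_section R n Mt pullback_bundle s' x ss').
have := near_and (near_and nT nU) (near_and nss (near_and (near_near nS) (near_near nS'))).
apply: near_imp => y [[Ty Uy] [[ssy ss'y] [Sy S'y]]] f sf.
have vTy i : vector_field (T i) y by have [] := Ty i.
have vUy j : vector_field (U j) y by have [] := Uy j.
have say i : smooth (a i) y by have [] := Ty i.
have sby j : smooth (b j) y by have [] := Uy j.
have vUS : vector_field (fun y g => \sum_j b j y * U j y g) y by exact: vector_field_lin.
rewrite (commutator_congr (pullback_anchor_smooth ssy) (pullback_anchor_smooth ss'y) sf Sy S'y).
rewrite commutator_suml //.
under eq_bigr => i _ do rewrite commutator_sumr // mulrDr !mulr_sumr.
rewrite big_split /= /rhs.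
have aD := @ancD R n Mt pullback_bundle pullback_anchor pullback_anchor_linear y.
have aN := @ancN R n Mt pullback_bundle pullback_anchor pullback_anchor_linear y.
have aS := @anc_sum R n Mt pullback_bundle pullback_anchor pullback_anchor_linear y.
rewrite aD // aD // aN // !aS //.
(* The commutator of the lifts is a lift of the bracket of the sections. *)
have C i j : pullback_anchor (bracket (t i) (u j) (p y)) f = commutator (T i) (U j) y f.
  have [st' vT' rT' _] := Ty i; have [su' vU' rU' _] := Uy j.
  apply: pullback_anchorE => //; first exact: bracket_section.
    exact: vector_field_commutator.
  exact: related_commutator.
have pT i : pullback_anchor (t i (p y)) f = T i y f.
  by have [st' vT' rT' _] := Ty i; exact: pullback_anchorE.
have pU j : pullback_anchor (u j (p y)) f = U j y f.
  by have [su' vU' rU' _] := Uy j; exact: pullback_anchorE.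
congr (_ + _ - _).
- have := aS 'I_r (fun=> 1) (fun i => \sum_j (a i y * b j y) *: bracket (t i) (u j) (p y)) f sf.
  rewrite (eq_bigr (fun i => \sum_j (a i y * b j y) *: bracket (t i) (u j) (p y))); last first.
    by move=> i _; rewrite scale1r.
  move=> ->; apply: eq_bigr => i _; rewrite mul1r aS //.
  by apply: eq_bigr => j _; rewrite C mulrA.
- rewrite exchange_big; apply: eq_bigr => j _ /=; rewrite pU (nbhs_singleton Sy) // mulr_suml.
  by apply: eq_bigr => i _; rewrite mulrA.
- by apply: eq_bigr => i _; rewrite pT (nbhs_singleton S'y).
Qed.

End LiftedAlgebroid.

Theorem theorem6p9 (R : realType) (n k l : nat) (M Mt : manifold R n)
    (I : M -> set (M -> R)) (Y : set M) (IY : M -> set (M -> R[i]))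
    (p : Mt -> M) :
  elliptic_divisor I ->
  irreducible_component I k Y ->
  holomorphic_ideal l Y IY ->
  adapted l Y IY I ->
  blowup IY p ->
  exists It : Mt -> set (Mt -> R),
    elliptic_divisor It /\
    forall A : lie_algebroid M, elliptic_tangent_bundle I A ->
    exists At : lie_algebroid Mt,
      elliptic_tangent_bundle It At /\
      exists Phi : forall x, At x -> A (p x),
        lie_algebroid_morphism Phi /\ forall x, bijective (Phi x).
Proof.
move=> eI _ hY aY bp; have [sp _ _] := bp; have [idI _] := eI; have [_ idY _ _] := hY.
have atl x := blowup_coordinates_at bp idY x eI hY aY.
have eIt := lifted_elliptic_divisor sp atl; have [idIt _] := eIt.
exists (lifted_ideal l I IY p); split=> // A EA.
(* Near each point, the standard frame in an adapted chart of M and its lift have all the required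
   properties. *)
have frames x : exists F Ft, lifting_frame p I (lifted_ideal l I IY p) x F Ft.
  have [d [c [k' [l' [j [dx bd]]]]]] := atl x.
  have [_ cd _ _ _] := blowup_ellipticity bd; have [[[cc _ _] _ _] _ _ dE] := bd.
  have [cx _] := dE x dx.
  exists (fun m => std c k' m), (fun m => lifted_std d k' l' j m); split.
  - move=> m; split; first exact: vector_field_std.
    + exact: (preserves_std bd idI).
    + exact: (vector_field_lifted_std bd).
    + exact: (preserves_lifted_std sp bd idIt).
    + by apply: near_imp (cdom_near cd dx) => y dy g sg; exact: (lifted_std_related sp bd).
  - by move=> X; exact: (preserves_std_sum bd).
  - by move=> Z; exact: (preserves_lifted_std_sum sp bd).
  - by move=> b; exact: (std_independent bd).
  - by move=> Z; exact: (related0 bd).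
exists (pullback_algebroid sp idIt frames EA); split; first exact: pullback_elliptic.
exists (fun x v => v); split; first exact: pullback_morphism.
by move=> x; exists id.
Qed.
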